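(* Let $R$ be a root system in $\mathbb{R}^n$ with positive subsystem $R_+$ and Weyl group $W$, let $E=\mathbb{R}^n\setminus\bigcup_{\alpha\in R}H_\alpha$, let $C$ be a Weyl chamber and $\pi:E\to \overline C$ the projection onto it. Suppose that $k:R\to[\frac12,+\infty)$ is a $W$-invariant multiplicity function and $l:R\to[0,+\infty)$ is a function, and for $u\in\mathbf{C}^\infty_K(E)$, $x\in E$ let $$\mathcal{L}_{k,l}u(x)=\frac12\Delta u(x)+\sum_{\alpha\in R_+}k(\alpha)\frac{\nabla u(x)\cdot\alpha}{x\cdot\alpha}+\sum_{\alpha\in R_+}l(\alpha)\frac{u(\sigma_\alpha x)-u(x)}{(x\cdot\alpha)^2}.$$ Then for every Borel probability measure $\nu$ on $E$, if there exists a solution of the $\mathbf{D}^\pi_E[0,\infty)$ martingale problem $(\mathcal{L}_{k,l},\nu)$, then it is unique (in law).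
   Context: A root system is a finite set $R\subset\mathbb{R}^n\setminus\{0\}$ with $R\cap\mathbb{R}\alpha=\{\pm\alpha\}$ and $\sigma_\alpha(R)=R$ for all $\alpha\in R$, where $\sigma_\alpha$ is the orthogonal reflection in the hyperplane $H_\alpha=\alpha^\perp$. Roots are normalized by $\alpha\cdot\alpha=2$, so $\sigma_\alpha(x)=x-(\alpha\cdot x)\alpha$. The (finite) Weyl group $W$ is generated by $\{\sigma_\alpha:\alpha\in R\}$. A positive subsystem is $R_+=\{\alpha\in R:\alpha\cdot\beta>0\}$ for some $\beta\notin\bigcup_{\alpha\in R}H_\alpha$. $k$ is $W$-invariant if $k(w\alpha)=k(\alpha)$ for all $w\in W$, $\alpha\in R$. A Weyl chamber is a connected component of $E$, and $\pi$ sends $x$ to the unique point of $Wx\cap\overline C$. $\mathbf{C}^\infty_K(E)$ is the space of compactly supported $C^\infty$ functions on $E$. $\mathbf{D}^\pi_E[0,\infty)$ is the set of right-continuous functions $\omega:[0,\infty)\to E$ with left limits in $E$ such that $\pi\circ\omega$ is continuous with values in $C$. A process $X$ is a solution of the $\mathbf{D}^\pi_E[0,\infty)$ martingale problem $(\mathcal{A},\nu)$, where $\mathcal{A}$ has domain $\mathbf{C}^\infty_K(E)$, if $X$ has sample paths in $\mathbf{D}^\pi_E[0,\infty)$, $X_0$ has law $\nu$, and for every $u\in\mathbf{C}_K^\infty(E)$ the process $u(X_t)-u(X_0)-\int_0^t\mathcal{A}u(X_s)\,ds$ is a martingale with respect to the natural filtration of $X$. *)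

(* Defs.v *)
(* MathComp / MathComp-Analysis *)
From HB Require Import structures.
From mathcomp Require Import all_boot all_order all_algebra.
From mathcomp Require Import all_classical all_reals all_analysis.

Set Implicit Arguments.
Unset Strict Implicit.
Unset Printing Implicit Defensive.

Import Order.TTheory GRing.Theory Num.Theory.
Import numFieldNormedType.Exports.

Local Open Scope classical_set_scope.
Local Open Scope ring_scope.

Section RootSystems.
Context {R : realType} {n : nat}.
Local Notation V := 'rV[R]_n.
Implicit Types (Phi : set V) (x y a : V).

Definition dot x y : R := \sum_i x 0 i * y 0 i.

Definition hyperplane a : set V := [set x | dot a x = 0].

(* The orthogonal reflection in the hyperplane of a, for roots normalized by
   dot a a = 2. *)
Definition reflection a x : V := x - dot a x *: a.

Record root_system Phi : Prop := RootSystem {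
  root_finite : finite_set Phi ;
  root_neq0 : forall a, Phi a -> a != 0 ;
  root_norm : forall a, Phi a -> dot a a = 2 ;
  root_line : forall a, Phi a -> Phi `&` range (fun c : R => c *: a) = [set a; - a] ;
  root_reflection : forall a, Phi a -> reflection a @` Phi = Phi }.

(* The subgroup of the bijections of R^n generated by the reflections. *)
Inductive weyl_group Phi : set (V -> V) :=
| weyl_refl a : Phi a -> weyl_group Phi (reflection a)
| weyl_id : weyl_group Phi id
| weyl_comp v w : weyl_group Phi v -> weyl_group Phi w ->
    weyl_group Phi (v \o w)
| weyl_inv v w : weyl_group Phi v -> cancel v w -> cancel w v ->
    weyl_group Phi w.

Definition weyl_invariant Phi (k : V -> R) : Prop :=
  forall w a, weyl_group Phi w -> Phi a -> k (w a) = k a.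

Definition regular_set Phi : set V := ~` \bigcup_(a in Phi) hyperplane a.

Definition positive_subsystem Phi (Phip : set V) : Prop :=
  exists2 b, regular_set Phi b & Phip = [set a | Phi a /\ 0 < dot a b].

Definition weyl_chamber Phi (C : set V) : Prop :=
  exists2 x, regular_set Phi x & C = connected_component (regular_set Phi) x.

Definition weyl_orbit Phi x : set V := [set w x | w in weyl_group Phi].

Definition weyl_proj Phi (C : set V) x : V :=
  get (weyl_orbit Phi x `&` closure C).

End RootSystems.

Section Operator.
Context {R : realType} {n : nat}.
Local Notation V := 'rV[R]_n.
Implicit Types (Phi Phip : set V) (u : V -> R) (x : V).

Definition partial (i : 'I_n) u : V -> R := fun x => 'D_(delta_mx 0 i) u x.

Definition smooth u : Prop := forall s : seq 'I_n,
  let v := foldr partial u s in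
  continuous v /\ forall (i : 'I_n) x, derivable v x (delta_mx 0 i).

(* A function in C_K^oo(D), for D open, is represented by its extension by 0
   to R^n, which is smooth on R^n. *)
Definition CK_infty (D : set V) : set (V -> R) :=
  [set u | [/\ smooth u, compact (closure [set x | u x != 0]) &
               closure [set x | u x != 0] `<=` D]].

Definition gradient u x : V := \row_i partial i u x.

Definition laplacian u x : R := \sum_i partial i (partial i u) x.

(* k and l are only evaluated on roots. *)
Definition dunkl_laplacian Phip (k l : V -> R) u x : R :=
  2^-1 * laplacian u x
  + \sum_(a \in Phip) k a * (dot (gradient u x) a / dot x a)
  + \sum_(a \in Phip) l a * ((u (reflection a x) - u x) / dot x a ^+ 2).

End Operator.

Section Paths.
Context {R : realType} {n : nat}.
Local Notation V := 'rV[R]_n.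
Implicit Types (Phi C : set V).

(* Time is indexed by R, but only the times t >= 0 matter, here and below. *)
Definition Dpi_paths Phi C : set (R -> V) :=
  [set p | [/\ forall t : R, 0 <= t -> regular_set Phi (p t),
     forall t : R, 0 <= t -> p s @[s --> t^'+] --> p t,
     forall t : R, 0 < t ->
       exists2 y, regular_set Phi y & p s @[s --> t^'-] --> y,
     {within `[0, +oo[, continuous (weyl_proj Phi C \o p)} &
     forall t : R, 0 <= t -> C (weyl_proj Phi C (p t))]].

End Paths.

Notation borel_rV R n := (g_sigma_algebraType (@open 'rV[R]_n)).

Section MartingaleProblem.
Context {R : realType} {n : nat} {d : measure_display} {T : measurableType d}.
Variable P : probability T R.
Local Notation V := 'rV[R]_n.
Implicit Types (G : set (set T)) (F : R -> set (set T)).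

(* Z is a version of the conditional expectation of Y given G. *)
Definition is_cond_exp G (Y Z : T -> R) : Prop :=
  [/\ forall B : set R, measurable B -> G (Z @^-1` B),
      P.-integrable setT (EFin \o Z) &
      forall A, G A ->
        (\int[P]_(w in A) (Z w)%:E = \int[P]_(w in A) (Y w)%:E)%E].

Definition is_martingale F (M : R -> T -> R) : Prop :=
  [/\ forall t : R, 0 <= t -> forall B : set R, measurable B -> F t (M t @^-1` B),
      forall t : R, 0 <= t -> P.-integrable setT (EFin \o M t) &
      forall s t : R, 0 <= s -> s <= t -> is_cond_exp (F s) (M t) (M s)].

Definition natural_filtration (X : R -> T -> V) (t : R) : set (set T) :=
  <<s [set A | exists (s : R) (B : set (borel_rV R n)),
         [/\ 0 <= s, s <= t, measurable B & A = X s @^-1` B]] >>.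

Record martingale_problem_solution (paths : set (R -> V)) (dom : set (V -> R))
    (A : (V -> R) -> V -> R) (nu : probability (borel_rV R n) R)
    (X : R -> T -> V) : Prop := MartingaleProblemSolution {
  solution_measurable : forall t : R, 0 <= t ->
    measurable_fun setT (X t : T -> borel_rV R n) ;
  solution_paths : forall w, paths (fun t => X t w) ;
  solution_initial : forall B : set (borel_rV R n), measurable B ->
    P (X 0 @^-1` B) = nu B ;
  solution_martingale : forall u, dom u ->
    is_martingale (natural_filtration X)
      (fun t w => u (X t w) - u (X 0 w)
         - \int[lebesgue_measure]_(s in `[0, t]) A u (X s w)) }.

End MartingaleProblem.

(* Generated by the evaluations at times t >= 0; its trace on a set of paths
   is the sigma-algebra on which the law of a process with those paths lives. *)
Definition path_sigma_algebra {R : realType} {n : nat} :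
    set (set (R -> 'rV[R]_n)) :=
  <<s [set A | exists (t : R) (B : set (borel_rV R n)),
         [/\ 0 <= t, measurable B & A = [set p | B (p t)]]] >>.

Definition same_law {R : realType} {n : nat} {d1 d2 : measure_display}
    {T1 : measurableType d1} {T2 : measurableType d2}
    (P1 : probability T1 R) (X1 : R -> T1 -> 'rV[R]_n)
    (P2 : probability T2 R) (X2 : R -> T2 -> 'rV[R]_n) : Prop :=
  forall A, path_sigma_algebra A ->
    P1 [set w | A (fun t => X1 t w)] = P2 [set w | A (fun t => X2 t w)].

(* Main.v *)
(** Let [X] solve the martingale problem and let [A] be an event observed up to
    time [s].  For lambda > 0 the functional
      theta u = \int_s^oo exp(-lambda t) E[1_A u(X_t)] dt
    is positive and satisfies theta (lambda u - L u) = exp(-lambda s) E[1_A u(X_s)]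
    for every test function [u].  If two such functionals theta_1, theta_2 have
    the same right-hand side, then they agree on C_c(E), by an argument of Kato
    type.  The equation is tested with u = rho(. - z) exp(-logw), where [rho] is
    a mollifier and exp(logw) is the weight prod_alpha |x.alpha|^k(alpha), which
    removes the drift.  This gives an equation for the mollified difference at
    [z]; it is multiplied by the sign of that difference and by
    exp(logw(z)) psi_N(z) and summed over a fine lattice of points [z].  A
    discrete summation by parts moves the second differences onto the smooth
    factor, and the jump terms are harmless because the weight is W-invariant
    and lattice sums are asymptotically invariant under reflections.  What
    remains is
      lambda |theta_1 - theta_2|(psi_N) <= (theta_1 + theta_2)((L psi_N)^-) + o(1).
    The cutoff is psi_N = exp(-1/(1/2 - phi/(2N))) with phi = A |x|^2 - logw.
    Since k >= 1/2, L logw = sum_alpha k (2k - 1) / (x.alpha)^2 >= 0, so L phi is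
    bounded above, L psi_N >= -c/N, and the right-hand side vanishes as N tends
    to infinity.

    The Laplace transform in time is injective on bounded right-continuous
    functions, so E[1_A u(X_t)] is determined for all t >= s by the law of X_s
    under 1_A P.  Applied to cylinder events A, by induction on the number of
    times, this determines the finite-dimensional laws. *)

Require Import Defs.
From HB Require Import structures.
From mathcomp Require Import all_boot all_order all_algebra.
From mathcomp Require Import ring lra zify.
From mathcomp Require Import all_classical all_reals all_analysis measurable_realfun.
Import Order.TTheory GRing.Theory Num.Theory.
Import numFieldNormedType.Exports.
Local Open Scope classical_set_scope.
Local Open Scope ring_scope.
Set Implicit Arguments.
Unset Strict Implicit.
Unset Printing Implicit Defensive.

(** * Smooth functions *)

(** The difference of the two functionals is a distribution on E without a density, so neither its
    sign nor the Laplacian of its absolute value makes sense; hence the mollification. This commutes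
    with the second-order part only once the drift is gone, hence the weight; the errors from
    potential and jump rates are controlled by their oscillation om over the support of the
    mollifier. For second differences Kato's inequality is plain algebra, valid for merely
    continuous functions, and on a lattice every superposition of test functions is finite, so
    linearity and positivity are all that is asked of the functionals. Lattice sums carry no volume
    factor: they are measured against the lattice mass of the mollifier, which cancels in the end.
    The constants are chosen in the order N, om, radius of the mollifier, mesh. What is shown to
    vanish with N is the integral of |L psi_N|: by the lower bound on L psi_N it equals the integral
    of L psi_N up to O(1/N), and the resolvent equation bounds the latter by the mass that psi_N
    misses at time s, which tends to 0 because the paths live in E. *)

Section Flat.
Context {R : realType}.
Implicit Types (r h : R) (j : nat).

(* flat 0 r = exp(-1/r) for 0 < r; the powers of 1/r close the family under
   differentiation. *)
Definition flat j r : R := if 0 < r then r^-1 ^+ j * expR (- r^-1) else 0.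

Lemma flat_ge0 j r : 0 <= flat j r.
Proof.
rewrite /flat; case: ifPn => // r0.
by rewrite mulr_ge0 ?expR_ge0// exprn_ge0// invr_ge0 ltW.
Qed.

(** With [t = 1/r] this is [t^j exp(-t) <= j!], one term of the exponential series. *)
Lemma flat_le_fact j r : flat j r <= (j`!%:R : R).
Proof.
rewrite /flat; case: ifPn => [r0|_]; last by rewrite ler0n.
set t := r^-1; have t0 : 0 <= t by rewrite invr_ge0 ltW.
rewrite expRN ler_pdivrMr ?expR_gt0//.
case: j => [|j].
  by rewrite expr0 fact0 mul1r (le_trans _ (expR_ge1Dx t))// lerDl.
rewrite -ler_pdivrMl ?ltr0n ?fact_gt0// mulrC.
by rewrite (le_trans _ (expR_ge1Dxn j t0))// lerDr.
Qed.

Lemma flat_le_linear j r : 0 <= r -> flat j r <= (j.+1`!%:R : R) * r.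
Proof.
move=> r0; have [->|rn0] := eqVneq r 0; first by rewrite /flat ltxx mulr0.
have r1 : 0 < r by rewrite lt0r rn0.
rewrite -ler_pdivrMr//; apply: le_trans (flat_le_fact _ r).
by rewrite /flat r1 exprS mulrC mulrA.
Qed.

(** Multiplication by [r^2] lowers the index by two, so the factorial bound at [j + 2] gives
    quadratic flatness at 0, as differentiability there requires. *)
Lemma flat_le_square j r : `|flat j r| <= (j.+2`!%:R : R) * r ^+ 2.
Proof.
rewrite ger0_norm ?flat_ge0//.
have [r0|r0] := ltP 0 r; last first.
  by rewrite /flat ltNge r0/= mulr_ge0 ?sqr_ge0.
have := flat_le_linear j.+1 (ltW r0).
rewrite /flat r0 exprS -mulrA -ler_pdivlMl ?invr_gt0// invrK => h.
by rewrite (le_trans h)// expr2 mulrCA.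
Qed.

Lemma flat0_le r h : r <= h -> flat 0 r <= flat 0 h.
Proof.
move=> rh; have [r0|r0] := ltP 0 r; last by rewrite {1}/flat ltNge r0 flat_ge0.
have h0 := lt_le_trans r0 rh.
by rewrite /flat r0 h0 !expr0 !mul1r ler_expR lerN2 lef_pV2 ?posrE.
Qed.

Lemma is_derive_inv r : r != 0 ->
  is_derive r 1 (fun s : R => s^-1) (- (r ^- 2)).
Proof.
move=> rn0; have h := @is_deriveV R id r 1 1 rn0 (is_derive_id _ _).
by move: h; rewrite /GRing.scale/= mulr1.
Qed.

Lemma is_derive_flat j r :
  is_derive r 1 (flat j) (flat j.+2 r - j%:R * flat j.+1 r).
Proof.
have [r0|r0|r0] := ltgtP 0 r.
- pose F := fun s : R => s^-1 ^+ j * expR (- s^-1).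
  have rn0 : r != 0 by rewrite gt_eqF.
  have h1 := is_derive_inv rn0.
  have h2 : is_derive r 1 (fun s : R => expR (- s^-1)) (expR (- r^-1) * r ^- 2).
    apply: (@is_derive1_comp _ expR (fun s => - s^-1)).
    by rewrite -[r ^- 2]opprK; exact: is_deriveN.
  have h3 : is_derive r 1 (fun s : R => s^-1 ^+ j)
      (j%:R * r^-1 ^+ j.-1 * - (r ^- 2)).
    have h := @is_deriveX R R (fun s : R => s^-1) j r 1 _ h1.
    by rewrite exprfctE in h; apply: is_derive_eq h _.
  have h4 : is_derive r 1 F (flat j.+2 r - j%:R * flat j.+1 r).
    have h := is_deriveM h3 h2.
    apply: (is_derive_eq h); rewrite /flat r0 /GRing.scale/=.
    by case: (j) => [|i]; rewrite /= !exprS; field.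
  apply: near_eq_is_derive h4.
  near=> s; rewrite /F /flat ifT//; near: s; exact: lt_nbhsr.
- have h4 : is_derive r 1 (cst 0 : R -> R) (flat j.+2 r - j%:R * flat j.+1 r).
    rewrite /flat !ltNge (ltW r0)/= mulr0 subr0; exact: is_derive_cst.
  apply: near_eq_is_derive h4.
  near=> s; rewrite /flat ifF//; apply/negbTE; rewrite -leNgt ltW//.
  near: s; exact: lt_nbhsl.
(* At 0 the slope function is [flat j z / z], which is O(|z|) by quadratic flatness. *)
- rewrite -r0; apply/is_derive1_caratheodory.
  exists (fun z => flat j z / z); rewrite /flat ltxx; split.
  + move=> z; rewrite !subr0; have [->|z0] := eqVneq z 0.
      by rewrite ltxx mulr0.
    by rewrite divfK.
  + apply/cvgrPdist_le => /= e e0; rewrite ltxx mul0r.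
    near=> z; rewrite sub0r normrN.
    have [->|z0] := eqVneq z 0; first by rewrite invr0 mulr0 normr0 ltW.
    have := flat_le_square j z; rewrite /flat normrM normrV ?unitfE// => h.
    rewrite ler_pdivrMr ?normr_gt0// (le_trans h)// -real_normK ?num_real//.
    rewrite expr2 mulrA ler_wpM2r// -ler_pdivlMl ?ltr0n ?fact_gt0//.
    near: z; apply: cvgr0_norm_le => //; rewrite mulr_gt0// invr_gt0 ltr0n fact_gt0//.
  + by rewrite mulr0 subr0 invr0 mulr0.
Unshelve. all: by end_near. Qed.

Lemma continuous_flat j : continuous (flat j).
Proof.
move=> r; apply/differentiable_continuous/derivable1_diffP.
by have [] := is_derive_flat j r.
Qed.

End Flat.

Section Elementary.
Context {R : realType} {n : nat}.
Local Notation V := 'rV[R]_n.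
Implicit Types (D : set V) (u v f g : V -> R) (x : V).

(** A syntactic class of explicit functions, closed under partial derivatives on [D], so that
    smoothness is checked by structure alone. [D] is where the inverses and logarithms make sense;
    elsewhere these total functions take default values. *)
Inductive elementary D : (V -> R) -> Prop :=
| elementary_cst c : elementary D (cst c)
| elementary_coord i : elementary D (fun x => x 0 i)
| elementary_add u v : elementary D u -> elementary D v ->
    elementary D (fun x => u x + v x)
| elementary_mul u v : elementary D u -> elementary D v ->
    elementary D (fun x => u x * v x)
| elementary_inv u : elementary D u -> (forall x, D x -> u x != 0) ->
    elementary D (fun x => (u x)^-1)
| elementary_expR u : elementary D u -> elementary D (fun x => expR (u x))
| elementary_ln u : elementary D u -> (forall x, D x -> 0 < u x) ->
    elementary D (fun x => ln (u x))
| elementary_flat j u : elementary D u -> elementary D (fun x => flat j (u x)).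

Lemma elementaryS D D' u : D' `<=` D -> elementary D u -> elementary D' u.
Proof.
move=> sD; elim=> {u}.
- exact: elementary_cst.
- exact: elementary_coord.
- by move=> u v _ ? _ ?; exact: elementary_add.
- by move=> u v _ ? _ ?; exact: elementary_mul.
- by move=> u _ eu u0; apply: elementary_inv => // x /sD; exact: u0.
- by move=> u _ ?; exact: elementary_expR.
- by move=> u _ eu u0; apply: elementary_ln => // x /sD; exact: u0.
- by move=> j u _ ?; exact: elementary_flat.
Qed.

Lemma is_derive_comp_line (F : R -> R) f x w a b :
  is_derive (f x) 1 F a -> is_derive x w f b ->
  is_derive x w (fun y => F (f y)) (a * b).
Proof.
move=> [dF <-{a}] [df <-{b}].
(* A directional derivative is the derivative at 0 along the line [h *: w + x], which reduces the
   claim to the chain rule in one variable. *)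
have line (g : V -> R) : 'D_w g x = 'D_1 (fun h : R => g (h *: w + x)) 0.
  rewrite /derive; set g1 := fun h => h^-1 *: _; set g2 := fun h => h^-1 *: _.
  suff -> : g1 = g2 by [].
  by apply/funext => h; rewrite /g1 /g2/= addr0 scale0r add0r [_%:A]mulr1.
have df0 := df; move/derivable1P : df0 => df0.
have x0 : 0 *: w + x = x by rewrite scale0r add0r.
have dF0 : derivable F (f (0 *: w + x)) 1 := eq_ind_r (fun y => derivable F (f y) 1) dF x0.
have h := is_derive1_comp (derivableP dF0) (derivableP df0).
apply: DeriveDef; first by apply: (derivable1P (fun y => F (f y)) x w).2; case: h.
rewrite line; have /(@derive_val _ _ _) -> := h.
by rewrite scale0r add0r -line.
Qed.

Lemma differentiable_comp_line (F : R -> R) f x a :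
  is_derive (f x) 1 F a -> differentiable f x ->
  differentiable (fun y => F (f y)) x.
Proof.
move=> [dF _] df; apply: (@differentiable_comp _ _ _ _ f F) => //.
exact/derivable1_diffP.
Qed.

Lemma elementary_differentiable D u x :
  elementary D u -> D x -> differentiable u x.
Proof.
move=> + Dx; elim=> {u}.
- by move=> c; exact: differentiable_cst.
- by move=> i; exact: differentiable_coord.
- by move=> u v _ du _ dv; exact: differentiableD.
- by move=> u v _ du _ dv; exact: differentiableM.
- by move=> u _ du u0; apply: differentiableV => //; exact: u0.
- by move=> u _ du; apply: differentiable_comp_line du.
- by move=> u _ du u0; apply: differentiable_comp_line du; apply: is_derive1_ln; exact: u0.
- move=> j u _ du; apply: differentiable_comp_line du; exact: is_derive_flat.
Qed.

Lemma elementary_opp D u : elementary D u -> elementary D (fun x => - u x).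
Proof.
move=> eu; rewrite (_ : (fun x => - u x) = fun x => cst (-1) x * u x).
  by apply: elementary_mul => //; exact: elementary_cst.
by apply/funext => x; rewrite mulN1r.
Qed.

Lemma elementary_sub D u v : elementary D u -> elementary D v ->
  elementary D (fun x => u x - v x).
Proof. by move=> eu ev; apply: elementary_add => //; exact: elementary_opp. Qed.

Lemma elementary_sum D (I : Type) (s : seq I) (P : pred I) (F : I -> V -> R) :
  (forall i, P i -> elementary D (F i)) ->
  elementary D (fun x => \sum_(i <- s | P i) F i x).
Proof.
move=> eF; elim: s => [|i s ih].
  rewrite (_ : (fun _ => _) = cst 0); first exact: elementary_cst.
  by apply/funext => x; rewrite big_nil.
rewrite (_ : (fun x => _) = fun x =>
  (if P i then F i x else 0) + \sum_(i <- s | P i) F i x); last first.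
  by apply/funext => x; rewrite big_cons; case: ifPn => //; rewrite add0r.
apply: elementary_add => //; case: (boolP (P i)) => [/eF//|_].
exact: elementary_cst.
Qed.

Lemma elementary_dot D a : elementary D (fun x => dot x a).
Proof.
apply: elementary_sum => i _; apply: elementary_mul.
  exact: elementary_coord.
exact: elementary_cst.
Qed.

Lemma is_derive_coord x w i : is_derive x w (fun y : V => y 0 i) (w 0 i).
Proof.
have l : linear (fun y : V => y 0 i : R) by move=> c y z; rewrite !mxE.
apply: DeriveDef; first exact/diff_derivable/differentiable_coord.
apply: cvg_lim => //; apply: cvg_near_cst; near=> h.
rewrite /= !mxE addrK /GRing.scale/= mulrA mulVf ?mul1r//.
by near: h; exact: nbhs_dnbhs_neq.
Unshelve. all: by end_near. Qed.

Lemma elementary_partial D u i : elementary D u ->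
  exists2 v, elementary D v & forall x, D x -> partial i u x = v x.
Proof.
have der w x : differentiable w x ->
    is_derive x (delta_mx 0 i) w (partial i w x).
  by move=> dw; apply: DeriveDef => //; exact: diff_derivable.
have val w x d : is_derive x (delta_mx 0 i) w d -> partial i w x = d by case.
elim=> {u}.
- move=> c; exists (cst 0); first exact: elementary_cst.
  by move=> x _; rewrite /partial derive_cst.
- move=> j; exists (cst ((delta_mx 0 i : V) 0 j)); first exact: elementary_cst.
  by move=> x _; rewrite /partial; have [_ ->] := is_derive_coord x (delta_mx 0 i) j.
- move=> u v eu [u' eu' uu'] ev [v' ev' vv'].
  exists (fun x => u' x + v' x); first exact: elementary_add.
  move=> x Dx; rewrite -uu'// -vv'//.
  have := is_deriveD (der _ _ (elementary_differentiable eu Dx))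
    (der _ _ (elementary_differentiable ev Dx)).
  by move=> /(@derive_val _ _ _).
- move=> u v eu [u' eu' uu'] ev [v' ev' vv'].
  exists (fun x => u x * v' x + v x * u' x).
    by apply: elementary_add; apply: elementary_mul.
  move=> x Dx; rewrite -uu'// -vv'//.
  have := is_deriveM (der _ _ (elementary_differentiable eu Dx))
    (der _ _ (elementary_differentiable ev Dx)).
  by move=> /(@derive_val _ _ _).
- move=> u eu [u' eu' uu'] u0.
  exists (fun x => - ((u x)^-1 * (u x)^-1) * u' x).
    apply: elementary_mul => //; apply: elementary_opp.
    by apply: elementary_mul; apply: elementary_inv.
  move=> x Dx; rewrite -uu'//.
  rewrite /partial deriveV//; last 2 first.
  + exact: u0.
  + exact/diff_derivable/(elementary_differentiable eu).
  by rewrite /GRing.scale/= -expr2 exprVn.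
- move=> u eu [u' eu' uu'].
  exists (fun x => expR (u x) * u' x).
    by apply: elementary_mul => //; apply: elementary_expR.
  move=> x Dx; rewrite -uu'//.
  exact: val (is_derive_comp_line (is_derive_expR (u x))
    (der _ _ (elementary_differentiable eu Dx))).
- move=> u eu [u' eu' uu'] u0.
  exists (fun x => (u x)^-1 * u' x).
    apply: elementary_mul => //; apply: elementary_inv => // x Dx.
    by rewrite gt_eqF// u0.
  move=> x Dx; rewrite -uu'//.
  exact: val (is_derive_comp_line (is_derive1_ln (u0 _ Dx))
    (der _ _ (elementary_differentiable eu Dx))).
- move=> j u eu [u' eu' uu'].
  exists (fun x => (flat j.+2 (u x) - j%:R * flat j.+1 (u x)) * u' x).
    apply: elementary_mul => //; apply: elementary_sub.
      exact: elementary_flat.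
    apply: elementary_mul; first exact: elementary_cst.
    exact: elementary_flat.
  move=> x Dx; rewrite -uu'//.
  exact: val (is_derive_comp_line (is_derive_flat j (u x))
    (der _ _ (elementary_differentiable eu Dx))).
Qed.

Lemma partial_near i u v x : (\near x, u x = v x) ->
  partial i u x = partial i v x.
Proof. exact: near_eq_derive. Qed.

(** As [D] is open, an identity on [D] holds near each of its points and can be differentiated
    again. *)
Lemma elementary_partials D u v s : open D -> elementary D v ->
  (forall x, D x -> u x = v x) ->
  exists2 w, elementary D w & forall x, D x -> foldr partial u s x = w x.
Proof.
move=> oD ev uv; elim: s => [|i s [w ew sw]]; first by exists v.
have [t et wt] := elementary_partial i ew.
exists t => // x Dx; rewrite /= -wt//; apply: partial_near.
by move: oD; rewrite openE => /(_ _ Dx); apply: filterS => y Dy; exact: sw.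
Qed.

(** Near a point of [K] the function is elementary; near a point outside [K] it vanishes, the
    complement of [K] being open. Hence the extension by zero is smooth everywhere. *)
Lemma elementary_CK_infty D u v (K : set V) : open D -> elementary D v ->
  (forall x, D x -> u x = v x) ->
  compact K -> K `<=` D -> (forall x, ~ K x -> u x = 0) -> CK_infty D u.
Proof.
move=> oD ev uv cK KD u0.
have clK : closed K by apply: compact_closed => //; exact: norm_hausdorff.
have sK : closure [set x | u x != 0] `<=` K.
  have -> : K = closure K by exact/closure_id.
  apply: closureS => x /= ux.
  by apply: contrapT => /u0 /eqP; rewrite (negbTE ux).
have oK : open (~` K) by exact: closed_openC.
split; last 2 first.
- by apply: subclosed_compact cK sK; exact: closed_closure.
- exact: subset_trans sK KD.
move=> s.
have near_cont w x : {near x, w =1 foldr partial u s} -> differentiable w x ->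
    {for x, continuous (foldr partial u s)} /\
    forall i, derivable (foldr partial u s) x (delta_mx 0 i).
  move=> wE dw; split=> [|i]; last first.
    exact: near_eq_derivable wE (diff_derivable dw).
  rewrite /prop_for /continuous_at -(nbhs_singleton wE).
  exact: (cvg_trans (near_eq_cvg wE) (differentiable_continuous dw)).
suff H x : {for x, continuous (foldr partial u s)} /\
    forall i, derivable (foldr partial u s) x (delta_mx 0 i).
  by split=> [x|i x]; [exact: (H x).1|exact: (H x).2].
have [Kx|Kx] := pselect (K x).
  have [w ew wE] := elementary_partials s oD ev uv.
  apply: near_cont (elementary_differentiable ew (KD _ Kx)).
  move: oD; rewrite openE => /(_ _ (KD _ Kx)).
  by apply: filterS => y Dy; rewrite wE.
have z y : (~` K) y -> foldr partial u s y = 0.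
  elim: s {near_cont} y => [|i s ih] y Ky /=; first exact: u0.
  rewrite (@partial_near _ _ (cst 0)); first by rewrite /partial derive_cst.
  by move: oK; rewrite openE => /(_ _ Ky); apply: filterS => t; exact: ih.
apply: near_cont (@differentiable_cst _ _ _ 0 x).
move: oK; rewrite openE => /(_ _ Kx).
by apply: filterS => y /z ->.
Qed.

End Elementary.

(** * Root systems *)

Section Dot.
Context {R : realType} {n : nat}.
Local Notation V := 'rV[R]_n.
Implicit Types (x y z a b : V) (c : R).

Lemma dotC x y : dot x y = dot y x.
Proof. by apply: eq_bigr => i _; rewrite mulrC. Qed.

Lemma dotDl x y z : dot (x + y) z = dot x z + dot y z.
Proof. by rewrite -big_split; apply: eq_bigr => i _; rewrite mxE mulrDl. Qed.

Lemma dotZl c x y : dot (c *: x) y = c * dot x y.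
Proof. by rewrite /dot mulr_sumr; apply: eq_bigr => i _; rewrite mxE mulrA. Qed.

Lemma dotNl x y : dot (- x) y = - dot x y.
Proof. by rewrite -scaleN1r dotZl mulN1r. Qed.

Lemma dotBl x y z : dot (x - y) z = dot x z - dot y z.
Proof. by rewrite dotDl dotNl. Qed.

Lemma dotDr x y z : dot x (y + z) = dot x y + dot x z.
Proof. by rewrite dotC dotDl !(dotC x). Qed.

Lemma dotZr c x y : dot x (c *: y) = c * dot x y.
Proof. by rewrite dotC dotZl dotC. Qed.

Lemma dotNr x y : dot x (- y) = - dot x y.
Proof. by rewrite dotC dotNl dotC. Qed.

Lemma dotBr x y z : dot x (y - z) = dot x y - dot x z.
Proof. by rewrite dotDr dotNr. Qed.

Lemma dot_ge0 x : 0 <= dot x x.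
Proof. by apply: sumr_ge0 => i _; rewrite -expr2 sqr_ge0. Qed.

Lemma dot_eq0 x : (dot x x == 0) = (x == 0).
Proof.
apply/eqP/eqP => [|->]; last by rewrite /dot big1// => i _; rewrite mxE mul0r.
move=> /eqP; rewrite psumr_eq0; last by move=> i _; rewrite -expr2 sqr_ge0.
move=> /allP x0; apply/rowP => i; rewrite mxE; apply/eqP.
by have := x0 i (mem_index_enum _); rewrite -expr2 sqrf_eq0.
Qed.

Lemma coord_sqr_le_dot x i : x 0 i ^+ 2 <= dot x x.
Proof.
rewrite /dot (bigD1 i)//= expr2 lerDl; apply: sumr_ge0 => j _.
by rewrite -expr2 sqr_ge0.
Qed.

(** Cauchy-Schwarz, from expanding the square of [2 *: x - dot x a *: a]. *)
Lemma dot_sqr_le a x : dot a a = 2 -> dot x a ^+ 2 <= 2 * dot x x.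
Proof.
move=> a2; have := dot_ge0 (2 *: x - dot x a *: a).
rewrite !(dotBl, dotBr, dotZl, dotZr) a2 (dotC a x) expr2; lra.
Qed.

Lemma reflection_reflection a x : dot a a = 2 -> reflection a (reflection a x) = x.
Proof.
move=> a2; rewrite /reflection !(dotBr, dotZr) a2.
have -> : dot a x - dot a x * 2 = - dot a x by ring.
by rewrite scaleNr opprK subrK.
Qed.

Lemma dot_reflection a x y : dot a a = 2 ->
  dot (reflection a x) (reflection a y) = dot x y.
Proof.
move=> a2; rewrite /reflection !(dotBl, dotBr, dotZl, dotZr) a2 (dotC x a); ring.
Qed.

Lemma reflectionB a x y : reflection a (x - y) = reflection a x - reflection a y.
Proof.
by rewrite /reflection dotBr scalerBl; apply/rowP => i; rewrite !mxE; ring.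
Qed.

Lemma reflection_self a : dot a a = 2 -> reflection a a = - a.
Proof. by move=> a2; rewrite /reflection a2 scaler_nat mulr2n opprD addNKr. Qed.

Lemma dot_reflectionC a x y : dot a a = 2 ->
  dot (reflection a x) y = dot x (reflection a y).
Proof. by move=> a2; rewrite -(dot_reflection _ _ a2) reflection_reflection. Qed.

End Dot.

Section RootSystem.
Context {R : realType} {n : nat} (Phi : set 'rV[R]_n).
Hypothesis hPhi : root_system Phi.
Local Notation V := 'rV[R]_n.
Implicit Types (x y a b : V).

Lemma root_reflect a b : Phi a -> Phi b -> Phi (reflection a b).
Proof. by move=> Pa Pb; rewrite -(root_reflection hPhi Pa); exists b. Qed.

Lemma root_opp a : Phi a -> Phi (- a).
Proof.
move=> Pa; rewrite -(reflection_self (root_norm hPhi Pa)); exact: root_reflect.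
Qed.

Lemma regular_dot_neq0 a x : Phi a -> regular_set Phi x -> dot x a != 0.
Proof.
move=> Pa Ex; apply/eqP => xa; apply: Ex; exists a => //.
by rewrite /hyperplane/= dotC.
Qed.

Lemma regular_setP x : regular_set Phi x <-> (forall a, Phi a -> dot x a != 0).
Proof.
split=> [Ex a Pa|h [a Pa]]; first exact: regular_dot_neq0.
by rewrite /hyperplane/= dotC => /eqP; apply/negP/h.
Qed.

Lemma regular_reflect a x : Phi a ->
  regular_set Phi x -> regular_set Phi (reflection a x).
Proof.
move=> Pa /regular_setP Ex; apply/regular_setP => b Pb.
by rewrite (dot_reflectionC _ _ (root_norm hPhi Pa)) Ex//; exact: root_reflect.
Qed.

Lemma open_regular_set : open (regular_set Phi).
Proof.
apply: closed_openC; apply: closed_bigcup; first exact: root_finite hPhi.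
move=> a Pa.
have -> : hyperplane a = (fun x => dot x a) @^-1` [set 0].
  by apply/seteqP; split=> x /=; rewrite /hyperplane/= dotC.
apply: closed_comp; last exact: closed_eq.
move=> x _; apply: differentiable_continuous.
exact: elementary_differentiable (elementary_dot setT a) _.
Qed.

Definition roots : seq V := finmap.enum_fset (fset_set Phi).

Lemma mem_roots a : (a \in roots) = (a \in Phi).
Proof. by rewrite in_fset_set//; exact: root_finite hPhi. Qed.

Lemma rootsP a : reflect (Phi a) (a \in roots).
Proof. by apply: (iffP idP); rewrite mem_roots inE. Qed.

Lemma roots_uniq : uniq roots. Proof. exact: finmap.fset_uniq. Qed.

Lemma perm_roots (f : V -> V) : injective f -> (forall a, Phi a -> Phi (f a)) ->
  perm_eq [seq f a | a <- roots] roots.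
Proof.
move=> fI fPhi; have uf : uniq [seq f a | a <- roots] by rewrite map_inj_uniq ?roots_uniq.
apply: uniq_perm => //; first exact: roots_uniq.
have sub : {subset [seq f a | a <- roots] <= roots}.
  by move=> _ /mapP[a /rootsP Pa ->]; apply/rootsP/fPhi.
by apply: (uniq_min_size uf sub _).2; rewrite size_map.
Qed.

Lemma sum_roots_reflect b (F : V -> R) : Phi b ->
  \sum_(a <- roots) F (reflection b a) = \sum_(a <- roots) F a.
Proof.
move=> Pb; rewrite -(big_map (reflection b) predT F); apply: perm_big.
apply: perm_roots => [|a]; last exact: root_reflect.
exact: can_inj (fun x => reflection_reflection x (root_norm hPhi Pb)).
Qed.

Variable Phip : set V.
Hypothesis hPhip : positive_subsystem Phi Phip.

Lemma positive_sub a : Phip a -> Phi a.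
Proof. by case: hPhip => b _ -> []. Qed.

Lemma positive_finite : finite_set Phip.
Proof. exact: sub_finite_set positive_sub (root_finite hPhi). Qed.

Definition posroots : seq V := finmap.enum_fset (fset_set Phip).

Lemma posrootsP a : reflect (Phip a) (a \in posroots).
Proof. by apply: (iffP idP); rewrite in_fset_set ?inE//; exact: positive_finite. Qed.

Lemma posroots_sub a : a \in posroots -> Phi a.
Proof. by move/posrootsP/positive_sub. Qed.

Lemma sum_posroots (F : V -> R) : \sum_(a \in Phip) F a = \sum_(a <- posroots) F a.
Proof. by rewrite fsbig_finite//; exact: positive_finite. Qed.

Lemma root_posroots a : Phi a -> (a \in posroots) || (- a \in posroots).
Proof.
have [b /regular_setP Eb PE] := hPhip; move=> Pa.
have [ab|ab|ab] := ltgtP 0 (dot a b).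
- by apply/orP; left; apply/posrootsP; rewrite PE.
- apply/orP; right; apply/posrootsP.
  by rewrite PE/= dotNl oppr_gt0; split=> //; exact: root_opp.
- by have := Eb _ Pa; rewrite dotC -ab eqxx.
Qed.

Lemma sum_roots_even (F : V -> R) : (forall a, Phi a -> F (- a) = F a) ->
  \sum_(a <- roots) F a = 2 * \sum_(a <- posroots) F a.
Proof.
move=> Feven; have [b /regular_setP Eb PE] := hPhip.
pose neg := [seq - a | a <- posroots].
have -> : \sum_(a <- roots) F a = \sum_(a <- posroots ++ neg) F a.
  apply: perm_big; apply: uniq_perm; first exact: roots_uniq.
    rewrite cat_uniq finmap.fset_uniq map_inj_uniq ?finmap.fset_uniq ?andbT/=; last exact: oppr_inj.
    apply/hasPn => _ /mapP[a /posrootsP + ->]; rewrite PE => -[_ ab].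
    by apply/negP => /posrootsP; rewrite PE => -[_]; rewrite dotNl oppr_gt0 ltNge ltW.
  move=> a; rewrite mem_cat; apply/rootsP/orP => [Pa|[|]].
  - have /orP[|aP] := root_posroots Pa; first by left.
    by right; apply/mapP; exists (- a) => //; rewrite opprK.
  - exact: posroots_sub.
  - by move=> /mapP[c /posroots_sub Pc ->]; exact: root_opp.
rewrite big_cat/= big_map mulr2n mulrDl mul1r; congr (_ + _).
by rewrite big_seq [RHS]big_seq; apply: eq_bigr => a /posroots_sub /Feven.
Qed.

(** A reflection permutes the roots but not the positive ones; by evenness the sum is doubled to all
    roots, permuted there and halved. *)
Lemma sum_posroots_reflect b (F : V -> R) : (forall a, Phi a -> F (- a) = F a) ->
  Phi b ->
  \sum_(a <- posroots) F (reflection b a) = \sum_(a <- posroots) F a.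
Proof.
move=> Fe Pb; apply: (@mulfI _ 2) => //; rewrite -!sum_roots_even//.
  exact: sum_roots_reflect.
by move=> a Pa; rewrite /reflection dotNr scaleNr -opprD Fe//; exact: root_reflect.
Qed.

Variable k : V -> R.
Hypothesis hkW : weyl_invariant Phi k.

Lemma invariant_reflect a b : Phi a -> Phi b -> k (reflection a b) = k b.
Proof. by move=> Pa Pb; apply: hkW => //; exact: weyl_refl. Qed.

Lemma invariant_opp a : Phi a -> k (- a) = k a.
Proof.
by move=> Pa; rewrite -{1}(reflection_self (root_norm hPhi Pa)) invariant_reflect.
Qed.

End RootSystem.

(** * Cancellation of the cross terms of non-proportional roots *)

Section CrossTerms.
Context {R : realType} {n : nat} (Phi Phip : set 'rV[R]_n).
Hypothesis hPhi : root_system Phi.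
Hypothesis hPhip : positive_subsystem Phi Phip.
Local Notation V := 'rV[R]_n.
Implicit Types (x y a b : V).
Variable k : V -> R.
Hypothesis hkW : weyl_invariant Phi k.
Variable x : V.
Hypothesis Ex : regular_set Phi x.

Let independent a b := (b != a) && (b != - a).
Let F a b := k a * k b * dot a b / (dot x a * dot x b).

Lemma root_scale a b (c : R) : Phi a -> Phi b -> independent a b -> b <> c *: a.
Proof.
move=> Pa Pb /andP[ba bNa] bc.
have : (Phi `&` range (fun c : R => c *: a)) b by split=> //; exists c.
rewrite (root_line hPhi Pa) => -[/eqP|/eqP]; first by rewrite (negbTE ba).
by rewrite (negbTE bNa).
Qed.

(** The second component is [- reflection p.2 p.1]: in the plane of the pair, both roots are turned
    by the angle from [p.1] to [p.2]. This permutes the pairs of independent roots. *)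
Let next (p : V * V) : V * V := (p.2, dot p.1 p.2 *: p.2 - p.1).
Let good (p : V * V) : Prop := [/\ Phi p.1, Phi p.2 & independent p.1 p.2].

Let next_good p : good p -> good (next p).
Proof.
move=> [Pb Pa ind]; split=> //=.
  rewrite -[_ - _]opprK; apply: (root_opp hPhi).
  by rewrite opprB dotC; exact: (root_reflect hPhi).
have ind' : independent p.2 p.1.
  move: ind => /andP[h1 h2]; apply/andP; split; first by rewrite eq_sym.
  by apply: contraNN h2 => /eqP ->; rewrite opprK.
apply/andP; split; apply/negP => /eqP e.
  apply: (@root_scale p.2 p.1 (dot p.1 p.2 - 1) Pa Pb ind').
  rewrite scalerBl scale1r; move: e => /= /eqP; rewrite subr_eq => /eqP ->.
  by rewrite addrAC subrr add0r.
apply: (@root_scale p.2 p.1 (dot p.1 p.2 + 1) Pa Pb ind').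
rewrite scalerDl scale1r; move: e => /= /eqP; rewrite subr_eq => /eqP ->.
by rewrite addrAC addNr add0r.
Qed.

(** [z p] is the projection of [x] to the plane of the pair, turned by a right angle and rescaled.
    So [Q p] is a multiple of the tangent of the angle between that projection and [p.1], with a
    multiplier invariant under [next]. *)
Let z (p : V * V) : V := dot x p.2 *: p.1 - dot x p.1 *: p.2.
Let Q (p : V * V) : R :=
  k p.1 * k p.2 * dot p.1 p.2 * dot (z p) p.1 / (dot (z p) (z p) * dot x p.1).

Let next_dot p : good p -> dot (next p).1 (next p).2 = dot p.1 p.2.
Proof. by move=> [_ Pa _]; rewrite /= dotBr dotZr (root_norm hPhi Pa) (dotC p.2); ring. Qed.

Let next_z p : z (next p) = z p.
Proof.
rewrite /z/= dotBr dotZr; apply/rowP => i; rewrite !mxE; ring.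
Qed.

Let next_k p : good p -> k (next p).2 = k p.1.
Proof.
move=> gp; have [Pb Pa _] := gp; have [_ Pc _] := next_good gp.
rewrite -(invariant_opp hPhi hkW Pc)/= opprB dotC.
exact: (invariant_reflect hkW).
Qed.

(** The difference formula for tangents, taken at the two roots of the pair. *)
Let telescope p : good p -> F p.1 p.2 = Q p - Q (next p).
Proof.
move=> gp; rewrite /Q next_z next_dot// next_k//=.
have [Pb Pa ind] := gp.
have xb := regular_dot_neq0 Pb Ex.
have xa := regular_dot_neq0 Pa Ex.
have zz : dot (z p) (z p) != 0.
  rewrite dot_eq0; apply/eqP => /eqP; rewrite subr_eq0 => /eqP e.
  apply: (@root_scale p.1 p.2 ((dot x p.1)^-1 * dot x p.2) Pb Pa ind).
  by rewrite -scalerA e scalerA mulVf// scale1r.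
have zE : dot (z p) (z p) = dot x p.2 * dot (z p) p.1 - dot x p.1 * dot (z p) p.2.
  by rewrite {2}/z dotBr !dotZr.
rewrite /F; set Z := dot (z p) (z p) in zz zE *.
have -> : k p.1 * k p.2 * dot p.1 p.2 / (dot x p.1 * dot x p.2) =
  k p.1 * k p.2 * dot p.1 p.2 / (dot x p.1 * dot x p.2) * (Z / Z).
  by rewrite divff// mulr1.
rewrite {1}zE; field.
by rewrite xa xb zz.
Qed.

Let pairs : seq (V * V) :=
  [seq p <- [seq (a, b) | a <- roots Phi, b <- roots Phi] | independent p.1 p.2].

Let pairsP p : reflect (good p) (p \in pairs).
Proof.
rewrite mem_filter; apply: (iffP andP).
  move=> [+ /allpairsP[[a b]/= [/(rootsP hPhi) Pa /(rootsP hPhi) Pb pE]]].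
  by rewrite pE => ind; split.
move=> [Pa Pb ind]; split => //; apply/allpairsP; exists p; split => //=; first exact/(rootsP hPhi).
  exact/(rootsP hPhi).
by case: p {Pa Pb ind}.
Qed.

Let sum_pairs_eq0 : \sum_(p <- pairs) F p.1 p.2 = 0.
Proof.
have up : uniq pairs.
  by rewrite filter_uniq// allpairs_uniq ?roots_uniq//; move=> [? ?] [? ?] _ _ [-> ->].
have nI : {in pairs &, injective next}.
  move=> p q /pairsP gp /pairsP gq e.
  have d : dot p.1 p.2 = dot q.1 q.2 by rewrite -next_dot// e next_dot.
  case: p q {gp gq} e d => [p1 p2] [q1 q2] /= [-> e1] d.
  by move: e1; rewrite d => /addrI/oppr_inj ->.
have um : uniq [seq next p | p <- pairs] by rewrite map_inj_in_uniq.
have pm : perm_eq [seq next p | p <- pairs] pairs.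
  apply: uniq_perm => //.
  have sub : {subset [seq next p | p <- pairs] <= pairs}.
    by move=> _ /mapP[p /pairsP gp ->]; apply/pairsP/next_good.
  by apply: (uniq_min_size um sub _).2; rewrite size_map.
transitivity (\sum_(p <- pairs) (Q p - Q (next p))).
  by rewrite !big_seq; apply: eq_bigr => p /pairsP; exact: telescope.
rewrite sumrB -(big_map next predT Q) (perm_big _ pm)/=.
by rewrite subrr.
Qed.

(** Over all ordered pairs of roots the independent pairs telescope along the orbits of [next] and
    sum to 0; only [b = a] and [b = - a] remain. Evenness in each root gives the factor 4 common to
    both sides. *)
Lemma cross_terms_cancel :
  \sum_(a <- posroots Phip) \sum_(b <- posroots Phip)
    k a * k b * dot a b / (dot x a * dot x b) =
  \sum_(a <- posroots Phip) 2 * k a ^+ 2 / dot x a ^+ 2.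
Proof.
have xne a : Phi a -> dot x a != 0 by move=> /regular_dot_neq0; exact.
have Fl a b : Phi a -> F (- a) b = F a b.
  by move=> Pa; rewrite /F (invariant_opp hPhi hkW Pa) dotNl dotNr !(mulrN, mulNr) invrN mulrN opprK.
have Fr a b : Phi b -> F a (- b) = F a b.
  by move=> Pb; rewrite /F (invariant_opp hPhi hkW Pb) !dotNr !(mulrN, mulNr) invrN mulrN opprK.
(* Set to 0 outside the roots, so that evenness in either argument holds for all vectors under the
   sums. *)
pose F' a b := if (a \in roots Phi) && (b \in roots Phi) then F a b else 0.
have rN a : (- a \in roots Phi) = (a \in roots Phi).
  apply/(rootsP hPhi)/(rootsP hPhi) => [/(root_opp hPhi)|]; first by rewrite opprK.
  exact: (root_opp hPhi).
have Fl' a b : F' (- a) b = F' a b.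
  by rewrite /F' rN; case: ifPn => // /andP[/(rootsP hPhi) Pa _]; rewrite Fl.
have Fr' a b : F' a (- b) = F' a b.
  by rewrite /F' rN; case: ifPn => // /andP[_ /(rootsP hPhi) Pb]; rewrite Fr.
have FF' a b : Phi a -> Phi b -> F' a b = F a b.
  by move=> /(rootsP hPhi) Pa /(rootsP hPhi) Pb; rewrite /F' Pa Pb.
have E1 : \sum_(a <- roots Phi) \sum_(b <- roots Phi) F' a b =
    4 * \sum_(a <- posroots Phip) \sum_(b <- posroots Phip) F a b.
  rewrite (@sum_roots_even _ _ _ hPhi _ hPhip); last first.
    by move=> a _; apply: eq_bigr => b _; exact: Fl'.
  rewrite (_ : 4 = 2 * 2 :> R); last by ring.
  rewrite -mulrA; congr (_ * _); rewrite [RHS]mulr_sumr big_seq [RHS]big_seq.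
  apply: eq_bigr => a /(posroots_sub hPhi hPhip) Pa.
  rewrite (@sum_roots_even _ _ _ hPhi _ hPhip)//; congr (_ * _).
  rewrite big_seq [RHS]big_seq.
  by apply: eq_bigr => b /(posroots_sub hPhi hPhip) Pb; rewrite FF'.
have E2 : \sum_(a <- roots Phi) \sum_(b <- roots Phi) F' a b =
    \sum_(p <- pairs) F p.1 p.2 + \sum_(a <- roots Phi) 2 * F' a a.
  transitivity (\sum_(a <- roots Phi)
      (\sum_(b <- roots Phi | independent a b) F a b + 2 * F' a a)).
    rewrite big_seq [RHS]big_seq; apply: eq_bigr => a /[dup] ain /(rootsP hPhi) Pa.
    rewrite (bigID (independent a))/=; congr (_ + _).
      rewrite big_seq_cond [RHS]big_seq_cond; apply: eq_bigr => b /andP[/(rootsP hPhi) Pb _].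
      exact: FF'.
    rewrite -big_filter.
    have pe : perm_eq [seq b <- roots Phi | ~~ independent a b] [:: a; - a].
      apply: uniq_perm.
      - by rewrite filter_uniq// roots_uniq.
      - rewrite /= inE andbT; apply/eqP => e.
        have : a != 0 by exact: root_neq0 hPhi _ Pa.
        have /eqP := e; rewrite -addr_eq0 -mulr2n -scaler_nat scaler_eq0.
        by rewrite pnatr_eq0/= => /eqP ->; rewrite eqxx.
      - move=> b; rewrite mem_filter !inE negb_and !negbK.
        apply: andb_idr => /orP[|] /eqP -> //; by rewrite rN.
    rewrite (perm_big _ pe)/= !big_cons big_nil Fr' addr0.
    by rewrite mulrDl mul1r.
  rewrite big_split/=; congr (_ + _).
  rewrite big_filter [RHS]big_mkcond big_allpairs_dep/=; apply: eq_bigr => a _.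
  by rewrite big_mkcond.
have E3 : \sum_(a <- roots Phi) 2 * F' a a =
    4 * \sum_(a <- posroots Phip) 2 * k a ^+ 2 / dot x a ^+ 2.
  rewrite (@sum_roots_even _ _ _ hPhi _ hPhip); last by move=> a _; rewrite Fl' Fr'.
  rewrite !mulr_sumr big_seq [RHS]big_seq.
  apply: eq_bigr => a /(posroots_sub hPhi hPhip) Pa.
  rewrite FF'// /F (root_norm hPhi Pa).
  by field; exact: xne.
move: E1; rewrite E2 sum_pairs_eq0 add0r E3 => /mulfI -> //.
Qed.

End CrossTerms.

(** * Compactly supported functions *)

Section CompactSupport.
Context {R : realType} {n : nat}.
Local Notation V := 'rV[R]_n.
Implicit Types (D K : set V) (f g u w : V -> R) (x y : V).

(** A Lebesgue number argument. Only the first point of a pair has to lie in [K], so the estimates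
    drawn from it reach a little beyond [K]. *)
Lemma compact_uniform K (Q : V -> V -> Prop) : compact K ->
  (forall x, K x -> exists2 r : R, 0 < r &
     forall y z, `|x - y| < r -> `|x - z| < r -> Q y z) ->
  exists2 d : R, 0 < d & forall x, K x -> forall y, `|x - y| < d -> Q x y.
Proof.
move=> /compact_near_coveringP cK H.
have : \forall d \near 0^'+, K `<=` [set x | forall y, `|x - y| < d -> Q x y].
  apply: cK => x /H[r r0 Qr].
  exists (ball x (r / 2), [set d | d < r / 2]) => /=.
    split; first by apply: nbhsx_ballx; rewrite divr_gt0.
    by apply: nbhs_right_lt; rewrite divr_gt0.
  move=> [y d]/= [xy dr] z yz.
  have xy2 : `|x - y| < r / 2 by move: xy; rewrite -ball_normE.
  apply: Qr; first by rewrite (lt_trans xy2)// ltr_pdivrMr// ltr_pMr// ltr1n.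
  rewrite -(subrKA y) (le_lt_trans (ler_normD _ _))// [ltRHS]splitr ltrD//.
  exact: lt_trans yz dr.
move=> /(filterI (nbhs_right_gt 0)) /filter_ex[d [d0 Kd]].
by exists d.
Qed.

Lemma compact_equicontinuous K f (e : R) : compact K -> 0 < e ->
  (forall x, K x -> {for x, continuous f}) ->
  exists2 d : R, 0 < d & forall x, K x -> forall y, `|x - y| < d -> `|f x - f y| <= e.
Proof.
move=> cK e0 fc; apply: (@compact_uniform K (fun x y => `|f x - f y| <= e)) => // x /fc.
move=> /cvgrPdist_lt/(_ (e / 2)); rewrite divr_gt0// => /(_ isT)/nbhs_ballP[r /= r0 rf].
exists r => // y z xy xz; rewrite -(subrKA (f x)) (le_trans (ler_normD _ _))//.
rewrite [leRHS]splitr lerD// ltW// ?(distrC _ (f x)).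
  by apply: rf; rewrite -ball_normE.
by apply: rf; rewrite -ball_normE.
Qed.

Lemma compact_fun_bounded K f : compact K ->
  (forall x, K x -> {for x, continuous f}) ->
  exists2 M : R, 0 < M & forall x, K x -> `|f x| <= M.
Proof.
move=> cK fc; have : bounded_set (f @` K).
  apply: compact_bounded; apply: continuous_compact => //.
  by apply: continuous_in_subspaceT => x; rewrite inE => /fc.
move=> [M [_ MK]]; exists (`|M| + 1); first by rewrite ltr_wpDl.
by move=> x Kx; apply: MK; [rewrite (le_lt_trans (ler_norm _))// ltrDl|exists x].
Qed.

Definition Cc D f := continuous f /\
  exists K, [/\ compact K, K `<=` D & forall x, ~ K x -> f x = 0].

Lemma Cc_continuous D f : Cc D f -> continuous f. Proof. by case. Qed.

Lemma Cc_bounded D f : Cc D f -> exists2 M : R, 0 < M & forall x, `|f x| <= M.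
Proof.
move=> [fc [K [cK _ f0]]]; have [M M0 fM] := compact_fun_bounded cK (fun x _ => fc x).
exists M => // x; have [/fM//|/f0 ->] := pselect (K x).
by rewrite normr0 ltW.
Qed.

Lemma Cc_equicontinuous D f (e : R) : Cc D f -> 0 < e ->
  exists2 d : R, 0 < d & forall x y, `|x - y| < d -> `|f x - f y| <= e.
Proof.
move=> [fc [K [cK _ f0]]] e0.
have [d d0 fd] := compact_equicontinuous cK e0 (fun x _ => fc x).
exists d => // x y xy; have [Kx|Kx] := pselect (K x); first exact: fd.
have [Ky|Ky] := pselect (K y); first by rewrite distrC; apply: fd => //; rewrite distrC.
by rewrite !f0// subrr normr0 ltW.
Qed.

Lemma Cc0 D : Cc D (cst 0).
Proof.
by split; [move=> ?; exact: cst_continuous|exists set0; split => //; exact: compact0].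
Qed.

Lemma CcD D f g : Cc D f -> Cc D g -> Cc D (fun x => f x + g x).
Proof.
move=> [fc [K [cK KD f0]]] [gc [L [cL LD g0]]]; split.
  by move=> x; exact: (continuousD (fc x) (gc x)).
exists (K `|` L); split; first exact: compactU.
  by move=> x [/KD|/LD].
by move=> x /not_orP[/f0 -> /g0 ->]; rewrite addr0.
Qed.

Lemma Cc_sum D (I : Type) (s : seq I) (F : I -> V -> R) :
  (forall i, Cc D (F i)) -> Cc D (fun x => \sum_(i <- s) F i x).
Proof.
move=> FC; elim: s => [|i s ih].
  by rewrite (_ : (fun _ => _) = cst 0); [exact: Cc0|apply/funext => x; rewrite big_nil].
rewrite (_ : (fun _ => _) = fun x => F i x + \sum_(j <- s) F j x); first exact: CcD.
by apply/funext => x; rewrite big_cons.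
Qed.

(** At a point outside [D], where [w] may be singular, the product vanishes in a neighbourhood, the
    complement of the compact support being open. In this way coefficients with poles on the walls
    act on test functions. *)
Lemma CcM D f w : open D -> Cc D f ->
  (forall x, D x -> {for x, continuous w}) -> Cc D (fun x => w x * f x).
Proof.
move=> oD [fc [K [cK KD f0]]] wc; split; last first.
  by exists K; split=> // x /f0 ->; rewrite mulr0.
move=> x; have [Dx|Dx] := pselect (D x).
  exact: (continuousM (wc x Dx) (fc x)).
have oK : open (~` K).
  by apply: closed_openC; apply: compact_closed => //; exact: norm_hausdorff.
have Kx : (~` K) x by move=> /KD.
rewrite /continuous_at f0// mulr0.
have z : {near x, (cst 0 : V -> R) =1 (fun x => w x * f x)}.
  by move: oK; rewrite openE => /(_ _ Kx); apply: filterS => y /f0 ->; rewrite mulr0.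
have h : (cst 0 : V -> R) @ x --> (0 : R) by exact: (@cst_continuous V R 0 x).
exact: (cvg_trans (near_eq_cvg z) h).
Qed.

Lemma CcZ D f (c : R) : Cc D f -> Cc D (fun x => c * f x).
Proof.
move=> [fc [K [cK KD f0]]]; split; last first.
  by exists K; split=> // x /f0 ->; rewrite mulr0.
by move=> x; exact: (continuousM (@cst_continuous _ _ c x) (fc x)).
Qed.

Lemma CcN D f : Cc D f -> Cc D (fun x => - f x).
Proof.
move=> /(CcZ (-1)); rewrite (_ : (fun _ => _) = fun x => - f x)//.
by apply/funext => x; rewrite mulN1r.
Qed.

Lemma Cc_norm D f : Cc D f -> Cc D (fun x => `|f x|).
Proof.
move=> [fc [K [cK KD f0]]]; split; last first.
  by exists K; split=> // x /f0 ->; rewrite normr0.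
by move=> x; exact: (cvg_norm (fc x)).
Qed.

Lemma Cc_comp D f (h : V -> V) : continuous h -> cancel h h ->
  (forall x, D x -> D (h x)) -> Cc D f -> Cc D (fun x => f (h x)).
Proof.
move=> hc hK hD [fc [K [cK KD f0]]]; split.
  by move=> x; apply: (@continuous_comp _ _ _ h f); [exact: hc|exact: fc].
exists (h @` K); split.
- apply: continuous_compact => //; exact: continuous_subspaceT.
- by move=> _ [x /KD Dx <-]; exact: hD.
- by move=> x nK; apply: f0 => Kh; apply: nK; exists (h x).
Qed.

Lemma partial_eq0 u i K x : closed K -> (forall y, ~ K y -> u y = 0) -> ~ K x ->
  partial i u x = 0.
Proof.
move=> clK u0 Kx; rewrite (@partial_near _ _ _ u (cst 0)).
  by rewrite /partial derive_cst.
have oK : open (~` K) by exact: closed_openC.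
by move: oK; rewrite openE => /(_ _ Kx); apply: filterS => y /u0.
Qed.

Lemma CK_infty_Cc D u : CK_infty D u -> Cc D u.
Proof.
move=> [su cK KD]; split; first exact: (su [::]).1.
exists (closure [set x | u x != 0]); split => //.
move=> x nK; apply: contrapT => /eqP ux; apply: nK; exact: subset_closure.
Qed.

Lemma CK_infty_partial D u i : CK_infty D u -> CK_infty D (partial i u).
Proof.
move=> [su cK KD].
have clK : closed (closure [set x | u x != 0]) by exact: closed_closure.
have u0 x : ~ closure [set x | u x != 0] x -> u x = 0.
  move=> nK; apply: contrapT => /eqP ux; apply: nK; exact: subset_closure.
have sub : closure [set x | partial i u x != 0] `<=` closure [set x | u x != 0].
  rewrite [X in _ `<=` X](closure_id _).1//.
  apply: closureS => x /= dx; apply: contrapT => /(partial_eq0 i clK u0) /eqP.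
  by rewrite (negbTE dx).
split; last 2 first.
- by apply: subclosed_compact cK sub; exact: closed_closure.
- exact: subset_trans sub KD.
move=> s; have := su (rcons s i); rewrite foldr_rcons.
exact.
Qed.

End CompactSupport.

Section Continuity.
Context {R : realType} {n : nat}.
Local Notation V := 'rV[R]_n.

Lemma continuous_dot (a : V) : continuous (fun x : V => dot x a).
Proof.
move=> x; apply: differentiable_continuous.
exact: elementary_differentiable (elementary_dot setT a) _.
Qed.

Lemma continuous_reflection (a : V) : continuous (reflection a).
Proof.
have h : continuous (fun x : 'rV[R]_n => dot x a *: a).
  by move=> x; apply: (@continuousZr_tmp _ _ _ (fun x => dot x a) a x); exact: continuous_dot.
move=> x; rewrite (_ : reflection a = fun x => x - dot x a *: a).
  have hid : (fun y : 'rV[R]_n => y) @ x --> x by move=> A.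
  exact: (cvgB hid (h x)).
by apply/funext => y; rewrite /reflection dotC.
Qed.

Lemma elementary_continuous (D : set V) u x : elementary D u -> D x ->
  {for x, continuous u}.
Proof. by move=> eu Dx; apply/differentiable_continuous/(elementary_differentiable eu Dx). Qed.

Lemma is_derive_partial (D : set V) u x i : elementary D u -> D x ->
  is_derive x (delta_mx 0 i) u (partial i u x).
Proof.
move=> eu Dx; apply: DeriveDef => //.
exact/diff_derivable/(elementary_differentiable eu Dx).
Qed.

Lemma is_derive_partial2 (D : set V) u x i : open D -> elementary D u -> D x ->
  is_derive x (delta_mx 0 i) (partial i u) (partial i (partial i u) x).
Proof.
move=> oD eu Dx; have [v ev uv] := elementary_partial i eu.
have nuv : \near x, v x = partial i u x.
  by move: oD; rewrite openE => /(_ _ Dx); apply: filterS => y Dy; rewrite uv.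
have := near_eq_is_derive nuv (is_derive_partial i ev Dx).
suff -> : partial i (partial i u) x = partial i v x by [].
by apply: partial_near; apply: filterS nuv => y ->.
Qed.

End Continuity.

(** * The generator *)

Section Generator.
Context {R : realType} {n : nat} (Phi Phip : set 'rV[R]_n).
Hypothesis hPhi : root_system Phi.
Hypothesis hPhip : positive_subsystem Phi Phip.
Local Notation V := 'rV[R]_n.
Local Notation E := (regular_set Phi).
Local Notation P := (posroots Phip).
Implicit Types (x y a b : V) (F u : V -> R) (i : 'I_n).
Variables k l : V -> R.

Lemma dunkl_laplacianE u x : dunkl_laplacian Phip k l u x =
  2^-1 * laplacian u x
  + \sum_(a <- P) k a * (dot (gradient u x) a / dot x a)
  + \sum_(a <- P) l a * ((u (reflection a x) - u x) / dot x a ^+ 2).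
Proof. by rewrite /dunkl_laplacian !(sum_posroots hPhi hPhip). Qed.

Let oE : open E := open_regular_set hPhi.

Lemma continuous_inv_dot a x : Phi a -> E x ->
  {for x, continuous (fun y => (dot y a)^-1)}.
Proof.
move=> Pa Ex; apply: (@elementary_continuous _ _ E _ x) => //.
by apply: elementary_inv (elementary_dot _ a) _ => y; exact: regular_dot_neq0.
Qed.

(** The poles of the coefficients lie off the support of [u] and of its reflections, so the image is
    bounded and continuous, and functionals on such functions apply to it. *)
Lemma dunkl_laplacian_Cc u : CK_infty E u -> Cc E (dunkl_laplacian Phip k l u).
Proof.
move=> ku.
have pu i : CK_infty E (partial i u) by exact: CK_infty_partial.
(* The tests [a \in P] make the summands compactly supported for arbitrary [a]; the square in the
   jump term is split into two simple poles. *)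
rewrite (_ : dunkl_laplacian Phip k l u = fun x =>
   (2^-1 * laplacian u x
  + \sum_(a <- P) (if a \in P then (dot x a)^-1 * (k a * dot (gradient u x) a) else 0))
  + \sum_(a <- P) (if a \in P then (dot x a)^-1 * ((dot x a)^-1 *
     (l a * (u (reflection a x) - u x))) else 0)); last first.
  apply/funext => x; rewrite dunkl_laplacianE; congr (_ + _ + _).
    rewrite big_seq [RHS]big_seq; apply: eq_bigr => a ->; ring.
  rewrite big_seq [RHS]big_seq; apply: eq_bigr => a ->.
  by rewrite expr2 invfM; ring.
apply: CcD.
  apply: CcD.
    by apply: CcZ; apply: Cc_sum => i; apply: CK_infty_Cc; exact: CK_infty_partial.
  apply: Cc_sum => a; case: (boolP (a \in P)) => [/(posroots_sub hPhi hPhip) Pa|_]; last exact: Cc0.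
  apply: CcM => //; last by move=> x; exact: continuous_inv_dot.
  apply: CcZ; apply: Cc_sum => i.
  rewrite (_ : (fun _ => _) = fun x => a 0 i * partial i u x).
    by apply: CcZ; exact: CK_infty_Cc.
  by apply/funext => x; rewrite /gradient mxE mulrC.
apply: Cc_sum => a; case: (boolP (a \in P)) => [/(posroots_sub hPhi hPhip) Pa|_]; last exact: Cc0.
apply: CcM => //; last by move=> x; exact: continuous_inv_dot.
apply: CcM => //; last by move=> x; exact: continuous_inv_dot.
apply: CcZ; apply: CcD; last by apply: CcN; exact: CK_infty_Cc.
apply: Cc_comp (CK_infty_Cc ku); first exact: continuous_reflection.
- by move=> x; exact: reflection_reflection (root_norm hPhi Pa).
- by move=> x; exact: (regular_reflect hPhi).
Qed.

(* The logarithm of the weight prod_(a in Phip) |x.a|^k(a). *)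
Definition logw x : R := \sum_(a <- P) 2^-1 * k a * ln (dot x a ^+ 2).

(** On [E] this is half of [|grad logw|^2 + laplacian logw], that is [2^-1 * laplacian w / w] for
    the weight [w = exp logw]: a potential of Calogero type. *)
Definition potential x : R := \sum_(a <- P) (k a ^+ 2 - k a) / dot x a ^+ 2.

Hypothesis hkW : weyl_invariant Phi k.

Lemma elementary_logw : elementary E logw.
Proof.
rewrite /logw.
rewrite (_ : (fun x => _) = fun x => \sum_(a <- P | a \in P)
  (cst (2^-1 * k a) x * ln (dot x a * dot x a))); last first.
  by apply/funext => x; rewrite big_seq; apply: eq_bigr => a _; rewrite expr2.
apply: elementary_sum => a /(posroots_sub hPhi hPhip) Pa.
apply: elementary_mul; first exact: elementary_cst.
apply: elementary_ln; first by apply: elementary_mul; exact: elementary_dot.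
by move=> x Ex; rewrite -expr2 exprn_even_gt0//= (regular_dot_neq0 Pa Ex).
Qed.

Lemma elementary_potential : elementary E potential.
Proof.
rewrite /potential.
rewrite (_ : (fun x => _) = fun x => \sum_(a <- P | a \in P)
  (cst (k a ^+ 2 - k a) x * (dot x a * dot x a)^-1)); last first.
  by apply/funext => x; rewrite big_seq; apply: eq_bigr => a _; rewrite expr2.
apply: elementary_sum => a /(posroots_sub hPhi hPhip) Pa.
apply: elementary_mul; first exact: elementary_cst.
apply: elementary_inv; first by apply: elementary_mul; exact: elementary_dot.
by move=> x Ex; rewrite mulf_neq0 ?(regular_dot_neq0 Pa Ex).
Qed.

Lemma logw_reflection a x : Phi a -> logw (reflection a x) = logw x.
Proof.
move=> Pa; rewrite /logw -(@sum_posroots_reflect _ _ _ hPhi _ hPhip a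
  (fun b => 2^-1 * k b * ln (dot x b ^+ 2)))//; last first.
  by move=> b Pb; rewrite (invariant_opp hPhi hkW)// dotNr sqrrN.
rewrite big_seq [RHS]big_seq; apply: eq_bigr => b /(posroots_sub hPhi hPhip) Pb.
by rewrite (invariant_reflect hkW)// (dot_reflectionC _ _ (root_norm hPhi Pa)).
Qed.

Lemma partial_val (w : V -> R) i x d : is_derive x (delta_mx 0 i) w d ->
  partial i w x = d.
Proof. by case. Qed.

Lemma is_derive_sum_seq (I : Type) (s : seq I) (H : I -> V -> R) (dH : I -> R) x v :
  (forall j, is_derive x v (H j) (dH j)) ->
  is_derive x v (fun y => \sum_(j <- s) H j y) (\sum_(j <- s) dH j).
Proof.
move=> Hd; elim: s => [|j s ih].
  rewrite big_nil (_ : (fun _ => _) = cst 0); first exact: is_derive_cst.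
  by apply/funext => y; rewrite big_nil.
rewrite big_cons (_ : (fun _ => _) = H j + (fun y => \sum_(j <- s) H j y)).
  exact: is_deriveD.
by apply/funext => y; rewrite big_cons.
Qed.

Lemma is_derive_dot a x i : is_derive x (delta_mx 0 i) (fun y => dot y a) (a 0 i).
Proof.
have h := @is_derive_sum_seq _ (index_enum 'I_n) (fun j y => y 0 j * a 0 j)
  (fun j => (i == j)%:R * a 0 j) x (delta_mx 0 i).
rewrite (_ : a 0 i = \sum_j (i == j)%:R * a 0 j).
  apply: h => j.
  have hc := is_derive_coord x (delta_mx 0 i) j.
  have := is_deriveM hc (is_derive_cst (a 0 j) x (delta_mx 0 i)).
  rewrite mxE eqxx/= => hm; apply: (is_derive_eq hm).
  by rewrite /GRing.scale/= mulr0 add0r mulrC eq_sym.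
rewrite (bigD1 i)//= eqxx mul1r big1 ?addr0// => j ji.
by rewrite eq_sym (negbTE ji) mul0r.
Qed.

Definition dlogw i x : R := \sum_(a <- P) k a * a 0 i / dot x a.
Definition ddlogw i x : R := - \sum_(a <- P) k a * a 0 i ^+ 2 / dot x a ^+ 2.

Lemma is_derive_logw i x : E x -> is_derive x (delta_mx 0 i) logw (dlogw i x).
Proof.
move=> Ex; pose H a y : R := if a \in P then 2^-1 * k a * ln (dot y a ^+ 2) else 0.
rewrite (_ : logw = fun y => \sum_(a <- P) H a y); last first.
  apply/funext => y; rewrite /logw big_seq [RHS]big_seq; apply: eq_bigr => a aP.
  by rewrite /H aP.
pose dH a : R := if a \in P then k a * a 0 i / dot x a else 0.
rewrite (_ : dlogw i x = \sum_(a <- P) dH a); last first.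
  by rewrite /dlogw big_seq [RHS]big_seq; apply: eq_bigr => a aP; rewrite /dH aP.
apply: is_derive_sum_seq => a; rewrite /H /dH.
case: (boolP (a \in P)) => [/(posroots_sub hPhi hPhip) Pa|_]; last exact: is_derive_cst.
have xa := regular_dot_neq0 Pa Ex.
have d1 := is_derive_dot a x i.
have d2 : is_derive x (delta_mx 0 i) (fun y => dot y a ^+ 2) (2 * dot x a * a 0 i).
  apply: (is_derive_eq (is_deriveM d1 d1)).
  by rewrite /GRing.scale/=; ring.
have x2 : 0 < dot x a ^+ 2 by rewrite exprn_even_gt0.
have d3 := is_derive_comp_line (is_derive1_ln x2) d2.
apply: (is_derive_eq (is_deriveZ (2^-1 * k a) d3)).
by rewrite /GRing.scale/=; field.
Qed.

Lemma near_regular x (Q : V -> Prop) : E x -> (forall y, E y -> Q y) -> \near x, Q x.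
Proof.
move=> Ex EQ; move: oE; rewrite openE => /(_ _ Ex).
by apply: filterS => y; exact: EQ.
Qed.

Lemma is_derive_dlogw i x : E x ->
  is_derive x (delta_mx 0 i) (dlogw i) (ddlogw i x).
Proof.
move=> Ex; pose H a y : R := if a \in P then k a * a 0 i / dot y a else 0.
rewrite (_ : dlogw i = fun y => \sum_(a <- P) H a y); last first.
  apply/funext => y; rewrite /dlogw big_seq [RHS]big_seq; apply: eq_bigr => a aP.
  by rewrite /H aP.
pose dH a : R := if a \in P then - (k a * a 0 i ^+ 2 / dot x a ^+ 2) else 0.
rewrite (_ : ddlogw i x = \sum_(a <- P) dH a); last first.
  rewrite /ddlogw -sumrN big_seq [RHS]big_seq; apply: eq_bigr => a aP.
  by rewrite /dH aP.
apply: is_derive_sum_seq => a; rewrite /H /dH.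
case: (boolP (a \in P)) => [/(posroots_sub hPhi hPhip) Pa|_]; last exact: is_derive_cst.
have xa := regular_dot_neq0 Pa Ex.
have d1 := is_derive_comp_line (f := fun y => dot y a) (is_derive_inv xa) (is_derive_dot a x i).
apply: (is_derive_eq (is_deriveZ (k a * a 0 i) d1)).
by rewrite /GRing.scale/=; field.
Qed.

Lemma dot_gradE (d : 'I_n -> R) a : \sum_i d i * a 0 i = dot (\row_i d i) a.
Proof. by apply: eq_bigr => i _; rewrite mxE. Qed.

Lemma sum_ddlogw x : \sum_i ddlogw i x = - \sum_(a <- P) 2 * k a / dot x a ^+ 2.
Proof.
rewrite /ddlogw sumrN exchange_big/=; congr (- _).
rewrite big_seq [RHS]big_seq; apply: eq_bigr => a /(posroots_sub hPhi hPhip) Pa.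
rewrite -(root_norm hPhi Pa) /dot -mulr_suml; congr (_ / _).
rewrite mulrC mulr_sumr; apply: eq_bigr => i _; by rewrite expr2.
Qed.

Lemma sum_dlogw_dot x a : \sum_i dlogw i x * a 0 i =
  \sum_(b <- P) k b * dot a b / dot x b.
Proof.
under eq_bigr do rewrite /dlogw mulr_suml.
rewrite exchange_big/=; apply: eq_bigr => b _.
rewrite /dot mulr_sumr mulr_suml; apply: eq_bigr => i _; ring.
Qed.

(** The drift is the inner product with the gradient of [logw], which is why conjugation by the
    weight removes it. *)
Lemma drift_dlogw x (d : 'I_n -> R) :
  \sum_(a <- P) k a * (dot (\row_i d i) a / dot x a) = \sum_i d i * dlogw i x.
Proof.
under eq_bigr do rewrite -dot_gradE.
under [RHS]eq_bigr do rewrite /dlogw mulr_sumr.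
rewrite [RHS]exchange_big/=; apply: eq_bigr => a _.
by rewrite mulr_suml mulr_sumr; apply: eq_bigr => i _; ring.
Qed.

(** The squared gradient is a double sum over the positive roots; its off-diagonal part cancels, so
    the potential has no mixed terms. *)
Lemma sum_dlogw_sqr x : E x ->
  \sum_i dlogw i x ^+ 2 = \sum_(a <- P) 2 * k a ^+ 2 / dot x a ^+ 2.
Proof.
move=> Ex; rewrite -(cross_terms_cancel hPhi hPhip hkW Ex).
under eq_bigr do rewrite expr2.
rewrite -drift_dlogw; apply: eq_bigr => a _.
rewrite -dot_gradE sum_dlogw_dot mulr_suml mulr_sumr.
by apply: eq_bigr => b _; rewrite invfM; ring.
Qed.

Definition diffusion_part u x : R :=
  2^-1 * laplacian u x + \sum_(a <- P) k a * (dot (gradient u x) a / dot x a).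

Lemma diffusion_partE u x (d dd : 'I_n -> R) :
  (forall i, partial i u x = d i) -> (forall i, partial i (partial i u) x = dd i) ->
  diffusion_part u x = 2^-1 * (\sum_i dd i) + \sum_i d i * dlogw i x.
Proof.
move=> hd hdd; rewrite /diffusion_part /laplacian (eq_bigr dd)//; congr (_ + _).
rewrite -drift_dlogw; apply: eq_bigr => a _; congr (_ * (dot _ _ / _)).
by apply/rowP => i; rewrite !mxE hd.
Qed.

(* Conjugating by the weight e^logw trades the singular drift for a zero-order
   term. *)
Lemma diffusion_part_ground_state F x : elementary E F -> E x ->
  diffusion_part (fun y => F y * expR (- logw y)) x =
  expR (- logw x) * (2^-1 * laplacian F x - potential x * F x).
Proof.
move=> eF Ex; set u := fun y => _.
have dexp i y : E y -> is_derive y (delta_mx 0 i) (fun y => expR (- logw y))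
    (expR (- logw y) * - dlogw i y).
  move=> Ey; apply: (is_derive_comp_line (is_derive_expR _)).
  exact: is_deriveN (is_derive_logw i Ey).
pose d i y := (partial i F y - F y * dlogw i y) * expR (- logw y).
have du i y : E y -> partial i u y = d i y.
  move=> Ey; apply: partial_val.
  apply: (is_derive_eq (is_deriveM (is_derive_partial i eF Ey) (dexp i y Ey))).
  rewrite /d /GRing.scale/=; ring.
pose dd i := (partial i (partial i F) x - 2 * (partial i F x * dlogw i x)
  - F x * ddlogw i x + F x * dlogw i x ^+ 2) * expR (- logw x).
have ddu i : partial i (partial i u) x = dd i.
  rewrite (@partial_near _ _ i (partial i u) (d i)); last first.
    by apply: near_regular => // y Ey; exact: du.
  apply: partial_val; rewrite /d.
  have h1 := is_deriveM (is_derive_partial i eF Ex) (is_derive_dlogw i Ex).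
  have h2 := is_deriveB (is_derive_partial2 i oE eF Ex) h1.
  apply: (is_derive_eq (is_deriveM h2 (dexp i x Ex))).
  rewrite /dd /GRing.scale/= !fctE; ring.
rewrite (diffusion_partE (fun i => du i x Ex) ddu).
rewrite /dd -mulr_suml !(big_split, sumrB)/= !sumrN -!mulr_sumr.
rewrite sum_ddlogw sum_dlogw_sqr// /d.
under [X in _ + X]eq_bigr do rewrite mulrAC mulrBl -mulrA -expr2.
rewrite -mulr_suml sumrB -mulr_sumr sum_dlogw_sqr//.
have -> : potential x = 2^-1 * (\sum_(a <- P) 2 * k a ^+ 2 / dot x a ^+ 2 -
    \sum_(a <- P) 2 * k a / dot x a ^+ 2).
  rewrite -sumrB mulr_sumr; apply: eq_bigr => a _.
  rewrite -mulrBl mulrA; congr (_ / _); by field.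
rewrite /laplacian; by field.
Qed.

(** [E] is stable under reflections, so [u] vanishes at [x] and at its reflected points, and every
    numerator over a possibly zero denominator is 0. *)
Lemma dunkl_laplacian_out u x : CK_infty E u -> ~ E x ->
  dunkl_laplacian Phip k l u x = 0.
Proof.
move=> ku nEx; have [_ cK KE] := ku.
have u0 y : ~ E y -> u y = 0.
  move=> nEy; apply: contrapT => /eqP uy; apply/nEy/KE; exact: subset_closure.
have p0 i v : CK_infty E v -> partial i v x = 0.
  move=> [_ cKv KvE]; apply: (@partial_eq0 _ _ v i (closure [set x | v x != 0])).
  - exact: closed_closure.
  - move=> y nK; apply: contrapT => /eqP vy; apply: nK; exact: subset_closure.
  - by move=> /KvE.
rewrite dunkl_laplacianE /laplacian big1 ?mulr0 ?add0r; last first.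
  by move=> i _; apply: p0; exact: CK_infty_partial.
rewrite !big1_seq ?addr0//.
- move=> a /(posroots_sub hPhi hPhip) Pa; rewrite (u0 x)// u0 ?subrr ?mul0r ?mulr0//.
  move=> Ex; apply: nEx; rewrite -(reflection_reflection x (root_norm hPhi Pa)).
  exact: (regular_reflect hPhi).
- move=> a _; rewrite (_ : gradient u x = 0); last first.
    by apply/rowP => i; rewrite !mxE p0.
  by rewrite -(scale0r 0) dotZl !mul0r mulr0.
Qed.

End Generator.

(** * Cutoff functions *)

Section Cutoff.
Context {R : realType} {n : nat} (Phi Phip : set 'rV[R]_n).
Hypothesis hPhi : root_system Phi.
Hypothesis hPhip : positive_subsystem Phi Phip.
Local Notation V := 'rV[R]_n.
Local Notation E := (regular_set Phi).
Local Notation P := (posroots Phip).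
Implicit Types (x y a b : V) (i : 'I_n) (N : R).
Variables k l : V -> R.
Hypothesis hk : forall a, Phi a -> 2^-1 <= k a.
Hypothesis hkW : weyl_invariant Phi k.
Local Notation logw := (logw Phip k).
Local Notation dlogw := (dlogw Phip k).
Local Notation ddlogw := (ddlogw Phip k).

Let oE : open E := open_regular_set hPhi.

(** Each term of [logw] is at most [k a * dot x x], so the sum of the multiplicities makes
    [A * dot x x - logw x] nonnegative; the extra 1 makes it at least [dot x x]. *)
Let A : R := \sum_(a <- P) k a + 1.

Let k_gt0 a : a \in P -> 0 < k a.
Proof. by move=> /(posroots_sub hPhi hPhip)/hk; apply: lt_le_trans; rewrite invr_gt0. Qed.

Let A_gt0 : 0 < A.
Proof.
rewrite ltr_wpDl// big_seq; apply: sumr_ge0 => a /k_gt0; exact: ltW.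
Qed.

Definition lyapunov x : R := A * dot x x - logw x.

Let ln_le (y : R) : 0 <= y -> ln y <= y.
Proof.
rewrite le_eqVlt => /orP[/eqP <-|y0]; first by rewrite ln0.
by have := expR_ge1Dx (ln y); rewrite lnK ?posrE// => h; lra.
Qed.

Let weight_term_le a x : a \in P -> 2^-1 * k a * ln (dot x a ^+ 2) <= k a * dot x x.
Proof.
move=> aP; have ka := k_gt0 aP.
rewrite [2^-1 * _]mulrC -mulrA ler_pM2l// ler_pdivrMl//.
rewrite (le_trans (ln_le (sqr_ge0 _)))// dot_sqr_le//.
exact: root_norm hPhi _ (posroots_sub hPhi hPhip aP).
Qed.

Lemma lyapunov_ge x : dot x x <= lyapunov x.
Proof.
rewrite /lyapunov /A mulrDl mul1r addrAC lerDr subr_ge0 mulr_suml /logw.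
rewrite big_seq [leRHS]big_seq; apply: ler_sum => a; exact: weight_term_le.
Qed.

(** All terms of [logw] but that of [a] are absorbed by [A * dot x x], which leaves [- lyapunov x <=
    2^-1 * k a * ln (dot x a ^+ 2)]. The 4 is the largest value of [2 / k a], at [k a = 1/2].
    Sublevel sets of [lyapunov] thus keep away from the walls. *)
Lemma lyapunov_dot_ge a x : E x -> Phi a ->
  expR (- 4 * lyapunov x) <= dot x a ^+ 2.
Proof.
move=> Ex Pa.
wlog aP : a Pa / a \in P.
  move=> H; have /orP[|aP] := root_posroots hPhi hPhip Pa; first exact: H.
  by have := H (- a) (root_opp hPhi Pa) aP; rewrite dotNr sqrrN.
have xa : 0 < dot x a ^+ 2 by rewrite exprn_even_gt0//= (regular_dot_neq0 Pa Ex).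
rewrite -[leRHS]lnK ?posrE// ler_expR.
have kaP := k_gt0 aP; have ka := hk Pa.
have h : logw x <= 2^-1 * k a * ln (dot x a ^+ 2) + A * dot x x.
  rewrite /logw (big_rem a)//= lerD2l /A mulrDl mul1r.
  rewrite (le_trans _ (_ : \sum_(b <- P) k b * dot x x <= _))//; last first.
    by rewrite mulr_suml lerDl dot_ge0.
  rewrite [leRHS](big_rem a)//= -[leLHS]add0r lerD//.
    by rewrite mulr_ge0 ?dot_ge0 ?ltW.
  rewrite big_seq [leRHS]big_seq; apply: ler_sum => b /mem_rem; exact: weight_term_le.
have h0 : 0 <= lyapunov x by rewrite (le_trans (dot_ge0 x))// lyapunov_ge.
have h1 : - lyapunov x <= 2^-1 * k a * ln (dot x a ^+ 2) by rewrite /lyapunov; lra.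
nra.
Qed.

(** As [lyapunov] is nonnegative the argument is at most 1/2, and up to 1/2 the function [flat 0] is
    convex. The argument is positive where [lyapunov x < N]. *)
Definition cutoff_arg N x : R := 2^-1 - lyapunov x / (2 * N).

Definition cutoff N x : R := if x \in E then flat 0 (cutoff_arg N x) else 0.

Lemma cutoff_in N x : E x -> cutoff N x = flat 0 (cutoff_arg N x).
Proof. by move=> Ex; rewrite /cutoff mem_set. Qed.

Lemma cutoff_out N x : ~ E x -> cutoff N x = 0.
Proof. by move=> nEx; rewrite /cutoff memNset. Qed.

Lemma cutoff_ge0 N x : 0 <= cutoff N x.
Proof. by rewrite /cutoff; case: ifP => // _; exact: flat_ge0. Qed.

Lemma cutoff_le1 N x : cutoff N x <= 1.
Proof.
by rewrite /cutoff; case: ifP => // _; have := flat_le_fact 0 (cutoff_arg N x).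
Qed.

Lemma elementary_lyapunov : elementary E lyapunov.
Proof.
rewrite /lyapunov; apply: elementary_sub; last exact: elementary_logw.
apply: (@elementary_mul _ _ _ (cst A)); first exact: elementary_cst.
apply: elementary_sum => i _; apply: elementary_mul; exact: elementary_coord.
Qed.

Lemma elementary_cutoff_arg N : elementary E (cutoff_arg N).
Proof.
rewrite /cutoff_arg; apply: (@elementary_sub _ _ _ (cst 2^-1)); first exact: elementary_cst.
apply: (@elementary_mul _ _ _ _ (cst (2 * N)^-1)); last exact: elementary_cst.
exact: elementary_lyapunov.
Qed.

Lemma norm_le_dot x (N : R) : dot x x <= N -> `|x| <= N + 1.
Proof.
move=> xN; rewrite [leLHS]/Num.norm /= mx_normrE; apply/bigmax_leP; split=> /=.
  by rewrite (le_trans (dot_ge0 x))// (le_trans xN)// lerDl.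
move=> [i j] _ /=; rewrite ord1.
have h := coord_sqr_le_dot x j; rewrite ler_norml; apply/andP; split; nra.
Qed.

(** Contains the points of [E] with [lyapunov x <= N], but is cut out by closed conditions on the
    whole space, hence compact. *)
Let supp N : set V := [set x | dot x x <= N /\ forall a, Phi a -> expR (- 4 * N) <= dot x a ^+ 2].

Let compact_supp N : compact (supp N).
Proof.
apply: bounded_closed_compact.
  exists (N + 1); split; first exact: num_real.
  by move=> M NM x [/norm_le_dot xN _]; exact: le_trans xN (ltW NM).
rewrite (_ : supp N = (fun x => dot x x) @^-1` [set t | t <= N] `&`
   \bigcap_(a in Phi) ((fun x => dot x a ^+ 2) @^-1` [set t | expR (- 4 * N) <= t])); last first.
  by apply/seteqP; split => x /= [h1 h2].
apply: closedI.
  apply: closed_comp => [x _|]; last exact: closed_le.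
  apply: differentiable_continuous; apply: (@elementary_differentiable _ _ setT) => //.
  apply: elementary_sum => i _; apply: elementary_mul; exact: elementary_coord.
apply: closed_bigI => a _.
rewrite (_ : (fun x => _) = fun x => dot x a * dot x a); last first.
  by apply/funext => x; rewrite expr2.
apply: closed_comp => [x _|]; last exact: closed_ge.
apply: differentiable_continuous; apply: (@elementary_differentiable _ _ setT) => //.
by apply: elementary_mul; exact: elementary_dot.
Qed.

Let supp_sub N : supp N `<=` E.
Proof.
move=> x [_ xN]; apply/regular_setP => a Pa; have := xN a Pa.
by apply: contraTneq => ->; rewrite expr0n/= -ltNge expR_gt0.
Qed.

Let cutoff_supp N x : 0 < N -> ~ supp N x -> cutoff N x = 0.
Proof.
move=> N0 nx; rewrite /cutoff; case: ifPn => // /set_mem Ex.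
rewrite /flat ifF//; apply/negbTE; rewrite -leNgt /cutoff_arg subr_le0.
rewrite leNgt; apply/negP => h; apply: nx.
have {}h : lyapunov x <= N by move: h; rewrite ltr_pdivrMr ?mulr_gt0// mulrA mulVf// mul1r => /ltW.
split; first exact: le_trans (lyapunov_ge x) h.
move=> a Pa; apply: le_trans (lyapunov_dot_ge Ex Pa); rewrite ler_expR; lra.
Qed.

Lemma cutoff_CK_infty N : 0 < N -> CK_infty E (cutoff N).
Proof.
move=> N0; apply: (@elementary_CK_infty _ _ E _ (fun x => flat 0 (cutoff_arg N x)) (supp N)) => //.
- by apply: elementary_flat; exact: elementary_cutoff_arg.
- by move=> x; exact: cutoff_in.
- by move=> x; exact: cutoff_supp.
Qed.

Lemma lyapunov_reflection a x : Phi a -> lyapunov (reflection a x) = lyapunov x.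
Proof.
move=> Pa; rewrite /lyapunov (logw_reflection hPhi hPhip hkW)//.
by rewrite (dot_reflection _ _ (root_norm hPhi Pa)).
Qed.

Lemma cutoff_reflection N a x : Phi a -> cutoff N (reflection a x) = cutoff N x.
Proof.
move=> Pa; rewrite /cutoff /cutoff_arg lyapunov_reflection//.
suff -> : (reflection a x \in E) = (x \in E) by [].
apply/idP/idP => /set_mem h; apply/mem_set; last exact: regular_reflect.
rewrite -(reflection_reflection x (root_norm hPhi Pa)); exact: regular_reflect.
Qed.

(** The lower bound does not depend on [N]: if [M] bounds [lyapunov] on [K], then [N >= 2 * M] keeps
    the argument at least 1/4. *)
Lemma cutoff_large K : compact K -> K `<=` E ->
  exists2 N0, 0 < N0 & forall N, N0 <= N -> forall x, K x ->
    flat 0 (4^-1) <= cutoff N x.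
Proof.
move=> cK KE; have [M M0 hM] := compact_fun_bounded cK
  (fun x Kx => elementary_continuous elementary_lyapunov (KE _ Kx)).
exists (2 * M); first by rewrite mulr_gt0.
move=> N NM x Kx; rewrite (cutoff_in _ (KE _ Kx)); apply: flat0_le.
have N0 : 0 < N by apply: lt_le_trans NM; rewrite mulr_gt0.
have h := le_trans (ler_norm _) (hM x Kx).
rewrite /cutoff_arg lerBrDr -lerBrDl ler_pdivrMr ?mulr_gt0//; lra.
Qed.

(** The limit is [exp(-2)], not 1, as the cutoffs are not normalised. *)
Lemma cvg_cutoff x : E x -> cutoff j.+1%:R x @[j --> \oo] --> (flat 0 (2^-1) : R).
Proof.
move=> Ex; under eq_fun do rewrite (cutoff_in _ Ex).
apply: (@cvg_comp _ _ _ (fun j => cutoff_arg j.+1%:R x) (flat 0)); last exact: continuous_flat.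
have h : (2^-1 - (lyapunov x / 2) * harmonic j) @[j --> \oo] --> (2^-1 - lyapunov x / 2 * 0 : R).
  apply: cvgB; first exact: cvg_cst.
  by apply: cvgM; [exact: cvg_cst|exact: cvg_harmonic].
rewrite mulr0 subr0 in h.
rewrite (_ : (fun j => _) = fun j => 2^-1 - (lyapunov x / 2) * harmonic j)//.
by apply/funext => j; rewrite /cutoff_arg invfM mulrA.
Qed.

(** The generator applied to [A * dot x x]: [A * n] from the Laplacian, [2 * A * k a] from the drift
    of each positive root, nothing from the jumps. *)
Let c : R := A * (n%:R + 2 * \sum_(a <- P) k a).

Let c_ge0 : 0 <= c.
Proof.
rewrite mulr_ge0 ?(ltW A_gt0)// addr_ge0// mulr_ge0// big_seq.
apply: sumr_ge0 => a /k_gt0; exact: ltW.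
Qed.

(** The chain rule with [q = cutoff_arg N] gives [flat 2 q] times the generator on [q], plus half of
    [flat 4 q - 2 * flat 3 q] times the squared gradient of [q]. The latter is nonnegative as
    [q <= 1/2]; the former is at least [2 * (- c / (2 * N))], since the generator is nonnegative on
    [logw] and [flat 2 <= 2]. *)
Lemma dunkl_laplacian_cutoff_ge N x : 0 < N ->
  - (c / N) <= dunkl_laplacian Phip k l (cutoff N) x.
Proof.
move=> N0; have [Ex|nEx] := pselect (E x); last first.
  rewrite (dunkl_laplacian_out hPhi hPhip k l (cutoff_CK_infty N0) nEx) oppr_le0.
  exact: divr_ge0 c_ge0 (ltW N0).
rewrite (dunkl_laplacianE hPhi hPhip) [X in _ <= _ + X]big1_seq ?addr0; last first.
  by move=> a /(posroots_sub hPhi hPhip) Pa; rewrite cutoff_reflection// subrr mul0r mulr0.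
rewrite -/(diffusion_part Phip k (cutoff N) x).
set q := cutoff_arg N.
pose dq i y : R := - (2 * A * y 0 i - dlogw i y) / (2 * N).
pose ddq i y : R := - (2 * A - ddlogw i y) / (2 * N).
have is_dq i y : E y -> is_derive y (delta_mx 0 i) q (dq i y).
  move=> Ey.
  have h0 : is_derive y (delta_mx 0 i) (fun y : V => dot y y) (2 * y 0 i).
    have hs := @is_derive_sum_seq _ _ _ (index_enum 'I_n) (fun j y => y 0 j * y 0 j)
      (fun j => 2 * y 0 j * (i == j)%:R) y (delta_mx 0 i).
    rewrite (_ : 2 * y 0 i = \sum_j 2 * y 0 j * (i == j)%:R).
      apply: hs => j; have hc := is_derive_coord y (delta_mx 0 i) j.
      apply: (is_derive_eq (is_deriveM hc hc)).
      by rewrite mxE eqxx/= /GRing.scale/= eq_sym; ring.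
    rewrite (bigD1 i)//= eqxx mulr1 big1 ?addr0// => j ji.
    by rewrite eq_sym (negbTE ji) mulr0.
  have h := is_deriveB (is_deriveZ A h0) (is_derive_logw hPhi hPhip k i Ey).
  have h2 := is_deriveB (is_derive_cst (2^-1 : R) y (delta_mx 0 i)) (is_deriveZ (2 * N)^-1 h).
  rewrite (_ : q = cst 2^-1 - (2 * N)^-1 \*: (A \*: (fun y : V => dot y y) - logw)).
    by apply: (is_derive_eq h2); rewrite /dq /GRing.scale/=; field; rewrite gt_eqF.
  by apply/funext => z; rewrite /q /cutoff_arg /lyapunov !fctE /GRing.scale/= mulrC.
have is_ddq i y : E y -> is_derive y (delta_mx 0 i) (dq i) (ddq i y).
  move=> Ey; have h0 := is_derive_coord y (delta_mx 0 i) i.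
  have h := is_deriveB (is_deriveZ (2 * A) h0) (is_derive_dlogw hPhi hPhip k i Ey).
  have h2 := is_deriveZ (- (2 * N)^-1) h.
  rewrite (_ : dq i = - (2 * N)^-1 \*: ((2 * A) \*: (fun y : V => y 0 i) - dlogw i)).
    apply: (is_derive_eq h2); rewrite /ddq /GRing.scale/= mxE !eqxx/= mulr1.
    by rewrite !mulNr mulrC.
  by apply/funext => z; rewrite /dq !fctE mulrC mulrN -mulNr.
pose d i y := flat 2 (q y) * dq i y.
have du i y : E y -> partial i (cutoff N) y = d i y.
  move=> Ey; rewrite (@partial_near _ _ i _ (fun z => flat 0 (q z))); last first.
    by apply: (near_regular hPhi) => // z; exact: cutoff_in.
  have := is_derive_comp_line (is_derive_flat 0 (q y)) (is_dq i y Ey).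
  by rewrite mul0r subr0 => /partial_val.
pose dd i := (flat 4 (q x) - 2 * flat 3 (q x)) * dq i x ^+ 2 + flat 2 (q x) * ddq i x.
have ddu i : partial i (partial i (cutoff N)) x = dd i.
  rewrite (@partial_near _ _ i _ (d i)); last first.
    by apply: (near_regular hPhi) => // z Ez; exact: du.
  apply: partial_val.
  have h1 := is_derive_comp_line (is_derive_flat 2 (q x)) (is_dq i x Ex).
  apply: (is_derive_eq (is_deriveM h1 (is_ddq i x Ex))).
  rewrite /dd /GRing.scale/=; ring.
rewrite (@diffusion_partE _ _ Phip k _ _ _ _ (fun i => du i x Ex) ddu).
have qh : q x <= 2^-1.
  have L0 : 0 <= lyapunov x := le_trans (dot_ge0 x) (lyapunov_ge x).
  by rewrite /q /cutoff_arg lerBlDr lerDl divr_ge0// mulr_ge0// ltW.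
have f43 : 0 <= flat 4 (q x) - 2 * flat 3 (q x).
  rewrite /flat; case: ifPn => q0; last by rewrite mulr0 subr0.
  have t2 : 2 <= (q x)^-1 by rewrite -[2]invrK lef_pV2 ?posrE ?invr_gt0.
  rewrite subr_ge0 mulrA ler_pM2r ?expR_gt0// [leRHS]exprS ler_pM2r//.
  by rewrite exprn_gt0// invr_gt0.
have f2 : 0 <= flat 2 (q x) <= 2.
  by rewrite flat_ge0/= (le_trans (flat_le_fact 2 _)).
have Lq : - c / (2 * N) <= 2^-1 * (\sum_i ddq i x) + \sum_i dq i x * dlogw i x.
  have hN : 2 * N != 0 by rewrite mulf_neq0// gt_eqF.
  have -> : \sum_i ddq i x = - (2 * A * n%:R + \sum_(a <- P) 2 * k a / dot x a ^+ 2) / (2 * N).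
    rewrite /ddq -mulr_suml sumrN sumrB sumr_const card_ord.
    by rewrite (sum_ddlogw hPhi hPhip) opprK mulr_natr.
  have xk : \sum_i x 0 i * dlogw i x = \sum_(a <- P) k a.
    rewrite -drift_dlogw big_seq [RHS]big_seq.
    apply: eq_bigr => a /(posroots_sub hPhi hPhip) Pa.
    rewrite (_ : \row_i x 0 i = x); last by apply/rowP => i; rewrite mxE.
    by rewrite divff ?mulr1// (regular_dot_neq0 Pa Ex).
  have -> : \sum_i dq i x * dlogw i x = - (2 * A * (\sum_(a <- P) k a) -
      \sum_(a <- P) 2 * k a ^+ 2 / dot x a ^+ 2) / (2 * N).
    rewrite -(sum_dlogw_sqr hPhi hPhip hkW Ex) -xk mulr_sumr -sumrB -sumrN mulr_suml.
    by apply: eq_bigr => i _; rewrite /dq; field; rewrite gt_eqF.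
  (* Here [k a >= 1/2] enters, as [k a <= 2 * k a ^+ 2]: the difference of the two sides is the
     generator applied to [logw]. *)
  have kk : \sum_(a <- P) k a / dot x a ^+ 2 <= \sum_(a <- P) 2 * k a ^+ 2 / dot x a ^+ 2.
    rewrite big_seq [leRHS]big_seq; apply: ler_sum => a aP.
    rewrite ler_wpM2r ?invr_ge0 ?sqr_ge0//.
    by have := hk (posroots_sub hPhi hPhip aP); nra.
  have -> : \sum_(a <- P) 2 * k a / dot x a ^+ 2 = 2 * \sum_(a <- P) k a / dot x a ^+ 2.
    by rewrite mulr_sumr; apply: eq_bigr => a _; rewrite mulrA.
  move: kk; rewrite /c; set S1 := \sum_(a <- P) k a / _; set S2 := \sum_(a <- P) _ / _.
  set S := \sum_(a <- P) _ => kk; rewrite -subr_ge0.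
  rewrite (_ : _ - _ = (S2 - S1) / (2 * N)); last by field; rewrite gt_eqF.
  by rewrite divr_ge0 ?subr_ge0// mulr_ge0// ltW.
have -> : \sum_i dd i = (flat 4 (q x) - 2 * flat 3 (q x)) * (\sum_i dq i x ^+ 2) +
    flat 2 (q x) * \sum_i ddq i x.
  by rewrite !mulr_sumr -big_split.
have -> : \sum_i d i x * dlogw i x = flat 2 (q x) * \sum_i dq i x * dlogw i x.
  by rewrite mulr_sumr; apply: eq_bigr => i _; rewrite /d mulrA.
have S0 : 0 <= \sum_i dq i x ^+ 2 by apply: sumr_ge0 => i _; exact: sqr_ge0.
have cN : 0 <= c / N := divr_ge0 c_ge0 (ltW N0).
have cN2 : - c / (2 * N) = - (c / N) / 2 by field; rewrite gt_eqF.
rewrite cN2 in Lq; move: f2 => /andP[f20 f21].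
set T1 := \sum_i ddq i x in Lq *; set T2 := \sum_i _ * _ in Lq *.
have h1 : 0 <= (flat 4 (q x) - 2 * flat 3 (q x)) * \sum_i dq i x ^+ 2 by exact: mulr_ge0.
have h2 : flat 2 (q x) * (- (c / N) / 2) <= flat 2 (q x) * (2^-1 * T1 + T2) by rewrite ler_wpM2l.
nra.
Qed.

End Cutoff.

(** * Lattice sums *)

Section Lattice.
Context {R : realType} {n : nat}.
Local Notation V := 'rV[R]_n.
Implicit Types (M : nat) (tau S T : R) (F G : V -> R) (x y : V).

(** The points of mesh [tau] in the cube of half-side [tau * M], with the origin at index [M]. *)
Definition pt M tau (z : {ffun 'I_n -> 'I_(M.*2.+1)}) : V :=
  \row_i (tau * ((z i)%:R - M%:R)).

Definition lsum M tau F : R := \sum_z F (@pt M tau z).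

Definition lvec tau (v : 'I_n -> int) : V := \row_i (tau * (v i)%:~R).

Lemma rV_norm_le x (r : R) : 0 <= r -> (`|x| <= r) = [forall i, `|x 0 i| <= r].
Proof.
move=> r0; rewrite [`|x|]/Num.norm /= mx_normrE.
apply/bigmax_leP/forallP => [[_ h] i|h]; first exact: (h (ord0, i)).
by split=> // [[i j]] _ /=; rewrite ord1.
Qed.

Lemma coord_le_norm x i : `|x 0 i| <= `|x|.
Proof. by have := lexx `|x|; rewrite rV_norm_le// => /forallP. Qed.

(** Invariance is exact: the margin [T] between the support and the boundary of the cube absorbs the
    shift, so indices that would leave the cube contribute 0 on either side. *)
Lemma lsum_shift M tau (v : 'I_n -> int) F S T : 0 < tau ->
  (forall y, S < `|y| -> F y = 0) -> `|lvec tau v| <= T -> S + T <= tau * M%:R ->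
  lsum M tau (fun y => F (y + lvec tau v)) = lsum M tau F.
Proof.
move=> tau0 FS vT STM.
have M2 : (M.*2)%:R = 2 * M%:R :> R by rewrite -muln2 natrM mulrC.
(* [inr w] selects the indices that stay in the cube when moved by [w]; on them [sh w] is the move,
   undone by [sh] of the opposite vector. *)
pose inr (w : 'I_n -> int) (z : {ffun 'I_n -> 'I_(M.*2.+1)}) :=
  [forall i, 0 <= (z i)%:Z + w i <= (M.*2)%:Z].
pose sh (w : 'I_n -> int) (z : {ffun 'I_n -> 'I_(M.*2.+1)}) : {ffun 'I_n -> 'I_(M.*2.+1)} :=
  [ffun i => inord (absz ((z i)%:Z + w i))].
have shE w z i : inr w z -> (sh w z i : nat)%:Z = (z i)%:Z + w i.
  move=> /forallP /(_ i) /andP[h1 h2]; rewrite ffunE inordK; first by rewrite gez0_abs.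
  by rewrite ltnS -lez_nat gez0_abs.
have inrN w z : inr w z -> inr (fun i => - w i) (sh w z).
  move=> h; apply/forallP => i; rewrite shE// addrK; apply/andP; split=> //.
  by rewrite lez_nat -ltnS ltn_ord.
have shK w z : inr w z -> sh (fun i => - w i) (sh w z) = z.
  move=> h; apply/ffunP => i; apply: val_inj; apply/eqP; rewrite -eqz_nat /=.
  by rewrite (shE _ _ _ (inrN _ _ h)) (shE _ _ _ h) addrK.
have ptE w z : inr w z -> pt tau (sh w z) = pt tau z + lvec tau w.
  move=> h; apply/rowP => i; rewrite !mxE -mulrDr; congr (_ * _).
  have e : (sh w z i)%:R = (z i)%:R + (w i)%:~R :> R.
    by have := congr1 (fun t : int => t%:~R : R) (shE _ _ i h); rewrite intrD.
  by rewrite e; ring.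
have T0 : 0 <= T by apply: le_trans vT.
have tauv i : `|tau * (v i)%:~R| <= T.
  by apply: le_trans vT; have := coord_le_norm (lvec tau v) i; rewrite mxE.
have outl z : ~~ inr v z -> F (pt tau z + lvec tau v) = 0.
  move=> /forallPn[i]; rewrite negb_and -!ltNge => h; apply: FS.
  apply: lt_le_trans (coord_le_norm _ i); rewrite !mxE -mulrDr.
  rewrite normrM (gtr0_norm tau0).
  have h2 : (M%:R : R) < `|(z i)%:R - M%:R + (v i)%:~R|.
    rewrite -(ltr_int R) -(ltr_int R (M.*2)%:Z) intrD/= ?pmulrn -?pmulrn M2 in h.
    rewrite ltr_normr; case/orP: h => h; apply/orP; [right|left]; lra.
  rewrite -ltr_pdivrMl// (le_lt_trans _ h2)// ler_pdivrMl//.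
  by apply: le_trans STM; rewrite lerDl.
have outr z : ~~ inr (fun i => - v i) z -> F (pt tau z) = 0.
  move=> /forallPn[i]; rewrite negb_and -!ltNge => h; apply: FS.
  apply: lt_le_trans (coord_le_norm _ i); rewrite !mxE.
  rewrite normrM (gtr0_norm tau0) -ltr_pdivrMl//.
  have := tauv i; rewrite normrM (gtr0_norm tau0) -ler_pdivlMl// => tv.
  have ST : tau^-1 * S + tau^-1 * T <= M%:R by rewrite -mulrDr ler_pdivrMl.
  have h2 : (M%:R : R) < `|(z i)%:R - M%:R| + `|(v i)%:~R|.
    rewrite -(ltr_int R) -(ltr_int R (M.*2)%:Z) intrD/= intrN ?pmulrn -?pmulrn M2 in h.
    have h3 := ler_norm ((v i)%:~R : R); have h4 := ler_norm (- ((v i)%:~R : R)).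
    rewrite normrN in h4.
    have h5 := ler_norm ((z i)%:R - M%:R : R); have h6 := ler_norm (- ((z i)%:R - M%:R : R)).
    rewrite normrN in h6.
    case/orP: h => h; lra.
  lra.
rewrite /lsum (bigID (inr v))/= [X in _ + X]big1 ?addr0//.
rewrite [RHS](bigID (inr (fun i => - v i)))/= [X in _ = _ + X]big1 ?addr0//.
rewrite [RHS](reindex_onto (sh v) (sh (fun i => - v i)))/=; last first.
  move=> z h; have := shK _ _ h; rewrite (_ : (fun i => - - v i) = v)//.
  by apply/funext => i; rewrite opprK.
rewrite [RHS](eq_bigl (inr v)); first by apply: eq_bigr => z /ptE ->.
move=> z; apply/andP/idP => [[h /eqP zE]|h]; last by rewrite inrN// shK.
apply/forallP => i; have := inrN _ _ h; rewrite zE => /forallP/(_ i) h'.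
have hs := shE _ _ i h; rewrite zE in hs; rewrite hs subrK.
by apply/andP; split=> //; rewrite lez_nat -ltnS ltn_ord.
Qed.

Lemma lvec_approx tau x : 0 < tau -> exists v, `|x - lvec tau v| <= tau.
Proof.
move=> tau0; exists (fun i => Num.floor (x 0 i / tau)).
rewrite rV_norm_le ?ltW//; apply/forallP => i; rewrite !mxE.
set t := x 0 i / tau; have -> : x 0 i = tau * t by rewrite mulrC divfK// gt_eqF.
rewrite -mulrBr normrM (gtr0_norm tau0) ler_piMr ?(ltW tau0)//.
have h1 := floor_le_tmp t; have h2 := floorD1_gt t.
rewrite intrD in h2; rewrite ger0_norm ?subr_ge0//; lra.
Qed.

End Lattice.

(** * Asymptotics of lattice sums *)

Section LatticeAsymptotics.
Context {R : realType} {n : nat}.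
Local Notation V := 'rV[R]_n.
Implicit Types (M : nat) (tau S T : R) (F G : V -> R) (x y : V).

Lemma eq_lsum M tau F G : F =1 G -> lsum M tau F = lsum M tau G.
Proof. by move=> FG; apply: eq_bigr => z _; rewrite FG. Qed.

Lemma lsumD M tau F G : lsum M tau (fun y => F y + G y) = lsum M tau F + lsum M tau G.
Proof. exact: big_split. Qed.

Lemma lsumN M tau F : lsum M tau (fun y => - F y) = - lsum M tau F.
Proof. exact: sumrN. Qed.

Lemma lsumB M tau F G : lsum M tau (fun y => F y - G y) = lsum M tau F - lsum M tau G.
Proof. by rewrite lsumD lsumN. Qed.

Lemma lsumZ M tau c F : lsum M tau (fun y => c * F y) = c * lsum M tau F.
Proof. by rewrite /lsum mulr_sumr. Qed.

Lemma lsum_sum M tau (I : Type) (s : seq I) (F : I -> V -> R) :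
  lsum M tau (fun y => \sum_(i <- s) F i y) = \sum_(i <- s) lsum M tau (F i).
Proof. by rewrite /lsum exchange_big. Qed.

Lemma exchange_lsum M M' tau tau' (F : V -> V -> R) :
  lsum M tau (fun y => lsum M' tau' (F y)) =
  lsum M' tau' (fun z => lsum M tau (F^~ z)).
Proof. exact: exchange_big. Qed.

Lemma ler_lsum M tau F G : (forall y, F y <= G y) -> lsum M tau F <= lsum M tau G.
Proof. by move=> FG; apply: ler_sum. Qed.

Lemma lsum_ge0 M tau F : (forall y, 0 <= F y) -> 0 <= lsum M tau F.
Proof. by move=> F0; apply: sumr_ge0. Qed.

Lemma ler_norm_lsum M tau F : `|lsum M tau F| <= lsum M tau (fun y => `|F y|).
Proof. exact: ler_norm_sum. Qed.

(** The filter of fine meshes in large cubes, spelled out: estimates hold at finite mesh and no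
    limit of the sums is taken. *)
Definition fine_mesh (Q : nat -> R -> Prop) := exists tau0 S0 : R, 0 < tau0 /\
  forall M tau, 0 < tau -> tau < tau0 -> S0 <= tau * M%:R -> Q M tau.

Lemma fine_meshI (Q1 Q2 : nat -> R -> Prop) : fine_mesh Q1 -> fine_mesh Q2 ->
  fine_mesh (fun M tau => Q1 M tau /\ Q2 M tau).
Proof.
move=> [t1 [S1 [t10 h1]]] [t2 [S2 [t20 h2]]].
exists (Num.min t1 t2), (Num.max S1 S2); split; first by rewrite lt_min t10.
move=> M tau tau0; rewrite lt_min ge_max => /andP[? ?] /andP[? ?].
by split; [apply: h1|apply: h2].
Qed.

Lemma fine_meshS (Q1 Q2 : nat -> R -> Prop) :
  (forall M tau, 0 < tau -> Q1 M tau -> Q2 M tau) -> fine_mesh Q1 -> fine_mesh Q2.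
Proof.
by move=> Q12 [t [S [t0 h]]]; exists t, S; split=> // M tau *; apply: Q12 => //; apply: h.
Qed.

Lemma fine_mesh_ex (Q : nat -> R -> Prop) : fine_mesh Q ->
  exists M tau, 0 < tau /\ Q M tau.
Proof.
move=> [t [S [t0 h]]].
exists (Num.truncn (`|S| / (t / 2))).+1, (t / 2); split; first by rewrite divr_gt0.
apply: h; first by rewrite divr_gt0.
  by rewrite ltr_pdivrMr// ltr_pMr// ltr1n.
rewrite -ler_pdivrMl ?divr_gt0// mulrC (le_trans _ (ltW (truncnS_gt _)))//.
by rewrite ler_wpM2r ?invr_ge0 ?divr_ge0 ?(ltW t0)// ler_norm.
Qed.

Lemma fine_mesh_mesh (t S : R) : 0 < t ->
  fine_mesh (fun M tau => tau < t /\ S <= tau * M%:R).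
Proof. by move=> t0; exists t, S; split. Qed.

Lemma lsum_shift_fine (S T : R) : fine_mesh (fun M tau => forall F v,
  (forall y, S < `|y| -> F y = 0) -> `|@lvec R n tau v| <= T ->
  lsum M tau (fun y => F (y + lvec tau v)) = lsum M tau F).
Proof.
exists 1, (S + T); split=> // M tau tau0 _ STM F v FS vT.
exact: lsum_shift FS vT STM.
Qed.

Definition ind (r : R) (y : V) : R := if `|y| <= r then 1 else 0.

Lemma ind_ge0 r y : 0 <= ind r y. Proof. by rewrite /ind; case: ifP. Qed.

Lemma ind_out r y : r < `|y| -> ind r y = 0.
Proof. by rewrite ltNge /ind => /negbTE ->. Qed.

(* Covering a large cube by translates of a small one. *)
Lemma lsum_ind_doubling (X r T : R) : 0 < r -> 0 <= X -> exists2 D : R, 0 < D &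
  fine_mesh (fun M tau => forall x, `|x| <= X ->
    lsum M tau (fun y => ind T (x - y)) <= D * lsum M tau (ind (2 * r))).
Proof.
move=> r0 X0; pose m := (Num.truncn (`|T| / r)).+1.
have mT : T < r * m%:R.
  by rewrite -ltr_pdivrMl// mulrC (le_lt_trans _ (truncnS_gt _))// ler_wpM2r ?ler_norm// invr_ge0 ltW.
exists (#|{ffun 'I_n -> 'I_(m.*2.+1)}|%:R); first by rewrite ltr0n card_ffun !card_ord expn_gt0.
have H := fine_meshI (lsum_shift_fine (2 * r) (X + r * m%:R + r)) (fine_mesh_mesh 0 r0).
apply: fine_meshS H => M tau tau0 [shift [taur _]] x xX.
have cover y : ind T (x - y) <= lsum m r (fun k => ind r (x - k - y)).
  rewrite /ind; case: ifPn => // xyT; last by apply: lsum_ge0 => k; exact: ind_ge0.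
  have [v hv] := lvec_approx (x - y) r0.
  have inb i : 0 <= v i + m%:Z <= (m.*2)%:Z.
    have h1 := coord_le_norm (x - y) i; have h2 := coord_le_norm (x - y - lvec r v) i.
    rewrite !mxE in h1 h2.
    have hv' : `|r * (v i)%:~R| < r * (m%:R + 1).
      rewrite mulrDr mulr1 (_ : r * (v i)%:~R = (x 0 i - y 0 i) - (x 0 i - y 0 i - r * (v i)%:~R)); last by ring.
      rewrite (le_lt_trans (ler_normB _ _))// ltr_leD//.
        by rewrite (le_lt_trans h1)// (le_lt_trans xyT).
      exact: le_trans h2 hv.
    move: hv'; rewrite normrM (gtr0_norm r0) ltr_pM2l// -intr_norm.
    have -> : m%:R + 1 = (m%:Z + 1)%:~R :> R by rewrite intrD.
    rewrite ltr_int ltzD1 ler_norml -muln2; move: (v i) => w; clear => h; lia.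
  pose z : {ffun 'I_n -> 'I_(m.*2.+1)} := [ffun i => inord (absz (v i + m%:Z))].
  have zE : pt r z = lvec r v.
    apply/rowP => i; rewrite !mxE ffunE inordK; last first.
      by have /andP[h1 h2] := inb i; rewrite ltnS -lez_nat gez0_abs.
    have /andP[h1 _] := inb i.
    by rewrite natr_absz ger0_norm// intrD addrK.
  rewrite /lsum (bigD1 z)//= zE addrAC hv lerDl.
  by apply: sumr_ge0 => k _; exact: ind_ge0.
rewrite (le_trans (ler_lsum _ _ cover))// exchange_lsum.
(* Replacing the centre by a lattice vector within [tau < r] costs a doubling of the radius, after
   which the exact shift invariance applies. *)
have small k : `|x - k| <= X + r * m%:R -> lsum M tau (fun y => ind r (x - k - y)) <= lsum M tau (ind (2 * r)).
  move=> xk; have [v hv] := lvec_approx (x - k) tau0.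
  pose v' i := - v i.
  have v'E : lvec tau v' = - lvec tau v.
    by apply/rowP => i; rewrite !mxE intrN mulrN.
  rewrite -(shift (ind (2 * r)) v').
  - apply: ler_lsum => y; rewrite /ind v'E; case: (leP _ r) => h; last exact: ind_ge0.
    rewrite ifT//.
    rewrite (_ : y - lvec tau v = (x - k - lvec tau v) - (x - k - y)); last first.
      by apply/rowP => i; rewrite !mxE; ring.
    rewrite (le_trans (ler_normB _ _))// mulr2n mulrDl mul1r lerD//.
    exact: le_trans hv (ltW taur).
  - exact: ind_out.
  - rewrite v'E normrN (_ : lvec tau v = (x - k) - (x - k - lvec tau v)); last by rewrite subKr.
    by rewrite (le_trans (ler_normB _ _))// lerD// (le_trans hv)// ltW.
rewrite -sum1_card natr_sum mulr_suml; apply: ler_sum => k _; rewrite mul1r.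
apply: small; rewrite (le_trans (ler_normB _ _))// lerD//.
rewrite rV_norm_le ?mulr_ge0 ?(ltW r0)//; apply/forallP => i; rewrite mxE normrM (gtr0_norm r0).
rewrite ler_pM2l// ler_norml; have := ltn_ord (k i); rewrite ltnS => hk.
have hk' : (k i)%:R <= 2 * m%:R :> R by rewrite -natrM ler_nat mul2n.
have h0 := ler0n R (k i); apply/andP; split; lra.
Qed.

(** Unnormalised, and a function of the Euclidean norm, hence invariant under reflections. The norm
    of row vectors is the maximum norm; the support lies in its ball of radius [e] as well. *)
Definition mollifier (e : R) (y : V) : R := flat 0 (e ^+ 2 - dot y y).

Lemma mollifier_ge0 e y : 0 <= mollifier e y. Proof. exact: flat_ge0. Qed.

Lemma mollifierN e y : mollifier e (- y) = mollifier e y.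
Proof. by rewrite /mollifier dotNl dotNr opprK. Qed.

Lemma mollifier_reflection e a x y : dot a a = 2 ->
  mollifier e (reflection a x - y) = mollifier e (x - reflection a y).
Proof.
move=> a2; rewrite /mollifier -{1 2}(reflection_reflection y a2) -reflectionB.
by rewrite dot_reflection.
Qed.

Lemma mollifier_out e y : 0 < e -> e < `|y| -> mollifier e y = 0.
Proof.
move=> e0 ey; rewrite /mollifier /flat ifF//; apply/negbTE; rewrite -leNgt subr_le0.
have : ~~ (`|y| <= e) by rewrite -ltNge.
rewrite (rV_norm_le _ (ltW e0)) => /forallPn[i]; rewrite -ltNge => h.
apply: (le_trans _ (coord_sqr_le_dot y i)).
rewrite -[leRHS]real_normK ?num_real// lerXn2r ?nnegrE//; exact: ltW.
Qed.

Lemma elementary_mollifier e z : elementary setT (fun y => mollifier e (y - z)).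
Proof.
apply: elementary_flat; apply: (@elementary_sub _ _ _ (cst (e ^+ 2))); first exact: elementary_cst.
apply: elementary_sum => i _.
have h : elementary setT (fun y : V => y 0 i - z 0 i).
  exact: elementary_sub (elementary_coord _ i) (elementary_cst _ (z 0 i)).
rewrite (_ : (fun _ => _) = fun y : V => (y 0 i - z 0 i) * (y 0 i - z 0 i)).
  exact: elementary_mul.
by apply/funext => y; rewrite !mxE.
Qed.

Lemma mollifier_Cc e : 0 < e -> Cc setT (mollifier e).
Proof.
move=> e0; split.
  rewrite (_ : mollifier e = fun y => mollifier e (y - 0)).
    by move=> x; exact: (@elementary_continuous _ _ _ _ x (elementary_mollifier e 0) I).
  by apply/funext => y; rewrite subr0.
exists [set y | `|y| <= e]; split => //.
  apply: bounded_closed_compact.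
    exists e; split; first exact: num_real.
    by move=> M eM y /= ye; exact: le_trans ye (ltW eM).
  apply: (@closed_comp _ _ (fun y : V => `|y|) [set t | t <= e]) => [y _|]; last exact: closed_le.
  exact: norm_continuous.
by move=> y /negP; rewrite -ltNge; exact: mollifier_out.
Qed.

Lemma mollifier_lower e : 0 < e -> exists r m : R, [/\ 0 < r, 0 < m &
  forall y, m * ind (2 * r) y <= mollifier e y].
Proof.
(* For [|y| <= 2 * r] the [n] coordinates give [dot y y <= n * (2 * r) ^+ 2], which is below half of
   [e ^+ 2]. *)
move=> e0; pose r := e / (4 * (n%:R + 1)); exists r, (flat 0 (e ^+ 2 / 2)).
have n1 : 0 < n%:R + 1 :> R by rewrite ltr_wpDl.
have r0 : 0 < r by rewrite divr_gt0// mulr_gt0.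
have e2 : 0 < e ^+ 2 by rewrite exprn_gt0.
split=> //; first by rewrite /flat divr_gt0// mulr_gt0// ?expR_gt0// exprn_gt0// invr_gt0 divr_gt0.
move=> y; rewrite /ind; case: ifPn => yr; last by rewrite mulr0 mollifier_ge0.
rewrite mulr1 /mollifier.
have hd : dot y y <= e ^+ 2 / 2.
  apply: le_trans (_ : \sum_(i < n) (2 * r) ^+ 2 <= _).
    apply: ler_sum => i _; rewrite -expr2 -[leLHS]real_normK ?num_real// lerXn2r ?nnegrE//.
      by rewrite mulr_ge0// ltW.
    exact: le_trans (coord_le_norm y i) yr.
  rewrite sumr_const card_ord -[_ *+ n]mulr_natr /r.
  rewrite (_ : 2 * (e / (4 * (n%:R + 1))) = e / 2 / (n%:R + 1)); last first.
    by field; rewrite gt_eqF.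
  set N := n%:R in n1 *; have N0 : 0 <= N by exact: ler0n.
  have h : N / (N + 1) ^+ 2 <= 1 by rewrite ler_pdivrMr ?exprn_gt0//; nra.
  rewrite (_ : _ * N = e ^+ 2 / 4 * (N / (N + 1) ^+ 2)); first by nra.
  by field; rewrite gt_eqF.
apply: flat0_le; lra.
Qed.

Lemma mollifier0_gt0 e M tau : 0 < e -> 0 < lsum M tau (mollifier e).
Proof.
move=> e0; have zM : (M < M.*2.+1)%N by rewrite ltnS -addnn leq_addr.
rewrite /lsum (bigD1 [ffun _ => Ordinal zM])//= ltr_pwDl//; last first.
  by apply: sumr_ge0 => k _; exact: mollifier_ge0.
rewrite (_ : pt _ _ = 0); last by apply/rowP => i; rewrite !mxE ffunE/= subrr mulr0.
by rewrite /mollifier (_ : dot 0 0 = 0 :> R); [rewrite subr0 /flat exprn_gt0// mulr_gt0// ?expR_gt0|apply/eqP; rewrite dot_eq0].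
Qed.

(** Turns a count of lattice points into a multiple of the mass of the mollifier, the unit in which
    errors are measured; [D] is independent of the mesh. *)
Lemma lsum_ind_le_mollifier (e X T : R) : 0 < e -> 0 <= X -> exists2 D : R, 0 < D &
  fine_mesh (fun M tau => forall x, `|x| <= X ->
    lsum M tau (fun y => ind T (x - y)) <= D * lsum M tau (mollifier e)).
Proof.
move=> e0 X0; have [r [m [r0 m0 hm]]] := mollifier_lower e0.
have [D D0 H] := lsum_ind_doubling T r0 X0.
exists (D / m); first by rewrite divr_gt0.
apply: fine_meshS H => M tau tau0 h x xX; apply: (le_trans (h x xX)).
rewrite -mulrA ler_pM2l// ler_pdivlMl// -lsumZ; exact: ler_lsum.
Qed.

(** For a lattice vector within [tau] of [x] the sum is exactly invariant; the remaining shift is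
    below the modulus of continuity of the mollifier, and the number of points where it matters is
    bounded by a multiple of the mass. *)
Lemma lsum_mollifier_translate (e X eta : R) : 0 < e -> 0 <= X -> 0 < eta ->
  fine_mesh (fun M tau => forall x, `|x| <= X ->
   `|lsum M tau (fun y => mollifier e (x - y)) - lsum M tau (mollifier e)| <= eta * lsum M tau (mollifier e)).
Proof.
move=> e0 X0 eta0.
have [D D0 H1] := lsum_ind_le_mollifier (e + 1) e0 X0.
have etaD : 0 < eta / D by rewrite divr_gt0.
have [d d0 hd] := Cc_equicontinuous (mollifier_Cc e0) etaD.
pose t := Num.min d 1; have t0 : 0 < t by rewrite lt_min d0/=.
have H2 := lsum_shift_fine e (X + 1).
have H3 := fine_mesh_mesh 0 t0.
have H := fine_meshI H1 (fine_meshI H2 H3).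
apply: fine_meshS H => M tau tau0 [doubling [shift [taut _]]] x xX.
have [v hv] := lvec_approx x tau0.
have /andP[taud tau1] : (tau < d) && (tau < 1) by rewrite -lt_min.
pose v' i := - v i.
have v'E : lvec tau v' = - lvec tau v by apply/rowP => i; rewrite !mxE intrN mulrN.
have E : lsum M tau (fun y => mollifier e (y - lvec tau v)) = lsum M tau (mollifier e).
  rewrite -v'E; apply: shift; first by move=> y; exact: mollifier_out.
  rewrite v'E normrN (_ : lvec tau v = x - (x - lvec tau v)); last by rewrite subKr.
  by rewrite (le_trans (ler_normB _ _))// lerD// (le_trans hv)// ltW.
rewrite -{1}E -lsumB (le_trans (ler_norm_lsum _ _ _))//.
apply: le_trans (_ : lsum M tau (fun y => eta / D * ind (e + 1) (x - y)) <= _); last first.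
  rewrite lsumZ (le_trans (ler_wpM2l (ltW etaD) (doubling x xX)))// mulrA divfK//.
  by rewrite gt_eqF.
apply: ler_lsum => y; rewrite -(mollifierN e (y - _)) opprB /ind; case: ifPn => h.
  rewrite mulr1; apply: hd; rewrite (_ : _ - _ = x - lvec tau v).
    exact: le_lt_trans hv taud.
  by apply/rowP => i; rewrite !mxE; ring.
rewrite -ltNge in h; rewrite !mollifier_out ?subrr ?normr0 ?mulr0//; last first.
  by rewrite (lt_trans _ h)// ltrDl.
have h2 : `|x - y| <= `|lvec tau v - y| + `|x - lvec tau v|.
  rewrite (_ : x - y = (lvec tau v - y) + (x - lvec tau v)); first exact: ler_normD.
  by apply/rowP => i; rewrite !mxE; ring.
lra.
Qed.

(** Reflections preserve the Euclidean norm, not the maximum norm; the comparison of the two costs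
    the square root of [n], which [n + 1] bounds. *)
Lemma norm_reflection_le a x : dot a a = 2 -> `|reflection a x| <= (n%:R + 1) * `|x|.
Proof.
move=> a2; rewrite rV_norm_le ?mulr_ge0// ?addr_ge0//; apply/forallP => i.
have h1 := coord_sqr_le_dot (reflection a x) i; rewrite (dot_reflection _ _ a2) in h1.
have h2 : dot x x <= n%:R * `|x| ^+ 2.
  rewrite mulr_natl -[X in _ <= _ *+ X](card_ord n) -sumr_const; apply: ler_sum => j _.
  by rewrite -expr2 -[leLHS]real_normK ?num_real// lerXn2r ?nnegrE// coord_le_norm.
have N0 : 0 <= n%:R :> R by exact: ler0n.
have h3 := normr_ge0 x.
rewrite -ler_sqr ?nnegrE ?mulr_ge0// ?addr_ge0// real_normK ?num_real//.
apply: (le_trans h1); apply: (le_trans h2); rewrite exprMn ler_wpM2r ?sqr_ge0//; nra.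
Qed.

(* Lattice sums are asymptotically invariant under reflections, compared with
   the mass of any fixed mollifier. *)
Lemma lsum_reflection (a : V) (F : V -> R) (e eta : R) : dot a a = 2 ->
  Cc setT F -> 0 < e -> 0 < eta ->
  fine_mesh (fun M tau =>
   `|lsum M tau F - lsum M tau (fun y => F (reflection a y))| <= eta * lsum M tau (mollifier e)).
Proof.
move=> a2 CF e0 eta0.
have [B B0 FB] := Cc_bounded CF.
have [_ [K [cK _ FK]]] := CF.
have [S S0 FS] : exists2 S : R, 0 < S & forall y, S < `|y| -> F y = 0.
  have [M0 [_ KM]] := compact_bounded cK.
  exists (`|M0| + 1); first by rewrite ltr_wpDl.
  move=> y yM; apply: FK => Ky; move: yM; rewrite ltNge => /negP; apply.
  by apply: KM => //; rewrite (le_lt_trans (ler_norm _))// ltrDl.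
have N0 : 0 <= n%:R :> R by exact: ler0n.
pose X := (n%:R + 1) * (S + 1) + 1.
have X0 : 0 <= X by rewrite addr_ge0// mulr_ge0 ?addr_ge0// ltW.
have SX : S + 1 <= X by rewrite /X; nra.
have [D D0 H1] := lsum_ind_le_mollifier X e0 (lexx 0).
pose eta' := eta / (4 * B + 4) / D.
have eta'0 : 0 < eta' by rewrite !divr_gt0// addr_gt0// mulr_gt0.
have [d d0 Fd] := Cc_equicontinuous CF eta'0.
(* The reflected lattice is another lattice. The two sums are linked by a second mollifier, of
   radius [r] below the modulus of continuity of [F], whose lattice mass is nearly the same around
   every centre. *)
pose r := Num.min d 1 / 2; have r0 : 0 < r by rewrite divr_gt0// lt_min d0/=.
have /andP[rd r1] : (r < d) && (r < 1).
  by rewrite -lt_min /r ltr_pdivrMr// ltr_pMr ?ltr1n// lt_min d0/=.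
have H2 : fine_mesh _ := lsum_mollifier_translate r0 X0 (_ : 0 < Num.min 1 eta').
have H2' := H2 _; rewrite lt_min eta'0 ltr01 in H2'; have {}H2' := H2' isT.
apply: fine_meshS (fine_meshI H1 H2') => M tau tau0 [h1 h2].
have {}h1 : lsum M tau (ind X) <= D * lsum M tau (mollifier e).
  have := h1 0; rewrite normr0 => /(_ (lexx _)); apply: le_trans.
  by apply: ler_lsum => y; rewrite /ind sub0r normrN.
set c := lsum M tau (mollifier r) in h2.
have c0 : 0 < c by exact: mollifier0_gt0.
have {}h2 x : `|x| <= X -> `|lsum M tau (fun y => mollifier r (x - y)) - c| <= eta' * c /\
    lsum M tau (fun y => mollifier r (x - y)) <= 2 * c.
  move=> /h2 h; have h' : Num.min 1 eta' <= 1 /\ Num.min 1 eta' <= eta'.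
    by rewrite !ge_min !lexx orbT.
  split; first by rewrite (le_trans h)// ler_wpM2r ?(ltW c0)//; case: h'.
  have h3 : `|lsum M tau (fun y => mollifier r (x - y)) - c| <= 1 * c.
    by rewrite (le_trans h)// ler_wpM2r ?(ltW c0)//; case: h'.
  by move: h3; rewrite ler_norml => /andP[_]; lra.
pose F' y := F (reflection a y).
have FX y : X < `|y| -> F y = 0 by move=> h; apply: FS; lra.
have F'X y : X < `|y| -> F' y = 0.
  move=> h; apply: FS; rewrite ltNge; apply/negP => h'.
  have := norm_reflection_le (reflection a y) a2; rewrite reflection_reflection//.
  by apply/negP; rewrite -ltNge (le_lt_trans _ h)// /X; nra.
have bE y z : mollifier r (reflection a y - z) = mollifier r (reflection a z - y).
  by rewrite mollifier_reflection// -mollifierN opprB.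
have SX' y : `|y| <= S + 1 -> `|reflection a y| <= X.
  by move=> h; apply: le_trans (norm_reflection_le y a2) _; rewrite /X; nra.
have Fle G y : (forall y, X < `|y| -> G y = 0) -> (forall y, `|G y| <= B) ->
    `|G y| <= B * ind X y.
  move=> GX GB; rewrite /ind; case: ifPn => h; first by rewrite mulr1 GB.
  by rewrite GX ?normr0 ?mulr0// ltNge.
(* The mass [c] may be replaced by that of the mollifier centred at [h y], for any centring [h] that
   stays bounded on the support of [G]. *)
have mass G (h : V -> V) : (forall y, X < `|y| -> G y = 0) -> (forall y, `|G y| <= B) ->
    (forall y, G y != 0 -> `|h y| <= X) ->
  `|c * lsum M tau G - lsum M tau (fun y => G y * lsum M tau (fun z => mollifier r (h y - z)))|
   <= eta' * c * B * lsum M tau (ind X).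
  move=> GX GB hG; rewrite -lsumZ -lsumB (le_trans (ler_norm_lsum _ _ _))// -lsumZ.
  apply: ler_lsum => y; have [->|Gy] := eqVneq (G y) 0.
    rewrite mulr0 mul0r subrr normr0; apply: mulr_ge0 (ind_ge0 _ _).
    exact: mulr_ge0 (mulr_ge0 (ltW eta'0) (ltW c0)) (ltW B0).
  have [h3 _] := h2 _ (hG _ Gy).
  rewrite (mulrC c) -mulrBr normrM distrC.
  rewrite (_ : _ * B * _ = B * ind X y * (eta' * c)); last by ring.
  by apply: ler_pM => //; exact: Fle.
have T1 : `|c * lsum M tau F - lsum M tau (fun y => F y * lsum M tau (fun z => mollifier r (reflection a y - z)))|
   <= eta' * c * B * lsum M tau (ind X).
  apply: mass => // y Fy; apply: SX'; rewrite leNgt; apply: contraNN Fy => h.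
  by apply/eqP/FS; lra.
have T3 : `|c * lsum M tau F' - lsum M tau (fun y => F' y * lsum M tau (fun z => mollifier r (reflection a y - z)))|
   <= eta' * c * B * lsum M tau (ind X).
  apply: mass => //; first by move=> y; exact: FB.
  move=> y Fy; rewrite leNgt; apply: contraNN Fy => h.
  by apply/eqP; apply: FS; lra.
(* The kernel [mollifier r (reflection a y - z)] is symmetric in [y] and [z]; on its support [z] is
   within [r] of [reflection a y], so [F z] and [F (reflection a y)] are close. *)
have T2 : `|lsum M tau (fun y => F y * lsum M tau (fun z => mollifier r (reflection a y - z))) -
    lsum M tau (fun y => F' y * lsum M tau (fun z => mollifier r (reflection a y - z)))|
   <= eta' * c * 2 * lsum M tau (ind X).
  have -> : lsum M tau (fun y => F' y * lsum M tau (fun z => mollifier r (reflection a y - z))) =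
      lsum M tau (fun z => lsum M tau (fun y => F' y * mollifier r (reflection a z - y))).
    rewrite exchange_lsum; apply: eq_lsum => y; rewrite -lsumZ.
    by apply: eq_lsum => z; rewrite bE.
  rewrite -lsumB (le_trans (ler_norm_lsum _ _ _))// -lsumZ.
  apply: ler_lsum => z; rewrite -lsumZ -lsumB (le_trans (ler_norm_lsum _ _ _))//.
  have [zS|zS] := leP `|z| (S + 1); last first.
    apply: (@le_trans _ _ 0); last first.
      apply: mulr_ge0 (ind_ge0 _ _).
      by apply: mulr_ge0; [exact: mulr_ge0 (ltW eta'0) (ltW c0)|].
    rewrite le_eqVlt; apply/orP; left; apply/eqP; rewrite /lsum big1// => w _; set y := pt _ w; rewrite -bE.
    have [b0|] := leP `|reflection a y - z| r; last first.
      by move=> /(mollifier_out r0) ->; rewrite !mulr0 subrr normr0.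
    have yS : S < `|reflection a y|.
      have := ler_normB (reflection a y) (reflection a y - z); rewrite subKr => h.
      lra.
    rewrite (FS z); last by lra.
    by rewrite /F' (FS _ yS) !mul0r subrr normr0.
  have [_ h3] := h2 _ (SX' _ zS).
  have -> : ind X z = 1 by rewrite /ind (le_trans zS SX).
  rewrite mulr1 -mulrA [c * 2]mulrC (le_trans _ (ler_wpM2l (ltW eta'0) h3))// -lsumZ.
  apply: ler_lsum => y; rewrite -mulrBl normrM (ger0_norm (mollifier_ge0 _ _)) -bE.
  have [b0|] := leP `|reflection a y - z| r; last by move=> /(mollifier_out r0) ->; rewrite !mulr0.
  rewrite ler_wpM2r ?mollifier_ge0//; apply: Fd.
  by rewrite distrC; exact: le_lt_trans b0 rd.
have tri : `|c * lsum M tau F - c * lsum M tau F'| <= eta' * c * (2 * B + 2) * lsum M tau (ind X).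
  move: T1 T2 T3; rewrite !ler_norml => /andP[? ?] /andP[? ?] /andP[? ?]; apply/andP; split; lra.
rewrite -mulrBr normrM (gtr0_norm c0) in tri.
rewrite -(ler_pM2l c0) (le_trans tri)//.
rewrite (_ : _ * _ * _ * _ = c * (eta' * (2 * B + 2) * lsum M tau (ind X))); last by ring.
rewrite ler_pM2l//.
apply: le_trans (_ : eta' * (2 * B + 2) * (D * lsum M tau (mollifier e)) <= _).
  by rewrite ler_wpM2l// mulr_ge0 ?(ltW eta'0)// addr_ge0// mulr_ge0// ltW.
rewrite mulrA ler_wpM2r ?(ltW (mollifier0_gt0 _ _ e0))//.
rewrite /eta' (_ : _ * D = eta * ((2 * B + 2) / (4 * B + 4))); last first.
  by field; rewrite !gt_eqF//; lra.
by rewrite ler_piMr ?(ltW eta0)// ler_pdivrMr; lra.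
Qed.

End LatticeAsymptotics.

(** * Positive functionals *)

Section Discrete.
Context {R : realType} {n : nat}.
Local Notation V := 'rV[R]_n.
Implicit Types (f : V -> R) (x y : V) (i : 'I_n).

Lemma is_derive_line f x w (t d : R) : is_derive (x + t *: w) w f d ->
  is_derive t 1 (fun s : R => f (x + s *: w)) d.
Proof.
move=> [df dE].
have e : (fun h => h^-1 *: (((fun s => f (x + s *: w)) \o shift t) (h *: 1) - f (x + t *: w)))
   = (fun h => h^-1 *: ((f \o shift (x + t *: w)) (h *: w) - f (x + t *: w))).
  apply/funext => h /=; congr (_ *: (f _ - _)).
  by rewrite [_%:A]mulr1 scalerDl addrCA.
by apply: DeriveDef; [rewrite /derivable e|rewrite /derive e].
Qed.

Definition second_diff tau i f x : R :=
  (f (x + tau *: delta_mx 0 i) + f (x - tau *: delta_mx 0 i) - 2 * f x) / tau ^+ 2.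

Definition discrete_laplacian tau f x : R := \sum_i second_diff tau i f x.

Lemma CK_infty_is_derive (D : set V) f x i : CK_infty D f ->
  is_derive x (delta_mx 0 i) f (partial i f x).
Proof. by move=> [sf _ _]; apply: DeriveDef => //; exact: (sf [::]).2. Qed.

(** The mean value theorem, applied twice to the second-order remainder along the direction [i];
    equicontinuity of the second partial derivative makes the mesh uniform in [x]. *)
Lemma second_diff_cvg (D : set V) f i (eta : R) : CK_infty D f -> 0 < eta ->
  exists2 t : R, 0 < t & forall tau : R, 0 < tau -> tau < t -> forall x,
    `|second_diff tau i f x - partial i (partial i f) x| <= eta.
Proof.
move=> kf eta0; set e := delta_mx 0 i : V.
have kf1 := CK_infty_partial i kf; have kf2 := CK_infty_partial i kf1.
have eta2 : 0 < eta / 2 by rewrite divr_gt0.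
have [d d0 hd] := Cc_equicontinuous (CK_infty_Cc kf2) eta2.
have en : `|e| <= 1.
  by rewrite rV_norm_le//; apply/forallP => j; rewrite mxE eqxx/=; case: eqP; rewrite ?normr1 ?normr0.
exists d => // tau tau0 taud x; set c := partial i (partial i f) x.
have close (s : R) : 0 <= s <= tau -> `|partial i (partial i f) (x + s *: e) - c| <= eta / 2
    /\ `|partial i (partial i f) (x + (- s) *: e) - c| <= eta / 2.
  move=> /andP[s0 st]; have hs : `|s *: e| < d.
    by rewrite normrZ ger0_norm// (le_lt_trans _ taud)// (le_trans _ st)// ler_piMr.
  split; apply: hd; first by rewrite addrAC subrr add0r.
  by rewrite addrAC subrr add0r scaleNr normrN.
pose q s := f (x + s *: e) + f (x + (- s) *: e) - 2 * f x - s ^+ 2 * c.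
pose p s := partial i f (x + s *: e) - partial i f (x + (- s) *: e) - 2 * s * c.
have line (g h : V -> R) (s : R) : (forall y, is_derive y e g (h y)) ->
    is_derive s (1 : R) (fun s : R => g (x + s *: e)) (h (x + s *: e)) /\
    is_derive s (1 : R) (fun s : R => g (x + (- s) *: e)) (- h (x + (- s) *: e)).
  move=> gh; split; first exact: is_derive_line.
  have h1 : is_derive (- s) (1 : R) (fun s : R => g (x + s *: e)) (h (x + (- s) *: e)) by exact: is_derive_line.
  have h2 : is_derive s 1 (fun s : R => - s) (- 1) by exact: is_deriveNid.
  have := @is_derive1_comp _ (fun s => g (x + s *: e)) (fun s => - s) s _ _ h1 h2.
  by rewrite mulrN1.
have dq (s : R) : is_derive s 1 q (p s).
  have [h1 h2] := line f (partial i f) s (fun y => CK_infty_is_derive y i kf).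
  have h3 : is_derive s 1 (fun s : R => s ^+ 2 * c) (2 * s * c).
    have := is_deriveM (is_deriveM (is_derive_id s (1:R)) (is_derive_id s (1:R))) (is_derive_cst c s (1:R)).
    move=> h; apply: (is_derive_eq h); rewrite /GRing.scale/=; ring.
  have h4 := is_deriveB (is_deriveB (is_deriveD h1 h2) (is_derive_cst (2 * f x) s 1)) h3.
  apply: (is_derive_eq h4); rewrite /p subr0.
  by move: (partial i f _) (partial i f _) => F1 F2.
have dp (s : R) : is_derive s 1 p (partial i (partial i f) (x + s *: e) +
    partial i (partial i f) (x + (- s) *: e) - 2 * c).
  have [h1 h2] := line (partial i f) _ s (fun y => CK_infty_is_derive y i kf1).
  have h3 : is_derive s 1 (fun s : R => 2 * s * c) (2 * c).
    have := is_deriveM (is_deriveM (is_derive_cst (2:R) s (1:R)) (is_derive_id s (1:R))) (is_derive_cst c s (1:R)).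
    move=> h; apply: (is_derive_eq h); rewrite /GRing.scale/=; ring.
  by apply: (is_derive_eq (is_deriveB (is_deriveB h1 h2) h3)); rewrite opprK.
have cont (g h : R -> R) (a b : R) : (forall s : R, is_derive s 1 g (h s)) -> {within `[a, b], continuous g}.
  move=> gh; apply: continuous_subspaceT => s.
  by apply/differentiable_continuous/derivable1_diffP; case: (gh s).
have pb (s : R) : 0 <= s <= tau -> `|p s| <= eta * s.
  move=> /andP[s0 st].
  have [r] := MVT_segment s0 (fun r _ => dp r) (cont _ _ _ _ dp).
  rewrite in_itv/= => /andP[r0 rs].
  have -> : p 0 = 0 by rewrite /p oppr0 scale0r addr0 subrr mulr0 mul0r subrr.
  rewrite !subr0 => ->; rewrite normrM (ger0_norm s0) ler_wpM2r//.
  move: (close r); rewrite r0 (le_trans rs st) => /(_ isT)[c1 c2].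
  move: c1 c2; move: (partial i _ (x + r *: e)) (partial i _ (x + - r *: e)) => F1 F2.
  clearbody c; rewrite !ler_norml => /andP[? ?] /andP[? ?]; apply/andP; split; lra.
have [r] := MVT_segment (ltW tau0) (fun r _ => dq r) (cont _ _ _ _ dq).
rewrite in_itv/= => /andP[r0 rt].
have -> : q 0 = 0 by rewrite /q oppr0 scale0r addr0 expr0n/=; ring.
rewrite !subr0 => qE.
have -> : second_diff tau i f x - c = q tau / tau ^+ 2.
  rewrite /second_diff /q scaleNr -/e; move: (f (x + _)) (f (x - _)) (f x) => F1 F2 F3.
  by clearbody c; field; rewrite gt_eqF.
rewrite normrM normfV (gtr0_norm (exprn_gt0 _ tau0)) ler_pdivrMr ?exprn_gt0// qE.
rewrite normrM (gtr0_norm tau0) expr2 mulrA ler_wpM2r ?(ltW tau0)//.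
have := pb r; rewrite r0 rt => /(_ isT) h; apply: (le_trans h).
by rewrite ler_wpM2l// ltW.
Qed.

Lemma discrete_laplacian_cvg (D : set V) f (eta : R) : CK_infty D f -> 0 < eta ->
  exists2 t : R, 0 < t & forall tau : R, 0 < tau -> tau < t -> forall x,
    `|discrete_laplacian tau f x - laplacian f x| <= eta.
Proof.
move=> kf eta0; have eta' : 0 < eta / (n%:R + 1) by rewrite divr_gt0// ltr_wpDl.
have : forall s : seq 'I_n, exists2 t : R, 0 < t & forall i, i \in s -> forall tau : R, 0 < tau -> tau < t ->
   forall x, `|second_diff tau i f x - partial i (partial i f) x| <= eta / (n%:R + 1).
  elim=> [|i s [t t0 ih]]; first by exists 1.
  have [t' t'0 h] := second_diff_cvg i kf eta'.
  exists (Num.min t t'); first by rewrite lt_min t0.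
  move=> j; rewrite inE => /orP[/eqP ->|js] tau tau0; rewrite lt_min => /andP[? ?] x.
    exact: h.
  exact: ih.
move=> /(_ (index_enum 'I_n))[t t0 h]; exists t => // tau tau0 taut x.
rewrite /discrete_laplacian /laplacian -sumrB (le_trans (ler_norm_sum _ _ _))//.
apply: le_trans (_ : \sum_(i < n) eta / (n%:R + 1) <= _).
  by apply: ler_sum => i _; apply: h => //; exact: mem_index_enum.
rewrite sumr_const card_ord -[_ *+ n]mulr_natr -mulrA ler_piMr ?(ltW eta0)//.
by rewrite mulrC ler_pdivrMr ?mul1r ?lerDl// ltr_wpDl.
Qed.

End Discrete.

Section PositiveFunctional.
Context {R : realType} {n : nat}.
Local Notation V := 'rV[R]_n.
Implicit Types (f g : V -> R) (theta : (V -> R) -> R).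

Definition Cb f := continuous f /\ exists M : R, forall x, `|f x| <= M.

(** Stands for integration against a finite measure. *)
Record positive_functional theta : Prop := PositiveFunctional {
  pf_linear : forall (c : R) f g, Cb f -> Cb g ->
    theta (fun x => c * f x + g x) = c * theta f + theta g ;
  pf_ge0 : forall f, Cb f -> (forall x, 0 <= f x) -> 0 <= theta f }.

Lemma Cc_Cb D f : Cc D f -> Cb f.
Proof. by move=> Cf; have [M _ fM] := Cc_bounded Cf; split; [case: Cf|exists M]. Qed.

Lemma Cb_cst (c : R) : Cb (cst c).
Proof. by split; [move=> x; exact: cst_continuous|exists `|c|]. Qed.

Lemma CbD f g : Cb f -> Cb g -> Cb (fun x => f x + g x).
Proof.
move=> [fc [M fM]] [gc [N gN]]; split; first by move=> x; exact: (continuousD (fc x) (gc x)).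
by exists (M + N) => x; rewrite (le_trans (ler_normD _ _))// lerD.
Qed.

Lemma CbM f g : Cb f -> Cb g -> Cb (fun x => f x * g x).
Proof.
move=> [fc [M fM]] [gc [N gN]]; split; first by move=> x; exact: (continuousM (fc x) (gc x)).
by exists (M * N) => x; rewrite normrM ler_pM.
Qed.

Lemma CbZ (c : R) f : Cb f -> Cb (fun x => c * f x).
Proof. exact: CbM (Cb_cst c). Qed.

Lemma CbN f : Cb f -> Cb (fun x => - f x).
Proof.
move=> /(CbZ (-1)); rewrite (_ : (fun _ => _) = fun x => - f x)//.
by apply/funext => x; rewrite mulN1r.
Qed.

Lemma CbB f g : Cb f -> Cb g -> Cb (fun x => f x - g x).
Proof. by move=> ? ?; apply: CbD => //; exact: CbN. Qed.

Lemma Cb_norm f : Cb f -> Cb (fun x => `|f x|).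
Proof.
move=> [fc [M fM]]; split; first by move=> x; exact: (cvg_norm (fc x)).
by exists M => x; rewrite normr_id.
Qed.

Lemma Cb_sum (I : Type) (s : seq I) (F : I -> V -> R) :
  (forall i, Cb (F i)) -> Cb (fun x => \sum_(i <- s) F i x).
Proof.
move=> FC; elim: s => [|i s ih].
  by rewrite (_ : (fun _ => _) = cst 0); [exact: Cb_cst|apply/funext => x; rewrite big_nil].
rewrite (_ : (fun _ => _) = fun x => F i x + \sum_(j <- s) F j x); first exact: CbD.
by apply/funext => x; rewrite big_cons.
Qed.

Variable theta : (V -> R) -> R.
Hypothesis ht : positive_functional theta.

Lemma pfD f g : Cb f -> Cb g -> theta (fun x => f x + g x) = theta f + theta g.
Proof.
move=> Cf Cg; rewrite -[theta f]mul1r -(pf_linear ht)//; congr (theta _).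
by apply/funext => x; rewrite mul1r.
Qed.

Lemma pf0 : theta (cst 0) = 0.
Proof.
have := pfD (Cb_cst 0) (Cb_cst 0); rewrite (_ : (fun _ => _) = cst 0).
  by move=> h; lra.
by apply/funext => x; rewrite /cst addr0.
Qed.

Lemma pfZ (c : R) f : Cb f -> theta (fun x => c * f x) = c * theta f.
Proof.
move=> Cf; rewrite -[RHS]addr0 -pf0 -(pf_linear ht)//; last exact: Cb_cst.
by congr (theta _); apply/funext => x; rewrite /cst addr0.
Qed.

Lemma pfN f : Cb f -> theta (fun x => - f x) = - theta f.
Proof.
move=> Cf; rewrite -mulN1r -pfZ//; congr (theta _).
by apply/funext => x; rewrite mulN1r.
Qed.

Lemma pfB f g : Cb f -> Cb g -> theta (fun x => f x - g x) = theta f - theta g.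
Proof. by move=> Cf Cg; rewrite pfD ?pfN//; exact: CbN. Qed.

Lemma pf_sum (I : Type) (s : seq I) (F : I -> V -> R) : (forall i, Cb (F i)) ->
  theta (fun x => \sum_(i <- s) F i x) = \sum_(i <- s) theta (F i).
Proof.
move=> FC; elim: s => [|i s ih].
  rewrite [RHS]big_nil -[RHS]pf0; congr (theta _).
  by apply/funext => x; rewrite big_nil.
rewrite big_cons -ih -pfD//; last exact: Cb_sum.
by congr (theta _); apply/funext => x; rewrite big_cons.
Qed.

Lemma pf_le f g : Cb f -> Cb g -> (forall x, f x <= g x) -> theta f <= theta g.
Proof.
move=> Cf Cg fg; rewrite -subr_ge0 -pfB//; apply: (pf_ge0 ht); first exact: CbB.
by move=> x; rewrite subr_ge0.
Qed.

Lemma pf_norm_le f g : Cb f -> Cb g -> (forall x, `|f x| <= g x) -> `|theta f| <= theta g.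
Proof.
move=> Cf Cg fg; rewrite ler_norml -pfN//.
by apply/andP; split; apply: pf_le => //; [exact: CbN|move=> x; have := fg x; rewrite ler_norml => /andP[]..].
Qed.

End PositiveFunctional.

(** * The Kato inequality *)

Section Kato.
Context {R : realType} {n : nat} (Phi Phip : set 'rV[R]_n).
Hypothesis hPhi : root_system Phi.
Hypothesis hPhip : positive_subsystem Phi Phip.
Local Notation V := 'rV[R]_n.
Local Notation E := (regular_set Phi).
Local Notation P := (posroots Phip).
Implicit Types (x y z a b : V) (i : 'I_n) (F f g u : V -> R).
Variables k l : V -> R.
Hypothesis hkW : weyl_invariant Phi k.
Local Notation logw := (logw Phip k).
Local Notation pot := (potential Phip k).
Local Notation L := (dunkl_laplacian Phip k l).

Let oE : open E := open_regular_set hPhi.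

Variables (theta1 theta2 : (V -> R) -> R) (lam : R).
Hypothesis ht1 : positive_functional theta1.
Hypothesis ht2 : positive_functional theta2.
Hypothesis lam_gt0 : 0 < lam.
Hypothesis resolvent : forall u, CK_infty E u ->
  theta1 (fun x => lam * u x - L u x) = theta2 (fun x => lam * u x - L u x).

(** [S] plays the role of the total variation of the signed functional [D]. *)
Let D F : R := theta1 F - theta2 F.
Let S F : R := theta1 F + theta2 F.

Let DD f g : Cb f -> Cb g -> D (fun x => f x + g x) = D f + D g.
Proof. by move=> Cf Cg; rewrite /D !pfD//; ring. Qed.

Let DZ c f : Cb f -> D (fun x => c * f x) = c * D f.
Proof. by move=> Cf; rewrite /D !pfZ//; ring. Qed.

Let DB f g : Cb f -> Cb g -> D (fun x => f x - g x) = D f - D g.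
Proof. by move=> Cf Cg; rewrite /D !pfB//; ring. Qed.

Let Dsum (I : Type) (s : seq I) (F : I -> V -> R) : (forall j, Cb (F j)) ->
  D (fun x => \sum_(j <- s) F j x) = \sum_(j <- s) D (F j).
Proof. by move=> FC; rewrite /D !pf_sum// sumrB. Qed.

Let SZ c f : Cb f -> S (fun x => c * f x) = c * S f.
Proof. by move=> Cf; rewrite /S !pfZ//; ring. Qed.

Let Ssum (I : Type) (s : seq I) (F : I -> V -> R) : (forall j, Cb (F j)) ->
  S (fun x => \sum_(j <- s) F j x) = \sum_(j <- s) S (F j).
Proof. by move=> FC; rewrite /S !pf_sum// big_split. Qed.

Let S_le f g : Cb f -> Cb g -> (forall x, f x <= g x) -> S f <= S g.
Proof. by move=> Cf Cg fg; rewrite /S lerD// pf_le. Qed.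

Let S_ge0 f : Cb f -> (forall x, 0 <= f x) -> 0 <= S f.
Proof. by move=> Cf f0; rewrite /S addr_ge0//; [exact: (pf_ge0 ht1)|exact: (pf_ge0 ht2)]. Qed.

Let D_le f g : Cb f -> Cb g -> (forall x, `|f x| <= g x) -> `|D f| <= S g.
Proof.
move=> Cf Cg fg; rewrite /D /S (le_trans (ler_normB _ _))// lerD//; exact: pf_norm_le.
Qed.

Variables (chi : V -> R) (K : set V) (d1 : R).
Hypothesis chiC : Cc E chi.
Hypothesis chi_ge0 : forall x, 0 <= chi x.
Hypothesis chi_le1 : forall x, chi x <= 1.
Hypothesis chi_reflection : forall a x, Phi a -> chi (reflection a x) = chi x.
Hypothesis chi_near : forall z x, K z -> `|z - x| < d1 -> chi x = 1.

Let chi_out x : ~ E x -> chi x = 0.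
Proof. by move: chiC => [_ [C [_ CE h]]] nE; apply: h => /CE. Qed.

Let near_E z x : K z -> `|z - x| < d1 -> E x.
Proof.
move=> Kz zx; apply: contrapT => /chi_out; rewrite (chi_near Kz zx) => /eqP.
by rewrite oner_eq0.
Qed.

(** The inverse weight may blow up at the walls. The invariant plateau [chi], equal to 1 around [K],
    gives it compact support in [E], so that the mollified difference is defined and continuous for
    every centre, not only near [K]. *)
Let w x : R := expR (- logw x) * chi x.

Let wC : Cc E w.
Proof.
apply: CcM => // x Ex; apply: (elementary_continuous _ Ex).
by apply: elementary_expR; apply: elementary_opp; exact: (elementary_logw hPhi hPhip).
Qed.

Let w_ge0 x : 0 <= w x. Proof. by rewrite mulr_ge0// expR_ge0. Qed.

Let w_out x : ~ E x -> w x = 0. Proof. by move=> /chi_out; rewrite /w => ->; rewrite mulr0. Qed.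

Let wCb : Cb w := Cc_Cb wC.

Let wF F : (forall x, E x -> {for x, continuous F}) -> Cb (fun x => w x * F x).
Proof.
move=> Fc; rewrite (_ : (fun x => _) = fun x => F x * w x).
  exact: Cc_Cb (CcM oE wC Fc).
by apply/funext => x; rewrite mulrC.
Qed.

Let wFc F : continuous F -> Cb (fun x => w x * F x).
Proof. by move=> Fc; apply: wF => x _; exact: Fc. Qed.

Let T : R := S w.

Let T_ge0 : 0 <= T. Proof. exact: S_ge0. Qed.

Variable e : R.
Hypothesis e_gt0 : 0 < e.
Hypothesis e_lt : e < d1.

Let rho z x : R := mollifier e (x - z).

Let rhoE z : elementary setT (rho z) := elementary_mollifier e z.

Let rho_cont z : continuous (rho z).
Proof. by move=> x; exact: (elementary_continuous (rhoE z) I). Qed.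

Let rho_out z x : e < `|x - z| -> rho z x = 0. Proof. exact: mollifier_out. Qed.

Let m z : R := D (fun x => w x * rho z x).
Let kap z : R := S (fun x => w x * rho z x).

Let kap_ge0 z : 0 <= kap z.
Proof. by apply: S_ge0 => [|x]; [exact: wFc|rewrite mulr_ge0// mollifier_ge0]. Qed.

Let m_le_kap z : `|m z| <= kap z.
Proof.
apply: D_le => [||x]; [exact: wFc|exact: wFc|].
by rewrite ger0_norm// mulr_ge0// mollifier_ge0.
Qed.

Let m_continuous : continuous m.
Proof.
move=> z; apply/(@cvgrPdist_le _ _ V (nbhs z) (nbhs_filter z)) => t t0.
have t' : 0 < t / (T + 1) by rewrite divr_gt0// ltr_wpDl.
have [d d0 hd] := Cc_equicontinuous (mollifier_Cc (n := n) e_gt0) t'.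
suff h : forall y, `|z - y| < d -> `|m z - m y| <= t.
  by apply: filterS (nbhsx_ballx z d d0) => y; rewrite -ball_normE; exact: h.
move=> y zy.
rewrite /m -DB; [|exact: wFc..].
apply: (@le_trans _ _ (t / (T + 1) * T)); last first.
  by rewrite mulrAC ler_pdivrMr ?ltr_wpDl// ler_pM2l// lerDl.
rewrite /T -SZ//; apply: D_le; first by apply: CbB; exact: wFc.
  exact: CbZ.
move=> x; rewrite -mulrBr normrM (ger0_norm (w_ge0 x)) mulrC ler_wpM2r//.
apply: hd; rewrite (_ : _ - _ = y - z); first by rewrite distrC.
by apply/rowP => j; rewrite !mxE; ring.
Qed.

Let jump a x : R := l a / dot x a ^+ 2.

Let jump_reflection a x : Phi a -> jump a (reflection a x) = jump a x.
Proof.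
move=> Pa; have a2 := root_norm hPhi Pa.
by rewrite /jump dot_reflectionC// reflection_self// dotNr sqrrN.
Qed.

Let jump_cont a x : a \in P -> E x -> {for x, continuous (jump a)}.
Proof.
move=> /(posroots_sub hPhi hPhip) Pa Ex.
rewrite (_ : jump a = fun x => cst (l a) x * ((dot x a)^-1 * (dot x a)^-1)).
  apply: (elementary_continuous (D := E)) => //; apply: (elementary_mul (elementary_cst _ _)).
  by apply: elementary_mul; apply: elementary_inv (elementary_dot _ a) _ => y; exact: regular_dot_neq0.
by apply/funext => y; rewrite /jump expr2 invfM.
Qed.

Let pot_cont x : E x -> {for x, continuous pot}.
Proof. by move=> Ex; exact: (elementary_continuous (elementary_potential hPhi hPhip k) Ex). Qed.

(** Freezes the coefficient [g] at the value [c]; the error involves the oscillation of [g] on the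
    support of [F]. *)
Let localize F g (c om : R) : (forall x, E x -> {for x, continuous F}) ->
  (forall x, 0 <= F x) -> (forall x, E x -> {for x, continuous g}) ->
  (forall x, E x -> F x != 0 -> `|g x - c| <= om) ->
  `|D (fun x => w x * (g x * F x)) - c * D (fun x => w x * F x)| <=
  om * S (fun x => w x * F x).
Proof.
move=> Fc F0 gc gom.
have gF x : E x -> {for x, continuous (fun x => g x * F x)}.
  by move=> Ex; exact: (continuousM (gc x Ex) (Fc x Ex)).
rewrite -DZ; last exact: wF.
rewrite -DB; [|exact: wF|by apply: CbZ; exact: wF].
rewrite -SZ; last exact: wF.
apply: D_le.
- by apply: CbB; [exact: wF|apply: CbZ; exact: wF].
- by apply: CbZ; exact: wF.
move=> x; have [Ex|/w_out ->] := pselect (E x); last by rewrite !mul0r !mulr0 subrr normr0.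
rewrite (_ : _ - _ = (g x - c) * (w x * F x)); last by ring.
rewrite normrM (ger0_norm (mulr_ge0 (w_ge0 x) (F0 x))).
have [->|Fx] := eqVneq (F x) 0; first by rewrite !mulr0.
by rewrite ler_wpM2r ?mulr_ge0// gom.
Qed.

Let lap_rho z := laplacian (rho z).

Let closed_cube z : closed [set x : V | `|x - z| <= e].
Proof.
have h (t : V) : (fun y : V => y - z) @ t --> t - z.
  have hid : (fun y : V => y) @ t --> t by move=> A.
  exact: (cvgB hid (@cst_continuous _ _ z t)).
apply: (@closed_comp _ _ (fun y : V => `|y - z|) [set t | t <= e]) => [y _|]; last exact: closed_le.
exact: (cvg_norm (h y)).
Qed.

Let compact_cube z : compact [set x : V | `|x - z| <= e].
Proof.
apply: bounded_closed_compact => //.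
exists (`|z| + e); split; first exact: num_real.
move=> N zN x /= xz; apply: le_trans (ltW zN).
by rewrite -[x](subrK z) (le_trans (ler_normD _ _))// addrC lerD2l.
Qed.

Let rho_CK z : CK_infty setT (rho z).
Proof.
apply: (@elementary_CK_infty _ _ setT _ (rho z) [set x | `|x - z| <= e]) => //.
- exact: openT.
- by move=> x /negP; rewrite -ltNge; exact: rho_out.
Qed.

Let lap_rho_cont z : continuous (lap_rho z).
Proof.
apply: (@Cc_continuous _ _ setT); apply: Cc_sum => i; apply: CK_infty_Cc.
by do 2!apply: CK_infty_partial.
Qed.

Let lap_rho_out z x : e < `|x - z| -> lap_rho z x = 0.
Proof.
move=> h; rewrite /lap_rho /laplacian big1// => i _.
have p0 y : ~ [set x | `|x - z| <= e] y -> rho z y = 0.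
  by move=> /negP; rewrite -ltNge; exact: rho_out.
have p1 y : ~ [set x | `|x - z| <= e] y -> partial i (rho z) y = 0.
  exact: (partial_eq0 i (@closed_cube z) p0).
apply: (partial_eq0 i (@closed_cube z) p1).
by apply/negP; rewrite -ltNge.
Qed.

Let u z x : R := rho z x * expR (- logw x).

Let u_CK z : K z -> CK_infty E (u z).
Proof.
move=> Kz.
apply: (@elementary_CK_infty _ _ E _ (u z) [set x | `|x - z| <= e]) => //.
- apply: elementary_mul; first exact: elementaryS (rhoE z).
  by apply: elementary_expR; apply: elementary_opp; exact: (elementary_logw hPhi hPhip).
- move=> x /= xz; apply: (near_E Kz); rewrite distrC; exact: le_lt_trans e_lt.
- by move=> x /negP; rewrite -ltNge /u => /rho_out ->; rewrite mul0r.
Qed.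

(** For this test function the drift turns into the potential, and as [logw] is invariant under
    reflections the jumps act on [rho z] alone. *)
Let L_u z x : K z -> lam * u z x - L (u z) x =
  w x * (lam * rho z x - 2^-1 * lap_rho z x + pot x * rho z x -
   \sum_(a <- P) jump a x * (rho z (reflection a x) - rho z x)).
Proof.
move=> Kz; have [Ex|nEx] := pselect (E x); last first.
  rewrite (dunkl_laplacian_out hPhi hPhip k l (u_CK Kz) nEx) w_out// mul0r.
  rewrite /u rho_out ?mul0r ?mulr0 ?subr0// ltNge; apply/negP => h.
  by apply: nEx; apply: (near_E Kz); rewrite distrC; exact: le_lt_trans e_lt.
have Lu : L (u z) x = expR (- logw x) * (2^-1 * lap_rho z x - pot x * rho z x +
   \sum_(a <- P) jump a x * (rho z (reflection a x) - rho z x)).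
  have rE : elementary E (rho z) by exact: elementaryS (rhoE z).
  have gs := diffusion_part_ground_state hPhi hPhip hkW rE Ex.
  rewrite (dunkl_laplacianE hPhi hPhip).
  rewrite -[X in X + _ = _]/(diffusion_part Phip k (u z) x) gs.
  rewrite [RHS]mulrDr; congr (_ + _).
  rewrite mulr_sumr big_seq [RHS]big_seq; apply: eq_bigr => a /(posroots_sub hPhi hPhip) Pa.
  rewrite /u (logw_reflection hPhi hPhip hkW)// /jump; ring.
rewrite Lu /w /u.
(* Replacing [exp(- logw)] by [w] changes nothing: where [chi] differs from 1, the point and, by
   invariance of [chi], all its reflections lie outside the support of [rho z]. *)
have [->|nchi] := eqVneq (chi x) 1; first by rewrite mulr1; ring.
have far y : chi y = chi x -> e < `|y - z|.
  move=> yx; rewrite ltNge; apply/negP => h; move/eqP: nchi; apply.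
  by rewrite -yx; apply: (chi_near Kz); rewrite distrC; exact: le_lt_trans e_lt.
rewrite (rho_out (far x erefl)) (lap_rho_out (far x erefl)).
rewrite (_ : \sum_(a <- P) _ = 0); first by ring.
rewrite big1_seq// => a /(posroots_sub hPhi hPhip) Pa.
by rewrite rho_out ?subrr ?mulr0//; apply: far; exact: chi_reflection.
Qed.

(** The resolvent equation tested with [u z], with potential and jump rates frozen at [z]. A
    reflection in the argument of [rho z] is a reflection of its centre, which turns the jumps of
    the test function into jumps of [m]. *)
Lemma equation_at z (om : R) : K z ->
  (forall x, E x -> `|x - z| <= e -> `|pot x - pot z| <= om) ->
  (forall a, a \in P -> forall x, E x -> `|x - z| <= e -> `|jump a x - jump a z| <= om) ->
  `|lam * m z - 2^-1 * D (fun x => w x * lap_rho z x) + pot z * m z -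
    \sum_(a <- P) jump a z * (m (reflection a z) - m z)| <=
  om * (kap z + \sum_(a <- P) (kap (reflection a z) + kap z)).
Proof.
move=> Kz hpot hjump.
pose rs a x := rho z (reflection a x).
have rs_cont a : continuous (rs a).
  move=> x; apply: (@continuous_comp _ _ _ (reflection a) (rho z)); [exact: continuous_reflection|exact: rho_cont].
have rsE a : a \in P -> rs a = rho (reflection a z).
  move=> /(posroots_sub hPhi hPhip)/(root_norm hPhi) a2; apply/funext => x.
  exact: mollifier_reflection.
(* Zero outside the positive roots, so that continuity and the rules for sums hold for every
   index. *)
pose jump' a x := if a \in P then jump a x else 0.
have jump'_cont a x : E x -> {for x, continuous (jump' a)}.
  move=> Ex; rewrite /jump'; case: (boolP (a \in P)) => aP; first exact: jump_cont.
  exact: cst_continuous.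
have wjump F a : continuous F -> Cb (fun x => w x * (jump' a x * F x)).
  move=> Fc; apply: wF => x Ex; exact: (continuousM (jump'_cont a x Ex) (Fc x)).
have wpot : Cb (fun x => w x * (pot x * rho z x)).
  apply: wF => x Ex; exact: (continuousM (pot_cont Ex) (@rho_cont z x)).
have eq0 : D (fun x => w x * (lam * rho z x - 2^-1 * lap_rho z x + pot x * rho z x -
   \sum_(a <- P) jump a x * (rho z (reflection a x) - rho z x))) = 0.
  have := resolvent (u_CK Kz); rewrite (_ : (fun x => _) = (fun x =>
   w x * (lam * rho z x - 2^-1 * lap_rho z x + pot x * rho z x -
   \sum_(a <- P) jump a x * (rho z (reflection a x) - rho z x)))).
    by rewrite /D => ->; rewrite subrr.
  by apply/funext => x; exact: L_u.
have eq1 : lam * m z - 2^-1 * D (fun x => w x * lap_rho z x) +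
    D (fun x => w x * (pot x * rho z x)) -
    \sum_(a <- P) (D (fun x => w x * (jump' a x * rs a x)) -
                   D (fun x => w x * (jump' a x * rho z x))) = 0.
  rewrite -[RHS]eq0 -DZ; last exact: wFc.
  rewrite -DZ; last exact: wFc.
  rewrite -DB; [|by apply: CbZ; exact: wFc..].
  rewrite -DD//; last by apply: CbB; apply: CbZ; exact: wFc.
  pose FF a x := w x * (jump' a x * rs a x) - w x * (jump' a x * rho z x).
  have FFC a : Cb (FF a) by apply: CbB; apply: wjump; [exact: rs_cont|exact: rho_cont].
  rewrite (eq_bigr (fun a => D (FF a))); last first.
    by move=> a _; rewrite -DB//; apply: wjump; [exact: rs_cont|exact: rho_cont].
  rewrite -(Dsum P FFC).
  rewrite -DB; last 2 first.
  - by apply: CbD => //; apply: CbB; apply: CbZ; exact: wFc.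
  - exact: Cb_sum.
  congr D; apply/funext => x.
  rewrite mulrBr; congr (_ - _); first by ring.
  rewrite mulr_sumr big_seq [RHS]big_seq; apply: eq_bigr => a aP.
  by rewrite /FF /jump' aP /rs; ring.
have b1 : `|D (fun x => w x * (pot x * rho z x)) - pot z * m z| <= om * kap z.
  apply: localize => //.
  - by move=> x _; exact: rho_cont.
  - by move=> x; exact: mollifier_ge0.
  - move=> x Ex rx; apply: hpot => //; rewrite leNgt; apply: contraNN rx => h.
    by rewrite rho_out.
have b2 a : a \in P ->
    `|D (fun x => w x * (jump' a x * rs a x)) - jump a z * m (reflection a z)|
      <= om * kap (reflection a z).
  move=> aP; have Pa := posroots_sub hPhi hPhip aP; rewrite /m /kap -(rsE _ aP); apply: localize => //.
  - by move=> x _; exact: rs_cont.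
  - by move=> x; exact: mollifier_ge0.
  - by move=> x; exact: jump'_cont.
  - move=> x Ex rx; rewrite /jump' aP -(jump_reflection _ Pa); apply: hjump => //.
      exact: regular_reflect.
    by rewrite leNgt; apply: contraNN rx => h; rewrite /rs rho_out.
have b3 a : a \in P ->
    `|D (fun x => w x * (jump' a x * rho z x)) - jump a z * m z| <= om * kap z.
  move=> aP; apply: localize => //.
  - by move=> x _; exact: rho_cont.
  - by move=> x; exact: mollifier_ge0.
  - by move=> x; exact: jump'_cont.
  - move=> x Ex rx; rewrite /jump' aP; apply: hjump => //.
    by rewrite leNgt; apply: contraNN rx => h; rewrite rho_out.
have b4 : `|\sum_(a <- P) (D (fun x => w x * (jump' a x * rs a x)) -
                   D (fun x => w x * (jump' a x * rho z x))) -
    \sum_(a <- P) jump a z * (m (reflection a z) - m z)| <=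
    om * \sum_(a <- P) (kap (reflection a z) + kap z).
  rewrite -sumrB (le_trans (ler_norm_sum _ _ _))// mulr_sumr big_seq [leRHS]big_seq.
  apply: ler_sum => a aP.
  have pair (d2 d3 j m1 m2 k1 k2 : R) : `|d2 - j * m1| <= om * k1 ->
      `|d3 - j * m2| <= om * k2 -> `|d2 - d3 - j * (m1 - m2)| <= om * (k1 + k2).
    rewrite !ler_norml mulrBr mulrDr => /andP[? ?] /andP[? ?]; apply/andP; split; lra.
  exact: pair (b2 a aP) (b3 a aP).
have final (lm LL B1 pm B4 J ok oK : R) : `|B1 - pm| <= ok -> `|B4 - J| <= oK ->
    lm - LL + B1 - B4 = 0 -> `|lm - LL + pm - J| <= ok + oK.
  rewrite !ler_norml => /andP[? ?] /andP[? ?] ?; apply/andP; split; lra.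
by rewrite [leRHS]mulrDr; exact: final b1 b4 eq1.
Qed.

Hypothesis hl : forall a, Phi a -> 0 <= l a.

Let jump_ge0 a z : a \in P -> 0 <= jump a z.
Proof. by move=> /(posroots_sub hPhi hPhip)/hl la; rewrite /jump divr_ge0 ?sqr_ge0. Qed.

Let err tau z : R := S (fun x => w x * `|lap_rho z x - discrete_laplacian tau (rho z) x|).

Let rho_shift z (v x : V) : rho z (x + v) = rho (z - v) x.
Proof. by rewrite /rho; congr mollifier; rewrite opprB addrA. Qed.

Let rho_Cb z : Cb (rho z). Proof. exact: Cc_Cb (CK_infty_Cc (rho_CK z)). Qed.

Let disc_cont tau z : continuous (discrete_laplacian tau (rho z)).
Proof.
suff [] : Cb (discrete_laplacian tau (rho z)) by [].
apply: Cb_sum => i; rewrite (_ : second_diff tau i (rho z) = fun x =>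
    (tau ^+ 2)^-1 * (rho (z - tau *: delta_mx 0 i) x + rho (z - - (tau *: delta_mx 0 i)) x
     - 2 * rho z x)).
  by apply: CbZ; apply: CbB; [apply: CbD; exact: rho_Cb|apply: CbZ; exact: rho_Cb].
by apply/funext => x; rewrite /second_diff !rho_shift mulrC.
Qed.

Let m_shift (v : V) z : m (z + v) = D (fun x => w x * rho z (x - v)).
Proof. by congr D; apply/funext => x; rewrite rho_shift opprK. Qed.

(** A shift of the centre is the opposite shift of the argument, and second differences are
    symmetric under that exchange. *)
Let disc_m tau z : 0 < tau -> D (fun x => w x * discrete_laplacian tau (rho z) x) =
  discrete_laplacian tau m z.
Proof.
move=> tau0; have tr (v : V) : Cb (fun x => w x * rho z (x - v)).
  rewrite (_ : (fun x => _) = fun x => w x * rho (z + v) x); first exact: wFc.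
  by apply/funext => x; rewrite rho_shift opprK.
pose H i x := (tau ^+ 2)^-1 * (w x * rho z (x - tau *: delta_mx 0 i) +
  w x * rho z (x - - (tau *: delta_mx 0 i)) - 2 * (w x * rho z x)).
have rhoz : Cb (fun x => w x * rho z x) by exact: wFc.
have HC i : Cb (H i) by apply: CbZ; apply: CbB; [exact: CbD|exact: CbZ].
rewrite (_ : (fun x => _) = fun x => \sum_i H i x); last first.
  apply/funext => x; rewrite /discrete_laplacian mulr_sumr; apply: eq_bigr => i _.
  by rewrite /H /second_diff opprK; move: (w x) (rho z _) (rho z _) (rho z _) => *; ring.
rewrite (Dsum _ HC); apply: eq_bigr => i _.
rewrite /H DZ; last by apply: CbB; [exact: CbD|exact: CbZ].
rewrite DB; [|exact: CbD|exact: CbZ].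
rewrite (DD (tr _) (tr _)) (DZ 2 rhoz).
by rewrite /second_diff (m_shift (tau *: _) z) (m_shift (- _) z) mulrC.
Qed.

(** Kato's inequality for second differences: [Num.sg (m z) * t <= |t|] at the two neighbours, and
    equality at [z] itself, where the coefficient is negative. *)
Let sg_disc tau z : 0 < tau ->
  Num.sg (m z) * discrete_laplacian tau m z <= discrete_laplacian tau (fun y => `|m y|) z.
Proof.
move=> tau0; rewrite mulr_sumr; apply: ler_sum => i _; rewrite /second_diff mulrA.
rewrite ler_wpM2r ?invr_ge0 ?sqr_ge0//.
have s1 (t : R) : Num.sg (m z) * t <= `|t|.
  rewrite (le_trans (ler_norm _))// normrM ler_piMl// normr_sg.
  by case: (m z == 0).
have final (t1 t2 : R) : Num.sg (m z) * (t1 + t2 - 2 * m z) <= `|t1| + `|t2| - 2 * `|m z|.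
  by rewrite mulrBr mulrDr mulrCA -normrEsg lerD2r lerD.
exact: final.
Qed.

(** The equation at [z] times the sign of [m z]. The jump terms obey the same kind of inequality as
    the second differences because the jump rates are nonnegative. *)
Lemma pointwise_inequality tau z (om : R) : 0 < tau -> K z ->
  (forall x, E x -> `|x - z| <= e -> `|pot x - pot z| <= om) ->
  (forall a, a \in P -> forall x, E x -> `|x - z| <= e -> `|jump a x - jump a z| <= om) ->
  lam * `|m z| <= 2^-1 * discrete_laplacian tau (fun y => `|m y|) z + 2^-1 * err tau z
    - pot z * `|m z| + \sum_(a <- P) jump a z * (`|m (reflection a z)| - `|m z|)
    + om * (kap z + \sum_(a <- P) (kap (reflection a z) + kap z)).
Proof.
move=> tau0 Kz hpot hjump; have eq := equation_at Kz hpot hjump.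
set s := Num.sg (m z).
have s1 (t : R) : s * t <= `|t|.
  rewrite (le_trans (ler_norm _))// normrM ler_piMl// normr_sg.
  by case: (m z == 0).
have sm : s * m z = `|m z| by rewrite -normrEsg.
have h1 : s * D (fun x => w x * lap_rho z x) <= s * discrete_laplacian tau m z + err tau z.
  rewrite -disc_m// -lerBlDl -mulrBr -DB; [|exact: wFc|exact/wFc/disc_cont].
  rewrite (le_trans (s1 _))//; apply: D_le.
  - by apply: CbB; [exact: wFc|exact/wFc/disc_cont].
  - apply: wFc => x; apply: (cvg_norm (_ : _ @ x --> lap_rho z x - _)).
    exact: (continuousB (@lap_rho_cont z x) (@disc_cont tau z x)).
  - by move=> x; rewrite -mulrBr normrM (ger0_norm (w_ge0 x)).
have h2 := sg_disc z tau0; rewrite -/s in h2.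
have h3 : s * (\sum_(a <- P) jump a z * (m (reflection a z) - m z)) <=
    \sum_(a <- P) jump a z * (`|m (reflection a z)| - `|m z|).
  rewrite mulr_sumr big_seq [leRHS]big_seq; apply: ler_sum => a aP.
  rewrite mulrCA; apply: (ler_wpM2l (jump_ge0 z aP)).
  by rewrite mulrBr sm lerD2r.
move: h1 h2 h3 eq; move: (s1 (lam * m z - 2^-1 * D (fun x => w x * lap_rho z x) + pot z * m z -
    \sum_(a <- P) jump a z * (m (reflection a z) - m z))) => h0 h1 h2 h3 eq.
have h4 := le_trans h0 eq.
have -> : lam * `|m z| = s * (lam * m z) by rewrite -sm mulrCA.
have -> : pot z * `|m z| = s * (pot z * m z) by rewrite -sm mulrCA.
have final (s' lm LL pm J Dm Da er Ja o : R) : s' * (lm - 2^-1 * LL + pm - J) <= o ->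
    s' * LL <= s' * Dm + er -> s' * Dm <= Da -> s' * J <= Ja ->
    s' * lm <= 2^-1 * Da + 2^-1 * er - s' * pm + Ja + o.
  rewrite !(mulrBr, mulrDr) => *; lra.
exact: final h4 h1 h2 h3.
Qed.

(** The sum moves inside the functional, where for fixed [x] it runs over the centres; [T] is the
    mass of [w]. *)
Let slsum_le M tau (h : V -> R) (H : V -> V -> R) (C : R) :
  (forall z, continuous (H z)) ->
  (forall x, w x != 0 -> lsum M tau (fun z => h z * H z x) <= C) ->
  lsum M tau (fun z => h z * S (fun x => w x * H z x)) <= C * T.
Proof.
move=> Hc HC; have HCb z : Cb (fun x => w x * H z x) by exact: wFc.
rewrite (_ : lsum _ _ _ = S (fun x => \sum_(z' : {ffun 'I_n -> 'I_(M.*2.+1)}) h (pt tau z') * (w x * H (pt tau z') x))); last first.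
  rewrite Ssum; last by move=> z; exact: CbZ.
  by apply: eq_bigr => z _; rewrite SZ.
rewrite -SZ//; apply: S_le.
- by apply: Cb_sum => z; exact: CbZ.
- exact: CbZ.
move=> x; rewrite (_ : \sum_(z' : {ffun 'I_n -> 'I_(M.*2.+1)}) _ = w x * lsum M tau (fun z => h z * H z x)); last first.
  by rewrite mulr_sumr; apply: eq_bigr => z _; rewrite mulrCA.
have [->|wx] := eqVneq (w x) 0; first by rewrite mul0r mulr0.
by rewrite mulrC ler_wpM2r// HC.
Qed.

Variables (G PP : V -> R) (BG om : R).
Hypothesis GC : CK_infty E G.
Hypothesis G_ge0 : forall z, 0 <= G z.
Hypothesis G_le : forall z, G z <= BG.
Hypothesis G_K : forall z, G z != 0 -> K z.
Hypothesis G_reflection : forall a z, Phi a -> G (reflection a z) = G z.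
Hypothesis PPC : Cc E PP.
Hypothesis PP_ge0 : forall z, 0 <= PP z.
Hypothesis G_PP : forall z, 2^-1 * laplacian G z - pot z * G z <= PP z.
Hypothesis om_gt0 : 0 < om.
Hypothesis pot_osc : forall z x, K z -> `|x - z| <= e -> `|pot x - pot z| <= om.
Hypothesis jump_osc : forall a z x, a \in P -> K z -> `|x - z| <= e ->
  `|jump a x - jump a z| <= om.
Hypothesis PP_osc : forall x z, `|x - z| <= e -> PP z <= PP x + om.

Let Gm a y : R := G y * jump a y * `|m y|.

Let Gm_Cc a : a \in P -> Cc setT (Gm a).
Proof.
move=> aP; rewrite (_ : Gm a = fun y => `|m y| * (jump a y * G y)); last first.
  by apply/funext => y; rewrite /Gm; ring.
apply: CcM; first exact: openT.
  have [h1 [C [cC CE C0]]] := CcM oE (CK_infty_Cc GC) (fun y Ey => jump_cont aP Ey).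
  by split=> //; exists C; split.
by move=> y _; exact: (cvg_norm (@m_continuous y)).
Qed.

Let lap_rhoE z x : lap_rho z x = laplacian (mollifier e) (x - z).
Proof.
have tr (f : V -> R) i : partial i (fun x => f (x - z)) = fun x => partial i f (x - z).
  apply/funext => y; rewrite /partial /derive.
  set g1 := fun h => h^-1 *: _; set g2 := fun h => h^-1 *: _.
  suff -> : g1 = g2 by [].
  by apply/funext => h; rewrite /g1 /g2/= addrA.
by apply: eq_bigr => i _; rewrite (tr (mollifier e)) (tr (partial i (mollifier e))).
Qed.

Let disc_rhoE tau z x :
  discrete_laplacian tau (rho z) x = discrete_laplacian tau (mollifier e) (x - z).
Proof.
apply: eq_bigr => i _; rewrite /second_diff /rho.
by rewrite (addrAC x (tau *: _)) (addrAC x (- (tau *: _))).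
Qed.

(** An exact identity: lattice sums are invariant under a shift by one mesh, and [G] vanishes near
    the boundary of the cube. *)
Let summation_by_parts M tau SG f : 0 < tau -> tau <= 1 ->
  (forall y : V, SG < `|y| -> G y = 0) ->
  (forall F v, (forall y : V, SG + 1 < `|y| -> F y = 0) -> `|@lvec R n tau v| <= 1 ->
    lsum M tau (fun y => F (y + lvec tau v)) = lsum M tau F) ->
  lsum M tau (fun z => G z * discrete_laplacian tau f z) =
  lsum M tau (fun z => discrete_laplacian tau G z * f z).
Proof.
move=> tau0 tau1 GS shift.
rewrite (_ : (fun z => G z * _) = fun z => \sum_i G z * second_diff tau i f z); last first.
  by apply/funext => z; rewrite mulr_sumr.
rewrite (_ : (fun z => _ * f z) = fun z => \sum_i second_diff tau i G z * f z); last first.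
  by apply/funext => z; rewrite mulr_suml.
rewrite !lsum_sum; apply: eq_bigr => i _.
have en (b : bool) : `|(-1) ^+ b * tau *: (delta_mx 0 i : V)| <= 1.
  rewrite normrZ normrM normrX normrN1 expr1n mul1r (gtr0_norm tau0) -[leRHS]mulr1.
  rewrite ler_pM ?(ltW tau0)// rV_norm_le//; apply/forallP => j; rewrite mxE eqxx/=.
  by case: eqP; rewrite ?normr1 ?normr0.
have tr (b : bool) (g : V -> R) :
    lsum M tau (fun z => G z * g (z + (-1) ^+ b * tau *: delta_mx 0 i)) =
    lsum M tau (fun z => G (z - (-1) ^+ b * tau *: delta_mx 0 i) * g z).
  set v := (-1) ^+ b * tau *: (delta_mx 0 i : V).
  pose vi (j : 'I_n) : int := if j == i then (if b then -1 else 1) else 0.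
  have vE : v = lvec tau vi.
    apply/rowP => j; rewrite !mxE eqxx/= /vi; case: (j == i); last by rewrite mulr0z !mulr0.
    by rewrite mulr1n; case: (b); rewrite ?expr1 ?expr0 ?mulrN1z ?mulr1z; ring.
  have h := shift (fun z => G (z - v) * g z) vi.
  rewrite -[RHS]h; last first.
  - by rewrite -vE; exact: en.
  - move=> y hy; rewrite GS ?mul0r//.
    have := ler_normB (y - v) (- v); rewrite opprK subrK normrN => h2.
    have := en b; rewrite -/v => h3; lra.
  by apply: eq_lsum => z; rewrite -vE addrK.
have tr0 := tr false f; have tr1 := tr true f.
rewrite expr0 mul1r in tr0; rewrite expr1 mulN1r scaleNr opprK in tr1.
rewrite (_ : (fun z => G z * second_diff tau i f z) = fun z => (tau ^+ 2)^-1 *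
  (G z * f (z + tau *: delta_mx 0 i) + G z * f (z - tau *: delta_mx 0 i) - 2 * (G z * f z))); last first.
  apply/funext => z; rewrite /second_diff.
  by move: (G z) (f (z + _)) (f (z - _)) (f z) => *; ring.
rewrite (_ : (fun z => second_diff tau i G z * f z) = fun z => (tau ^+ 2)^-1 *
  (G (z + tau *: delta_mx 0 i) * f z + G (z - tau *: delta_mx 0 i) * f z - 2 * (G z * f z))); last first.
  apply/funext => z; rewrite /second_diff.
  by move: (f z) (G (z + _)) (G (z - _)) (G z) => *; ring.
by rewrite !lsumZ !lsumB !lsumD tr0 tr1 [X in X - _]addrC.
Qed.

(** The errors per unit of mass and of [om]: [4 * T] from evaluating [PP] away from the centre and
    from the second differences of [G], [BG * T] from those of the mollifier, the next term from
    freezing the coefficients, [size P] from the approximate invariance under reflections. *)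
Let C1 : R := 4 * T + BG * T + 2 * BG * T * (1 + 2 * (size P)%:R) + (size P)%:R.

Let PPc : continuous PP. Proof. by case: PPC. Qed.

Let PPom_Cb : Cb (fun x => PP x + om).
Proof. by apply: CbD; [exact: Cc_Cb PPC|exact: Cb_cst]. Qed.

Let PPom_cont : continuous (fun x => PP x + om). Proof. by case: PPom_Cb. Qed.

Let Cb_cont F : Cb F -> continuous F. Proof. by case. Qed.

Let BG_ge0 : 0 <= BG. Proof. exact: le_trans (G_ge0 0) (G_le 0). Qed.

Let fine_mesh_all (s : seq V) (Q : V -> nat -> R -> Prop) :
  (forall a, a \in s -> fine_mesh (Q a)) ->
  fine_mesh (fun M tau => forall a, a \in s -> Q a M tau).
Proof.
elim: s => [|a s ih] h; first by exists 1, 0; split.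
have h1 := h a (mem_head _ _).
have h2 := ih (fun b bs => h b (mem_behead (s := a :: s) bs)).
apply: fine_meshS (fine_meshI h1 h2) => M tau _ [q1 q2] b.
by rewrite inE => /orP[/eqP ->//|]; exact: q2.
Qed.

(** [G] will be [exp(logw)] times the cutoff; then the left side of [G_PP] is [exp(logw)] times the
    generator on the cutoff, and [PP] its absolute value. The common factor on the right is the
    lattice mass of the mollifier. *)
Lemma kato_inequality : fine_mesh (fun M tau =>
  lam * lsum M tau (fun z => G z * `|m z|) <=
  lsum M tau (@mollifier R n e) * (2 * S (fun x => w x * PP x) + om * C1)).
Proof.
have [X [X0 wX wXr]] : exists X, [/\ 0 <= X, forall x, w x != 0 -> `|x| <= X &
    forall a x, a \in P -> w x != 0 -> `|reflection a x| <= X].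
  have [_ [Cw [cC _ C0]]] := wC; have [M0 [_ M0C]] := compact_bounded cC.
  pose X0 := `|M0| + 1; have X00 : 0 <= X0 by rewrite addr_ge0.
  have N0 : 0 <= n%:R :> R by exact: ler0n.
  have wX0 x : w x != 0 -> `|x| <= X0.
    move=> wx; apply: M0C; first by rewrite (le_lt_trans (ler_norm _))// ltrDl.
    by apply: contrapT => /C0 /eqP; rewrite (negbTE wx).
  exists ((n%:R + 1) * X0); split; first by rewrite mulr_ge0// addr_ge0.
    move=> x /wX0 h; nra.
  move=> a x /(posroots_sub hPhi hPhip)/(root_norm hPhi) a2 /wX0 h.
  by rewrite (le_trans (norm_reflection_le x a2))// ler_wpM2l// addr_ge0.
have H1 := lsum_mollifier_translate (n := n) e_gt0 X0 ltr01.
have [Db Db0 H2] := lsum_ind_le_mollifier (n := n) (2 * e) e_gt0 X0.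
have eta0 : 0 < om / Db by rewrite divr_gt0.
have rho0_CK : CK_infty setT (@mollifier R n e).
  rewrite (_ : @mollifier R n e = rho 0); first exact: rho_CK.
  by apply/funext => x; rewrite /rho subr0.
have [t1 t10 H3] := discrete_laplacian_cvg rho0_CK eta0.
have [t2 t20 H4] := discrete_laplacian_cvg GC om_gt0.
have [SG GS] : exists SG : R, forall y : V, SG < `|y| -> G y = 0.
  have [_ [Cw [cC _ C0]]] := CK_infty_Cc GC; have [M0 [_ M0C]] := compact_bounded cC.
  exists (`|M0| + 1) => y yM; apply: C0 => Cy; move: yM; rewrite ltNge => /negP; apply.
  by apply: M0C => //; rewrite (le_lt_trans (ler_norm _))// ltrDl.
have H5 := lsum_shift_fine (n := n) (SG + 1) 1.
have H6 : fine_mesh (fun M tau => forall a, a \in P ->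
    `|lsum M tau (Gm a) - lsum M tau (fun y => Gm a (reflection a y))| <=
    om * lsum M tau (@mollifier R n e)).
  apply: (@fine_mesh_all P (fun a M tau =>
    `|lsum M tau (Gm a) - lsum M tau (fun y => Gm a (reflection a y))| <=
    om * lsum M tau (@mollifier R n e))) => a aP; apply: lsum_reflection => //; last exact: Gm_Cc.
  exact: root_norm hPhi _ (posroots_sub hPhi hPhip aP).
pose t := Num.min (Num.min t1 t2) (Num.min e 1).
have t0 : 0 < t by rewrite !lt_min t10 t20 e_gt0/=.
have H7 := fine_mesh_mesh 0 t0.
apply: fine_meshS (fine_meshI H1 (fine_meshI H2 (fine_meshI H5 (fine_meshI H6 H7)))).
move=> M tau tau0 [h1 [h2 [h5 [h6 [+ _]]]]].
rewrite !lt_min => /andP[/andP[taut1 taut2] /andP[taue tau1]].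
set c := lsum M tau (@mollifier R n e) in h1 h2 h6 *.
(* Relative error 1 for the mass of a translated mollifier: the source of the factor 2 in the
   conclusion. *)
have {}h1 x : `|x| <= X -> lsum M tau (fun y => mollifier e (x - y)) <= 2 * c.
  by move=> /h1; rewrite mul1r ler_norml => /andP[_]; lra.
have c0 : 0 < c by exact: mollifier0_gt0.
have hosc z : K z -> (forall x, E x -> `|x - z| <= e -> `|pot x - pot z| <= om) /\
  (forall a, a \in P -> forall x, E x -> `|x - z| <= e -> `|jump a x - jump a z| <= om).
  by move=> Kz; split=> [x _|a aP x _]; [exact: pot_osc|exact: jump_osc].
have kapB (h : V -> R) B : (forall z, 0 <= h z) -> (forall z, h z <= B) ->
    lsum M tau (fun z => h z * kap z) <= B * 2 * c * T.
  move=> h0 hB; apply: slsum_le; first exact: rho_cont.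
  move=> x wx; apply: (@le_trans _ _ (lsum M tau (fun z => B * mollifier e (x - z)))).
    by apply: ler_lsum => z; rewrite ler_wpM2r ?mollifier_ge0.
  rewrite lsumZ -mulrA ler_wpM2l ?(le_trans (h0 0) (hB 0))// h1//; exact: wX.
have kaprB a : a \in P -> lsum M tau (fun z => G z * kap (reflection a z)) <= BG * 2 * c * T.
  move=> aP; have a2 := root_norm hPhi (posroots_sub hPhi hPhip aP).
  apply: slsum_le => [z|x wx]; first exact: rho_cont.
  apply: (@le_trans _ _ (lsum M tau (fun z => BG * mollifier e (reflection a x - z)))).
    apply: ler_lsum => z; rewrite /rho -(mollifier_reflection _ _ _ a2).
    by rewrite ler_wpM2r ?mollifier_ge0.
  by rewrite lsumZ -mulrA ler_wpM2l ?BG_ge0// h1//; exact: wXr.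
have errB : lsum M tau (fun z => G z * err tau z) <= BG * om * c * T.
  apply: slsum_le => [z x|x wx].
    apply: (cvg_norm (_ : _ @ x --> lap_rho z x - _)).
    exact: (continuousB (@lap_rho_cont z x) (@disc_cont tau z x)).
  apply: (@le_trans _ _ (lsum M tau (fun z => BG * (om / Db) * ind (2 * e) (x - z)))).
    apply: ler_lsum => z; rewrite lap_rhoE disc_rhoE -mulrA.
    apply: ler_pM => //; rewrite /ind; case: ifPn => xz.
      by rewrite mulr1 distrC; exact: H3.
    rewrite -ltNge in xz; rewrite -lap_rhoE -disc_rhoE lap_rho_out; last by lra.
    rewrite /discrete_laplacian big1 ?subrr ?normr0 ?mulr0// => i _.
    have en : `|tau *: (delta_mx 0 i : V)| <= e.
      rewrite normrZ (gtr0_norm tau0) (le_trans _ (ltW taue))// ler_piMr ?(ltW tau0)//.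
      rewrite rV_norm_le//; apply/forallP => j; rewrite mxE eqxx/=.
      by case: eqP; rewrite ?normr1 ?normr0.
    have xm : e < `|x - tau *: delta_mx 0 i - z|.
      have := ler_normB (x - tau *: delta_mx 0 i - z) (- (tau *: delta_mx 0 i)).
      rewrite opprK (_ : x - tau *: delta_mx 0 i - z + tau *: delta_mx 0 i = x - z) ?normrN; last first.
        by rewrite addrAC subrK.
      move: en xz; lra.
    have xp : e < `|x + tau *: delta_mx 0 i - z|.
      have := ler_normB (x + tau *: delta_mx 0 i - z) (tau *: delta_mx 0 i).
      rewrite (_ : x + tau *: delta_mx 0 i - z - tau *: delta_mx 0 i = x - z); last first.
        by rewrite addrAC addrK.
      move: en xz; lra.
    have x0 : e < `|x - z| by lra.
    by rewrite /second_diff (rho_out xp) (rho_out xm) (rho_out x0) mulr0 addr0 subrr mul0r.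
  rewrite lsumZ (le_trans (ler_wpM2l _ (h2 x (wX x wx))))//.
    by rewrite mulr_ge0 ?BG_ge0// ltW.
  by rewrite -/c le_eqVlt; apply/orP; left; apply/eqP; field; rewrite gt_eqF.
(* On the support of the mollifier [PP z] exceeds [PP x] by at most [om], so the majorant is
   evaluated at [x] and leaves the lattice sum. *)
have PPB : lsum M tau (fun z => PP z * kap z) <= 2 * c * S (fun x => w x * (PP x + om)).
  rewrite (_ : 2 * c * _ = S (fun x => w x * (2 * c * (PP x + om)))); last first.
    rewrite -SZ; last by apply: wFc; exact: PPom_cont.
    by congr S; apply/funext => x; rewrite mulrCA.
  rewrite (_ : lsum _ _ _ = S (fun x => \sum_(z' : {ffun 'I_n -> 'I_(M.*2.+1)})
      PP (pt tau z') * (w x * rho (pt tau z') x))); last first.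
    rewrite Ssum; last by move=> z; apply: CbZ; exact: wFc.
    by apply: eq_bigr => z _; rewrite SZ//; exact: wFc.
  apply: S_le.
  - by apply: Cb_sum => z; apply: CbZ; exact: wFc.
  - by apply: wFc; apply: Cb_cont; apply: CbZ; exact: PPom_Cb.
  move=> x; rewrite (_ : \sum_(z' : {ffun 'I_n -> 'I_(M.*2.+1)}) _ =
      w x * lsum M tau (fun z => PP z * rho z x)); last first.
    by rewrite mulr_sumr; apply: eq_bigr => z _; rewrite mulrCA.
  have [->|wx] := eqVneq (w x) 0; first by rewrite !mul0r.
  rewrite ler_wpM2l//.
  apply: (@le_trans _ _ (lsum M tau (fun z => (PP x + om) * mollifier e (x - z)))).
    apply: ler_lsum => z; have [xz|] := leP `|x - z| e.
      by rewrite ler_wpM2r ?mollifier_ge0//; exact: PP_osc.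
    by move=> /(mollifier_out e_gt0) h; rewrite /rho h !mulr0.
  rewrite lsumZ mulrC ler_wpM2r ?addr_ge0 ?(ltW om_gt0)//; apply: h1; exact: wX.
have PPS : S (fun x => w x * (PP x + om)) = S (fun x => w x * PP x) + om * T.
  rewrite (_ : (fun x => w x * (PP x + om)) = fun x => w x * PP x + om * w x); last first.
    by apply/funext => x; rewrite mulrDr (mulrC om).
  have CP : Cb (fun x => w x * PP x) by exact: wFc PPc.
  have Cw : Cb (fun x => om * w x) by exact: CbZ.
  by rewrite -SZ// /S (pfD ht1)// (pfD ht2)//; ring.
have sbp := summation_by_parts (fun y => `|m y|) tau0 (ltW tau1) GS h5.
have main : lam * lsum M tau (fun z => G z * `|m z|) <=
    2^-1 * lsum M tau (fun z => G z * discrete_laplacian tau (fun y => `|m y|) z)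
    + 2^-1 * lsum M tau (fun z => G z * err tau z)
    - lsum M tau (fun z => G z * (pot z * `|m z|))
    + \sum_(a <- P) lsum M tau (fun z => G z * (jump a z * (`|m (reflection a z)| - `|m z|)))
    + om * (lsum M tau (fun z => G z * kap z) +
        \sum_(a <- P) (lsum M tau (fun z => G z * kap (reflection a z)) + lsum M tau (fun z => G z * kap z))).
  rewrite -!lsumZ -lsumD -lsumB -lsum_sum -lsumD.
  rewrite (eq_bigr (fun a => lsum M tau (fun z => G z * kap (reflection a z) + G z * kap z))); last first.
    by move=> a _; rewrite lsumD.
  rewrite -lsum_sum -lsumD -lsumZ -lsumD.
  apply: ler_lsum => z; have [->|Gz] := eqVneq (G z) 0.
    rewrite !mul0r !mulr0 !big1 => [|a _|a _]; rewrite ?mul0r ?addr0//.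
    by rewrite subr0 mulr0 !addr0.
  have Kz := G_K Gz; have [po1 po2] := hosc z Kz.
  have pw := ler_wpM2l (G_ge0 z) (pointwise_inequality tau0 Kz po1 po2).
  have e1 : \sum_(a <- P) G z * (jump a z * (`|m (reflection a z)| - `|m z|)) =
      G z * \sum_(a <- P) jump a z * (`|m (reflection a z)| - `|m z|) by rewrite mulr_sumr.
  have e2 : \sum_(a <- P) (G z * kap (reflection a z) + G z * kap z) =
      G z * \sum_(a <- P) (kap (reflection a z) + kap z).
    by rewrite [RHS]mulr_sumr; apply: eq_bigr => a _; rewrite -mulrDr.
  rewrite e1 e2 mulrCA; apply: (le_trans pw); rewrite le_eqVlt; apply/orP; left; apply/eqP.
  move: (discrete_laplacian _ _ _) (err _ _) (\sum_(a <- P) _) (\sum_(a <- P) _).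
  move: (G z) (pot z) `|m z| (kap z) => *; ring.
(* [G] and the jump rate of [a] are invariant under the reflection in [a], so the summand is [Gm a]
   at the reflected point minus [Gm a]. *)
have jumps : \sum_(a <- P) lsum M tau (fun z => G z * (jump a z * (`|m (reflection a z)| - `|m z|)))
    <= (size P)%:R * (om * c).
  rewrite -sum1_size natr_sum mulr_suml big_seq [leRHS]big_seq.
  apply: ler_sum => a aP; rewrite mul1r; have Pa := posroots_sub hPhi hPhip aP.
  rewrite (_ : (fun z => _) = fun z => Gm a (reflection a z) - Gm a z); last first.
    apply/funext => z; rewrite /Gm (G_reflection _ Pa) (jump_reflection _ Pa); ring.
  rewrite lsumB; apply: le_trans (h6 a aP); rewrite distrC; exact: ler_norm.
(* The second differences now fall on [G]. The coefficient of [|m z|] is at most [PP z + om], which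
   is nonnegative, so [|m z|] may then be enlarged to [kap z]. *)
have diff : 2^-1 * lsum M tau (fun z => G z * discrete_laplacian tau (fun y => `|m y|) z)
    - lsum M tau (fun z => G z * (pot z * `|m z|)) <=
    lsum M tau (fun z => PP z * kap z) + lsum M tau (fun z => om * kap z).
  rewrite sbp -lsumZ -lsumB -lsumD; apply: ler_lsum => z.
  have h := H4 tau tau0 taut2 z; have hm := m_le_kap z; have m0 := normr_ge0 (m z).
  have hG := G_PP z; have hP := PP_ge0 z.
  move: h hm m0 hG hP (kap_ge0 z) om_gt0; rewrite ler_norml => /andP[_].
  move: (discrete_laplacian tau G z) (laplacian G z) `|m z| (kap z) (pot z) (G z) (PP z) => A1 A2 A3 A4 A5 A6 A7.
  move=> i1 i2 i3 i4 i5 i6 i7.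
  have -> : 2^-1 * (A1 * A3) - A6 * (A5 * A3) = (2^-1 * A1 - A5 * A6) * A3 by ring.
  have j1 : 2^-1 * A1 - A5 * A6 <= A7 + om by lra.
  have j2 : 0 <= A7 + om by lra.
  by rewrite -mulrDl (le_trans (ler_wpM2r i3 j1))// ler_wpM2l.
have kap1 := kapB (cst om) om (fun _ => ltW om_gt0) (fun _ => lexx _).
have kapG := kapB G BG G_ge0 G_le.
have kaps : \sum_(a <- P) (lsum M tau (fun z => G z * kap (reflection a z)) + lsum M tau (fun z => G z * kap z))
   <= (size P)%:R * (2 * (BG * 2 * c * T)).
  rewrite -sum1_size natr_sum mulr_suml big_seq [leRHS]big_seq.
  apply: ler_sum => a aP; rewrite mul1r (mulr_natl (BG * 2 * c * T) 2) mulr2n.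
  exact: lerD (kaprB a aP) kapG.
move: main jumps diff PPB PPS kap1 kapG kaps errB; rewrite /C1 /cst.
set X1 := lsum _ _ _; set X2 := lsum _ _ _; set X3 := lsum _ _ _; set X4 := lsum _ _ _.
set X5 := \sum_(a <- P) _; set X6 := lsum _ _ _; set X7 := \sum_(a <- P) _.
set X8 := lsum _ _ _; set X9 := lsum _ _ _; set Y1 := S _; set Y2 := S _.
move: (size P)%:R => r main jumps diff PPB PPS kap1 kapG kaps errB.
have q1 := ler_wpM2l (ltW om_gt0) kapG; have q2 := ler_wpM2l (ltW om_gt0) kaps.
rewrite PPS in PPB.
have q3 : 0 <= BG * om * c * T by rewrite !mulr_ge0 ?BG_ge0 ?T_ge0// ltW.
have : lam * X1 <= 2 * c * (Y2 + om * T) + om * 2 * c * T + 2^-1 * (BG * om * c * T)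
   + r * (om * c) + om * (BG * 2 * c * T) + om * (r * (2 * (BG * 2 * c * T))) by lra.
move=> h; apply: (le_trans h); rewrite -subr_ge0.
have final (y t' b o c' r' : R) : c' * (2 * y + o * (4 * t' + b * t' + 2 * b * t' * (1 + 2 * r') + r')) -
  (2 * c' * (y + o * t') + o * 2 * c' * t' + 2^-1 * (b * o * c' * t') +
   r' * (o * c') + o * (b * 2 * c' * t') + o * (r' * (2 * (b * 2 * c' * t')))) =
   2^-1 * (b * o * c' * t') by field.
by rewrite final mulr_ge0// invr_ge0.
Qed.

(** From [m] back to the difference: the superposition of mollifiers with coefficients [hu] is close
    to [c * hu], where [c] is the lattice mass. In [2 + U] the 2 comes from the oscillation of [hu],
    the [U] from the error in the mass. One fine mesh is enough, since [c] cancels. *)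
Lemma kato_conclusion hu (A U mass : R) : Cc E hu -> 0 <= A -> (forall x, `|hu x| <= A * G x) ->
  (forall x, `|hu x| <= U) -> (forall x z, `|x - z| <= e -> `|hu z - hu x| <= om) ->
  mass = theta1 (fun x => expR (- logw x) * chi x) + theta2 (fun x => expR (- logw x) * chi x) ->
  lam * `|theta1 (fun x => expR (- logw x) * chi x * hu x)
        - theta2 (fun x => expR (- logw x) * chi x * hu x)| <=
  A * (2 * (theta1 (fun x => expR (- logw x) * chi x * PP x) +
            theta2 (fun x => expR (- logw x) * chi x * PP x))
       + om * (4 * mass + BG * mass + 2 * BG * mass * (1 + 2 * (size P)%:R) + (size P)%:R))
  + lam * (om * (2 + U) * mass).
Proof.
move=> huC A0 huG huU hu_osc massE.
have [X [X0 wX]] : exists X, 0 <= X /\ forall x, w x != 0 -> `|x| <= X.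
  have [_ [Cw [cC _ C0]]] := wC; have [M0 [_ M0C]] := compact_bounded cC.
  exists (`|M0| + 1); split=> [|x wx]; first by rewrite addr_ge0.
  apply: M0C; first by rewrite (le_lt_trans (ler_norm _))// ltrDl.
  by apply: contrapT => /C0 /eqP; rewrite (negbTE wx).
have H1 := lsum_mollifier_translate (n := n) e_gt0 X0 ltr01.
have H2 := lsum_mollifier_translate (n := n) e_gt0 X0 om_gt0.
have [M [tau [tau0 [h1 [h2 hK]]]]] := fine_mesh_ex (fine_meshI H1 (fine_meshI H2 kato_inequality)).
set c := lsum M tau (@mollifier R n e) in h1 h2 hK.
have c0 : 0 < c by exact: mollifier0_gt0.
have huc : continuous hu by case: huC.
pose Q x := lsum M tau (fun z => hu z * rho z x).
have QC : Cb (fun x => w x * Q x).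
  apply: wFc; apply: Cb_cont; apply: Cb_sum => z; apply: CbZ; exact: rho_Cb.
have QE : D (fun x => w x * Q x) = lsum M tau (fun z => hu z * m z).
  rewrite (_ : (fun x => w x * Q x) = fun x => \sum_(z' : {ffun 'I_n -> 'I_(M.*2.+1)})
      hu (pt tau z') * (w x * rho (pt tau z') x)); last first.
    by apply/funext => x; rewrite mulr_sumr; apply: eq_bigr => z _; rewrite mulrCA.
  rewrite Dsum; last by move=> z; apply: CbZ; exact: wFc.
  by apply: eq_bigr => z _; rewrite DZ//; exact: wFc.
have cw : Cb (fun x => c * (w x * hu x)) by apply: CbZ; exact: wFc.
have close : `|c * D (fun x => w x * hu x) - lsum M tau (fun z => hu z * m z)| <=
    c * om * (2 + U) * T.
  rewrite -QE -DZ; last exact: wFc.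
  rewrite -DB// -SZ//; apply: D_le; [exact: CbB|exact: CbZ|] => x.
  rewrite (_ : _ - _ = w x * (c * hu x - Q x)); last by rewrite mulrBr (mulrCA c).
  rewrite normrM (ger0_norm (w_ge0 x)) [leRHS]mulrC.
  have [->|wx] := eqVneq (w x) 0; first by rewrite !mul0r.
  rewrite ler_wpM2l//.
  have b1 : `|Q x - hu x * lsum M tau (fun z => rho z x)| <= om * (2 * c).
    rewrite -lsumZ -lsumB (le_trans (ler_norm_lsum _ _ _))//.
    apply: (@le_trans _ _ (lsum M tau (fun z => om * mollifier e (x - z)))).
      apply: ler_lsum => z; rewrite -mulrBl normrM (ger0_norm (mollifier_ge0 _ _)).
      have [xz|] := leP `|x - z| e; first by rewrite ler_wpM2r ?mollifier_ge0//; exact: hu_osc.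
      by move=> /(mollifier_out e_gt0) ->; rewrite !mulr0.
    rewrite lsumZ ler_wpM2l ?(ltW om_gt0)//.
    by have := h1 x (wX x wx); rewrite mul1r ler_norml => /andP[_]; move: (lsum _ _ _) => *; lra.
  have b2 := h2 x (wX x wx); have hU := huU x; move: b1 b2.
  rewrite -/(rho _ _); set q := lsum M tau (fun z => rho z x); rewrite -/q.
  move: (Q x) q c0 hU om_gt0 => q1 q2 c0 hU o0 b1 b2.
  rewrite (_ : c * hu x - q1 = - (q1 - hu x * q2) - hu x * (q2 - c)); last by ring.
  rewrite (le_trans (ler_normB _ _))// normrN normrM.
  have b3 : `|hu x| * `|q2 - c| <= U * (om * c) by rewrite ler_pM.
  rewrite (_ : c * om * (2 + U) = om * (2 * c) + U * (om * c)); last by ring.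
  exact: lerD.
have hG : `|lsum M tau (fun z => hu z * m z)| <= A * lsum M tau (fun z => G z * `|m z|).
  rewrite (le_trans (ler_norm_lsum _ _ _))// -lsumZ; apply: ler_lsum => z.
  by rewrite normrM mulrA ler_wpM2r.
rewrite -[leLHS]/(lam * `|D (fun x => w x * hu x)|).
rewrite -[X in 2 * X]/(S (fun x => w x * PP x)) massE -/(S w) -/T -/C1.
have final (d q g c' SP CC E' lm A' : R) : 0 < c' -> 0 <= A' -> 0 < lm ->
    `|c' * d - q| <= c' * E' -> `|q| <= A' * g -> lm * g <= c' * (SP + CC) ->
    lm * `|d| <= A' * (SP + CC) + lm * E'.
  move=> c'0 A'0 lm0 i1 i2 i3; rewrite -(ler_pM2l c'0) mulrCA.
  have -> : c' * `|d| = `|c' * d| by rewrite normrM gtr0_norm.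
  have i4 : `|c' * d| <= A' * g + c' * E'.
    have := ler_normD (c' * d - q) q; rewrite subrK => i5; lra.
  have i5 := ler_wpM2l (ltW lm0) i4; have i6 := ler_wpM2l A'0 i3.
  apply: (le_trans i5); rewrite !mulrDr (mulrCA lm A') (mulrCA lm c') (mulrCA c' A') (mulrCA c' lm).
  rewrite lerD2r; apply: (le_trans i6); rewrite le_eqVlt; apply/orP; left; apply/eqP; ring.
apply: final c0 A0 lam_gt0 _ hG hK.
by move: close; rewrite (_ : c * om * (2 + U) * T = c * (om * (2 + U) * T))// !mulrA.
Qed.

End Kato.

(** * Choice of the constants and growth of the cutoff *)

Section KatoUniqueness.
Context {R : realType} {n : nat} (Phi Phip : set 'rV[R]_n).
Hypothesis hPhi : root_system Phi.
Hypothesis hPhip : positive_subsystem Phi Phip.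
Local Notation V := 'rV[R]_n.
Local Notation E := (regular_set Phi).
Local Notation P := (posroots Phip).
Implicit Types (x y z a b : V) (i : 'I_n) (N : R).
Variables k l : V -> R.
Hypothesis hk : forall a, Phi a -> 2^-1 <= k a.
Hypothesis hkW : weyl_invariant Phi k.
Hypothesis hl : forall a, Phi a -> 0 <= l a.
Local Notation logw := (logw Phip k).
Local Notation pot := (potential Phip k).
Local Notation L := (dunkl_laplacian Phip k l).
Local Notation cutoff := (cutoff Phi Phip k).

Let oE : open E := open_regular_set hPhi.

Lemma partials_near i u v x : (\near x, u x = v x) ->
  partial i (partial i u) x = partial i (partial i v) x.
Proof.
move=> uv; apply: partial_near.
by apply: filterS (near_join uv) => y; exact: partial_near.
Qed.

Lemma laplacian_near (u v : V -> R) x : (\near x, u x = v x) ->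
  laplacian u x = laplacian v x.
Proof. by move=> uv; apply: eq_bigr => i _; exact: partials_near. Qed.

Lemma diffusion_part_near (u v : V -> R) x : (\near x, u x = v x) ->
  diffusion_part Phip k u x = diffusion_part Phip k v x.
Proof.
move=> uv; rewrite /diffusion_part (laplacian_near uv).
suff -> : gradient u x = gradient v x by [].
by apply/rowP => i; rewrite !mxE; exact: partial_near.
Qed.

Let Ew : elementary E (fun x => expR (logw x)).
Proof. exact: elementary_expR (elementary_logw hPhi hPhip k). Qed.

Lemma weighted_cutoff_CK_infty N : 0 < N ->
  CK_infty E (fun x => expR (logw x) * cutoff N x).
Proof.
move=> N0; have [_ [K [cK KE K0]]] := CK_infty_Cc (cutoff_CK_infty hPhi hPhip hk N0).
apply: (@elementary_CK_infty _ _ E _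
  (fun x => expR (logw x) * flat 0 (cutoff_arg Phip k N x)) K) => //.
- apply: elementary_mul => //; apply: elementary_flat; exact: elementary_cutoff_arg.
- by move=> x Ex; rewrite cutoff_in.
- by move=> x /K0 ->; rewrite mulr0.
Qed.

(** The conjugation identity read backwards; the jumps give nothing, as the cutoff is invariant. *)
Lemma weighted_cutoff_potential N x : 0 < N ->
  2^-1 * laplacian (fun x => expR (logw x) * cutoff N x) x
  - pot x * (expR (logw x) * cutoff N x) = expR (logw x) * L (cutoff N) x.
Proof.
move=> N0; have CK := cutoff_CK_infty hPhi hPhip hk N0.
have [Ex|nEx] := pselect (E x); last first.
  rewrite (dunkl_laplacian_out hPhi hPhip k l CK nEx).
  have CG := weighted_cutoff_CK_infty N0.
  have [_ [K [_ KE K0]]] := CK_infty_Cc CK.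
  rewrite K0 ?mulr0 ?subr0; last by move=> /KE.
  have [_ [K' [_ K'E K'0]]] : Cc E (laplacian (fun x => expR (logw x) * cutoff N x)).
    by apply: Cc_sum => i; apply: CK_infty_Cc; do 2!apply: CK_infty_partial.
  by rewrite K'0 ?mulr0// => /K'E.
have -> : L (cutoff N) x = diffusion_part Phip k (cutoff N) x.
  rewrite (dunkl_laplacianE hPhi hPhip) [X in _ + X = _]big1_seq ?addr0// => a.
  by move=> /(posroots_sub hPhi hPhip) Pa; rewrite cutoff_reflection// subrr mul0r mulr0.
pose F y := expR (logw y) * flat 0 (cutoff_arg Phip k N y).
have eF : elementary E F.
  apply: elementary_mul => //; apply: elementary_flat; exact: elementary_cutoff_arg.
rewrite (@diffusion_part_near _ (fun y => F y * expR (- logw y))); last first.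
  apply: (near_regular hPhi) => // y Ey.
  by rewrite /F cutoff_in// mulrC mulrA -expRD addNr expR0 mul1r.
rewrite (diffusion_part_ground_state hPhi hPhip hkW eF Ex) [RHS]mulrA -expRD subrr expR0 mul1r.
rewrite (@laplacian_near _ F); last first.
  by apply: (near_regular hPhi) => // y Ey; rewrite /F cutoff_in.
by rewrite /F cutoff_in.
Qed.

Lemma regular_plateau K : compact K -> K `<=` E ->
  exists (chi : V -> R) (d : R), 0 < d /\ [/\ Cc E chi,
    forall x, 0 <= chi x, forall x, chi x <= 1,
    forall a x, Phi a -> chi (reflection a x) = chi x &
    forall z x, K z -> `|z - x| < d -> chi x = 1].
Proof.
move=> cK KE; have [N N0 hN] := cutoff_large hPhi hPhip k cK KE.
set c0 : R := flat 0 (4^-1) in hN.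
have c00 : 0 < c0 by rewrite /c0 /flat invr_gt0 ltr0n/= mulr_gt0 ?expR_gt0// exprn_gt0// invr_gt0 invr_gt0.
have CC := CK_infty_Cc (cutoff_CK_infty hPhi hPhip hk N0).
have c02 : 0 < c0 / 2 by rewrite divr_gt0.
have [d d0 hd] := Cc_equicontinuous CC c02.
(* The cutoff is at least [c0] on [K], hence at least [c0 / 2] within [d] of it. So [t] is at least
   1 there, and [chi] is the minimum of [t] and 1. *)
pose t x := 2 / c0 * cutoff N x.
have t0 x : 0 <= t x by rewrite mulr_ge0 ?divr_ge0 ?(ltW c00)// cutoff_ge0.
have tCb : Cb t by apply: CbZ; exact: Cc_Cb CC.
pose chi x := 2^-1 * (1 + t x - `|1 - t x|).
have chiCb : Cb chi.
  apply: CbZ; apply: CbB; first by apply: CbD => //; exact: Cb_cst.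
  by apply: Cb_norm; apply: CbB => //; exact: Cb_cst.
exists chi, d; split=> //; split.
- split; first by case: chiCb.
  have [_ [K' [cK' K'E K'0]]] := CC; exists K'; split=> // x /K'0.
  by rewrite /chi /t => ->; rewrite mulr0 addr0 subr0 normr1 subrr mulr0.
- move=> x; rewrite /chi; have := t0 x; move: (t x) => r r0.
  by case: (ltrgt0P (1 - r)) => h; lra.
- move=> x; rewrite /chi; move: (t x) => r.
  by case: (ltrgt0P (1 - r)) => h; lra.
- by move=> a x Pa; rewrite /chi /t cutoff_reflection.
- move=> z x Kz zx; have h1 := hN N (lexx _) z Kz; have h2 := hd z x zx.
  have : 1 <= t x.
    rewrite /t mulrAC ler_pdivlMr// mul1r.
    by move: h2; rewrite ler_norml => /andP[_]; lra.
  rewrite /chi; move: (t x) => r r1; rewrite ler0_norm; last by rewrite subr_le0.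
  by field.
Qed.

Variables (theta1 theta2 : (V -> R) -> R) (lam : R).
Hypothesis ht1 : positive_functional theta1.
Hypothesis ht2 : positive_functional theta2.
Hypothesis lam_gt0 : 0 < lam.
Hypothesis resolvent : forall u, CK_infty E u ->
  theta1 (fun x => lam * u x - L u x) = theta2 (fun x => lam * u x - L u x).
Hypothesis nonexplosion : forall eta : R, 0 < eta -> exists N0 : nat, forall N : nat, (N0 <= N)%N ->
  theta1 (fun x => `|L (cutoff N.+1%:R) x|) + theta2 (fun x => `|L (cutoff N.+1%:R) x|) <= eta.

Let jump a x : R := l a / dot x a ^+ 2.

Let jump_cont a x : a \in P -> E x -> {for x, continuous (jump a)}.
Proof.
move=> /(posroots_sub hPhi hPhip) Pa Ex.
rewrite (_ : jump a = fun x => cst (l a) x * ((dot x a)^-1 * (dot x a)^-1)).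
  apply: (elementary_continuous (D := E)) => //; apply: (elementary_mul (elementary_cst _ _)).
  by apply: elementary_mul; apply: elementary_inv (elementary_dot _ a) _ => y; exact: regular_dot_neq0.
by apply/funext => y; rewrite /jump expr2 invfM.
Qed.

Let radius (s : seq V) (K : set V) (om : R) : {subset s <= P} -> compact K -> K `<=` E -> 0 < om ->
  exists2 d : R, 0 < d & forall a, a \in s -> forall z x, K z -> `|z - x| < d ->
    `|jump a z - jump a x| <= om.
Proof.
move=> + cK KE om0; elim: s => [|a s ih] sP; first by exists 1.
have [d d0 hd] := ih (fun b bs => sP b (mem_behead (s := a :: s) bs)).
have jc x : K x -> {for x, continuous (jump a)}.
  by move=> /KE; apply: jump_cont; apply: sP; exact: mem_head.
have [d' d'0 hd'] := compact_equicontinuous cK om0 jc.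
exists (Num.min d d'); first by rewrite lt_min d0.
move=> b; rewrite inE => /orP[/eqP ->|bs] z x Kz; rewrite lt_min => /andP[? ?]; first exact: hd'.
exact: hd.
Qed.

Theorem kato_uniqueness u : Cc E u -> theta1 u = theta2 u.
Proof.
move=> uC; have [uc [K [cK KE K0]]] := uC.
have [U U0 hU] := Cc_bounded uC.
have [N0 N00 hN0] := cutoff_large hPhi hPhip k cK KE.
set c0 : R := flat 0 (4^-1) in hN0.
have c00 : 0 < c0 by rewrite /c0 /flat invr_gt0 ltr0n/= mulr_gt0 ?expR_gt0// exprn_gt0// invr_gt0 invr_gt0.
(* [c0] bounds from below on [K] all cutoffs with [N >= N0], so [A] does not depend on [N] and stays
   fixed while [eta] tends to 0. *)
pose A := U / c0; have A0 : 0 <= A := divr_ge0 (ltW U0) (ltW c00).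
suff bound (eta : R) : 0 < eta -> lam * `|theta1 u - theta2 u| <= A * (2 * eta).
  apply/eqP; rewrite -subr_eq0 -normr_le0 -(pmulr_rle0 _ lam_gt0).
  apply/ler_addgt0Pr => r r0; rewrite add0r.
  have r' : 0 < r / (2 * (A + 1)) by rewrite divr_gt0// mulr_gt0// ltr_wpDl.
  apply: (le_trans (bound _ r')).
  have -> : A * (2 * (r / (2 * (A + 1)))) = A / (A + 1) * r by field; rewrite gt_eqF// ltr_wpDl.
  by rewrite ler_piMl ?(ltW r0)// ler_pdivrMr ?ltr_wpDl// mul1r lerDl.
move=> eta0; have [N1 hN1] := nonexplosion eta0.
have [N [NN0 NN1]] : exists N : nat, N0 <= N.+1%:R /\ (N1 <= N)%N.
  exists (maxn N1 (Num.truncn N0)); split; last exact: leq_maxl.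
  have /ltW h := truncnS_gt N0; apply: (le_trans h).
  by rewrite ler_nat ltnS leq_maxr.
have {hN1}small := hN1 N NN1.
have Np : 0 < N.+1%:R :> R by [].
set psi := cutoff N.+1%:R in small.
have psiCK : CK_infty E psi := cutoff_CK_infty hPhi hPhip hk Np.
have LC := dunkl_laplacian_Cc hPhi hPhip k l psiCK.
pose G x := expR (logw x) * psi x.
have GC : CK_infty E G := weighted_cutoff_CK_infty Np.
have [BG BG0 hBG] := Cc_bounded (CK_infty_Cc GC).
have [_ [KG [cKG KGE KG0]]] := CK_infty_Cc GC.
pose PP x := `|expR (logw x) * L psi x|.
have PPC : Cc E PP.
  by apply: Cc_norm; apply: CcM => // x Ex; exact: (elementary_continuous Ew Ex).
pose hu x := expR (logw x) * u x.
have huC : Cc E hu by apply: CcM => // x Ex; exact: (elementary_continuous Ew Ex).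
have [Uh Uh0 hUh] := Cc_bounded huC.
have [chi [d1 [d10 [chiC chi0 chi1 chir chin]]]] := regular_plateau cKG KGE.
have huG x : `|hu x| <= A * G x.
  rewrite /hu /G normrM (gtr0_norm (expR_gt0 _)) mulrCA ler_wpM2l ?expR_ge0//.
  have [Kx|/K0 ->] := pselect (K x).
    rewrite /A mulrAC ler_pdivlMr// ler_pM//; first exact: ltW.
    exact: hN0.
  by rewrite normr0 mulr_ge0// cutoff_ge0.
(* The weights cancel, and [chi] is 1 wherever [u] is not 0: there the cutoff is positive, so the
   point lies in [KG]. *)
have whu : (fun x => expR (- logw x) * chi x * hu x) = u.
  apply/funext => x; rewrite /hu mulrACA -expRD addNr expR0 mul1r.
  have [->|ux] := eqVneq (u x) 0; first by rewrite mulr0.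
  rewrite (chin x) ?mul1r ?subrr ?normr0//.
  apply: contrapT => /KG0 /eqP; rewrite mulf_eq0 gt_eqF ?expR_gt0//= => /eqP p0.
  have Kx : K x by apply: contrapT => /K0 /eqP; rewrite (negbTE ux).
  by have := hN0 _ NN0 x Kx; rewrite -/psi p0 leNgt c00.
pose mass := theta1 (fun x => expR (- logw x) * chi x) + theta2 (fun x => expR (- logw x) * chi x).
have ineq (om : R) : 0 < om -> lam * `|theta1 u - theta2 u| <=
  A * (2 * (theta1 (fun x => expR (- logw x) * chi x * PP x) +
            theta2 (fun x => expR (- logw x) * chi x * PP x))
       + om * (4 * mass + BG * mass + 2 * BG * mass * (1 + 2 * (size P)%:R) + (size P)%:R))
  + lam * (om * (2 + Uh) * mass).
  move=> om0.
  have pc x : KG x -> {for x, continuous pot}.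
    by move=> /KGE Ex; exact: (elementary_continuous (elementary_potential hPhi hPhip k) Ex).
  have [e1 e10 he1] := compact_equicontinuous cKG om0 pc.
  have [e2 e20 he2] := radius (fun a aP => aP) cKG KGE om0.
  have [e3 e30 he3] := Cc_equicontinuous PPC om0.
  have [e4 e40 he4] := Cc_equicontinuous huC om0.
  pose e := Num.min (Num.min d1 e1) (Num.min e2 (Num.min e3 e4)) / 2.
  have m0 : 0 < Num.min (Num.min d1 e1) (Num.min e2 (Num.min e3 e4)).
    by rewrite !lt_min d10 e10 e20 e30 e40.
  have e0 : 0 < e by rewrite divr_gt0.
  have : e < Num.min (Num.min d1 e1) (Num.min e2 (Num.min e3 e4)).
    by rewrite /e ltr_pdivrMr// ltr_pMr// ltr1n.
  rewrite !lt_min => /andP[/andP[ed1 ee1] /andP[ee2 /andP[ee3 ee4]]].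
  rewrite -whu; apply: (@kato_conclusion R n Phi Phip hPhi hPhip k l hkW theta1 theta2 lam
    ht1 ht2 lam_gt0 resolvent chi KG d1 chiC chi0 chir chin e e0 ed1 hl G PP BG om GC
    _ _ _ _ PPC _ _ om0 _ _ _ hu A Uh mass huC A0 huG hUh _ erefl).
  - by move=> z; rewrite mulr_ge0 ?expR_ge0 ?cutoff_ge0.
  - by move=> z; rewrite (le_trans (ler_norm _)).
  - by move=> z /eqP Gz; apply: contrapT => /KG0.
  - by move=> a z Pa; rewrite /G /psi (logw_reflection hPhi hPhip hkW)// cutoff_reflection.
  - by move=> z; exact: normr_ge0.
  - by move=> z; rewrite /G /psi weighted_cutoff_potential// ler_norm.
  - by move=> z x Kz xz; rewrite distrC; apply: he1 => //; rewrite distrC (le_lt_trans xz).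
  - by move=> a z x aP Kz xz; rewrite distrC; apply: he2 => //; rewrite distrC (le_lt_trans xz).
  - move=> x z xz; have := he3 x z (le_lt_trans xz ee3).
    by rewrite ler_norml => /andP[+ _]; lra.
  - by move=> x z xz; rewrite distrC; apply: he4; exact: le_lt_trans xz ee4.
have wPP : theta1 (fun x => expR (- logw x) * chi x * PP x) +
            theta2 (fun x => expR (- logw x) * chi x * PP x) <= eta.
  have C1 : Cb (fun x => `|L psi x|) by apply: Cb_norm; exact: Cc_Cb LC.
  have e1 : (fun x => expR (- logw x) * chi x * PP x) = fun x => chi x * `|L psi x|.
    apply/funext => x; rewrite /PP normrM (gtr0_norm (expR_gt0 _)) mulrACA -expRD addNr expR0.
    by rewrite mul1r.
  have C2 : Cb (fun x => chi x * `|L psi x|) by apply: CbM => //; exact: Cc_Cb chiC.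
  have le x : chi x * `|L psi x| <= `|L psi x| by rewrite ler_piMl.
  by rewrite e1 (le_trans _ small)// lerD// pf_le.
apply/ler_addgt0Pr => r r0.
(* The total coefficient of [om]. It depends on [N] through [BG], [Uh] and [mass]'s plateau or
   weight, but is fixed before [om] is chosen. *)
pose Q := A * (4 * mass + BG * mass + 2 * BG * mass * (1 + 2 * (size P)%:R) + (size P)%:R)
   + lam * ((2 + Uh) * mass).
have om0 : 0 < r / (`|Q| + 1) by rewrite divr_gt0// ltr_wpDl.
have := ineq _ om0; move: wPP.
set X := theta1 _ + theta2 _; set om := r / _ => wPP h; apply: (le_trans h).
have omQ : om * Q <= r.
  rewrite /om mulrAC ler_pdivrMr ?ltr_wpDl// ler_pM2l// (le_trans (ler_norm _))//.
  by rewrite lerDl.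
have AX : A * (2 * X) <= A * (2 * eta) by rewrite ler_wpM2l// ler_pM2l.
apply: le_trans (lerD AX omQ); rewrite le_eqVlt; apply/orP; left; apply/eqP.
have final (a m' s x o b h' lm : R) : a * (2 * x + o * (4 * m' + b * m' + 2 * b * m' * (1 + 2 * s) + s))
    + lm * (o * (2 + h') * m') = a * (2 * x) + o * (a * (4 * m' + b * m' + 2 * b * m' * (1 + 2 * s) + s)
    + lm * ((2 + h') * m')) by ring.
exact: final.
Qed.

End KatoUniqueness.

(** * Laplace transforms *)

Section MeasurableProjections.
Context d1 d2 d3 (T1 : measurableType d1) (T2 : measurableType d2) (T3 : measurableType d3).

Lemma measurable_comp_fst (f : T1 -> T3) : measurable_fun setT f ->
  measurable_fun setT (fun z : T1 * T2 => f z.1).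
Proof.
move=> mf; apply: (@measurableT_comp _ _ _ _ _ _ f setT (fun z : T1 * T2 => z.1)) => //.
exact: measurable_fst.
Qed.

Lemma measurable_comp_snd (f : T2 -> T3) : measurable_fun setT f ->
  measurable_fun setT (fun z : T1 * T2 => f z.2).
Proof.
move=> mf; apply: (@measurableT_comp _ _ _ _ _ _ f setT (fun z : T1 * T2 => z.2)) => //.
exact: measurable_snd.
Qed.

End MeasurableProjections.
Arguments measurable_comp_fst {d1 d2 d3 T1} T2 {T3 f}.
Arguments measurable_comp_snd {d1 d2 d3} T1 {T2 T3 f}.

Section RightContinuous.
Context {R : realType}.
Local Notation mu := (@lebesgue_measure R).

(** Rounding time up to a grid of step [1/(m+1)] gives functions piecewise constant in time; right
    continuity gives their convergence. *)
Lemma measurable_right_continuous d (T : measurableType d) (g : R -> T -> R) :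
  (forall t, measurable_fun setT (g t)) ->
  (forall t w, g s w @[s --> t^'+] --> g t w) ->
  measurable_fun setT (fun z : R * T => g z.1 z.2).
Proof.
move=> mg cg.
(* Strictly larger than [t], even at grid points, as convergence is along [t^'+]. *)
pose q (m : nat) (t : R) : R := ((Num.floor (t * m.+1%:R) + 1)%:~R) / m.+1%:R.
have q_gt m t : t < q m t.
  by rewrite /q ltr_pdivlMr// -floor_lt_int ltzD1.
have q_le m t : q m t <= t + m.+1%:R^-1.
  by rewrite /q ler_pdivrMr// mulrDl mulVf// intrD lerD2r floor_le.
apply: (@measurable_fun_cvg _ _ _ _ (fun m z => g (q m z.1) z.2)).
  move=> m _ B mB; rewrite setTI.
  pose F (j : int) : set (R * T) :=
    `[j%:~R / m.+1%:R, (j + 1)%:~R / m.+1%:R[ `*` (g ((j + 1)%:~R / m.+1%:R) @^-1` B).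
  suff -> : (fun z : R * T => g (q m z.1) z.2) @^-1` B = \bigcup_j F j.
    apply: countable_bigcupT_measurable => // j; apply: measurableX => //.
    by rewrite -[_ @^-1` _]setTI; exact: mg.
  have floorE (t : R) (j : int) : `[j%:~R / m.+1%:R, (j + 1)%:~R / m.+1%:R[%classic t ->
      Num.floor (t * m.+1%:R) = j.
    rewrite /= in_itv/= ler_pdivrMr// ltr_pdivlMr// => h; exact: floor_def.
  apply/seteqP; split=> [[t w]/= gB|[t w] [j _ []/= /floorE jE]].
    exists (Num.floor (t * m.+1%:R)) => //; split=> //=.
    rewrite in_itv/= ler_pdivrMr// ltr_pdivlMr// floor_le/=.
    by rewrite -floor_lt_int ltzD1.
  by rewrite /q jE.
move=> [t w] _ /=.
have := cg t w => /cvg_at_rightP; apply; split=> [m|]; first exact: q_gt.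
apply: (@squeeze_cvgr _ _ _ _ (cst t) (fun m => t + m.+1%:R^-1)).
- by apply: nearW => m; rewrite (ltW (q_gt m t)) q_le.
- exact: cvg_cst.
- rewrite -[X in _ --> X]addr0; apply: cvgD; [exact: cvg_cst|exact: cvg_harmonic].
Qed.

Lemma measurable_fun_right_continuous (a : R -> R) :
  (forall t, a s @[s --> t^'+] --> a t) -> measurable_fun setT a.
Proof.
move=> ca; have := @measurable_right_continuous _ R (fun t _ => a t)
  (fun t => measurable_cst _) (fun t _ => ca t).
by move=> /(measurableT_comp)/(_ (measurable_fun_pair (@measurable_id _ R setT) (@measurable_id _ R setT))).
Qed.

End RightContinuous.

Section LaplaceTransform.
Context {R : realType}.
Local Notation mu := (@lebesgue_measure R).
Implicit Types (a b : R -> R) (t s lam M c : R).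

Lemma measurable_expNM lam (D : set R) : measurable_fun D (fun t => expR (- lam * t)).
Proof.
by apply: measurable_funTS; apply: measurableT_comp => //; exact: measurable_funM.
Qed.

Lemma integral_expNM lam s : 0 < lam ->
  (\int[mu]_(t in `[s, +oo[) (expR (- lam * t))%:E = (expR (- lam * s) / lam)%:E)%E.
Proof.
move=> lam0.
have dF (x : R) : is_derive x (1 : R) (fun t => - (expR (- lam * t) / lam)) (expR (- lam * x)).
  have h1 : is_derive x (1 : R) (fun t : R => - lam * t) (- lam).
    have := is_deriveZ (- lam) (is_derive_id x (1 : R)).
    by rewrite /GRing.scale/= mulr1.
  have h2 := is_derive1_comp (is_derive_expR (- lam * x)) h1.
  have h3 := is_deriveZ (- lam^-1) h2.
  rewrite (_ : (fun t => - _) = - lam^-1 \*: (expR \o (fun t : R => - lam * t))).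
    apply: (is_derive_eq h3); rewrite /GRing.scale/=; field; exact: lt0r_neq0.
  apply/funext => t; transitivity (- lam^-1 * expR (- lam * t)) => //.
  by rewrite [RHS]mulNr [in RHS]mulrC.
have cF : continuous (fun t => - (expR (- lam * t) / lam)).
  by move=> x; apply/differentiable_continuous/derivable1_diffP; case: (dF x).
have cf : continuous (fun t : R => expR (- lam * t)).
  move=> x; apply: (@continuous_comp _ _ _ (fun t : R => - lam * t) expR); last exact: continuous_expR.
  exact: mulrl_continuous.
rewrite (@ge0_continuous_FTC2y _ _ (fun t => - (expR (- lam * t) / lam)) _ 0).
- by rewrite sub0e -EFinN opprK.
- by move=> x _; exact: expR_ge0.
- exact: continuous_subspaceT.
- rewrite -oppr0; apply: cvgN; rewrite -[X in _ --> X](mul0r lam^-1); apply: cvgMr_tmp.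
  rewrite (_ : (fun x => _) = (fun z => expR (- z)) \o (fun z => lam * z)); last first.
    by apply/funext => x /=; rewrite mulNr.
  apply: (@cvg_comp _ _ _ _ _ _ (pinfty_nbhs R)); last exact: cvgr_expR.
  exact: gt0_cvgMry.
- by move=> x _; case: (dF x).
- apply: cvg_at_right_filter; exact: cF.
- by move=> x _; rewrite derive1E; case: (dF x).
Qed.

Lemma integrable_expNM lam s : 0 < lam ->
  mu.-integrable `[s, +oo[ (EFin \o (fun t => expR (- lam * t))).
Proof.
move=> lam0; apply/integrableP; split.
  by apply/measurable_EFinP; exact: measurable_expNM.
under eq_integral do rewrite /= ger0_norm ?expR_ge0//.
by rewrite integral_expNM// ltry.
Qed.

Lemma integrable_laplace lam s a M : 0 < lam -> measurable_fun setT a ->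
  (forall t, `|a t| <= M) ->
  mu.-integrable `[s, +oo[ (EFin \o (fun t => expR (- lam * t) * a t)).
Proof.
move=> lam0 ma aM.
have h : mu.-integrable `[s, +oo[ (fun t => M%:E * (expR (- lam * t))%:E)%E.
  by apply: integrableZl => //; exact: integrable_expNM.
apply: (le_integrable _ _ _ h) => //.
  apply/measurable_EFinP; apply: measurable_funM; first exact: measurable_expNM.
  exact: measurable_funTS.
move=> t _ /=; rewrite lee_fin normrM (ger0_norm (expR_ge0 _)) mulrC.
rewrite normrM (ger0_norm (expR_ge0 _)) ler_wpM2r ?expR_ge0//.
exact: le_trans (ler_norm _).
Qed.

Definition laplace lam s a : R := \int[mu]_(t in `[s, +oo[) (expR (- lam * t) * a t).

Lemma integrable_itv_bounded s t a M : measurable_fun setT a -> (forall r, `|a r| <= M) ->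
  mu.-integrable `[s, t] (EFin \o a).
Proof.
move=> ma aM; apply: measurable_bounded_integrable => //.
- by rewrite /= lebesgue_measure_itv; case: ifP => _; rewrite ?ltry.
- exact: measurable_funTS.
- exists M; split; first exact: num_real.
  by move=> N MN r _; rewrite /= (le_trans (aM r))// ltW.
Qed.

Lemma laplaceD lam s a b M N : 0 < lam -> measurable_fun setT a -> measurable_fun setT b ->
  (forall t, `|a t| <= M) -> (forall t, `|b t| <= N) ->
  laplace lam s (fun t => a t + b t) = laplace lam s a + laplace lam s b.
Proof.
move=> lam0 ma mb aM bN; rewrite -RintegralD//.
- by apply: eq_Rintegral => t _; rewrite mulrDr.
- exact: integrable_laplace aM.
- exact: integrable_laplace bN.
Qed.

Lemma laplaceZ lam s c a M : 0 < lam -> measurable_fun setT a -> (forall t, `|a t| <= M) ->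
  laplace lam s (fun t => c * a t) = c * laplace lam s a.
Proof.
move=> lam0 ma aM; rewrite -RintegralZl//; last exact: integrable_laplace aM.
by apply: eq_Rintegral => t _; rewrite mulrCA.
Qed.

Lemma laplace_cst lam s c : 0 < lam -> laplace lam s (cst c) = c * (expR (- lam * s) / lam).
Proof.
move=> lam0; rewrite /laplace /cst RintegralZr//; last exact: integrable_expNM.
by rewrite mulrC /Rintegral integral_expNM.
Qed.

(** Tonelli on the region [s <= r <= t]: integrating [exp(-lam t)] over [t >= r] gives
    [exp(-lam r) / lam]. *)
Lemma laplace_antiderivative_ge0 lam s a M : 0 < lam -> measurable_fun setT a ->
  (forall t, 0 <= a t) -> (forall t, `|a t| <= M) ->
  mu.-integrable `[s, +oo[ (EFin \o (fun t => expR (- lam * t) * \int[mu]_(r in `[s, t]) a r)) /\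
  laplace lam s (fun t => \int[mu]_(r in `[s, t]) a r) = lam^-1 * laplace lam s a.
Proof.
move=> lam0 ma a0 aM.
pose F (z : R * R) : R := if (s <= z.2) && (z.2 <= z.1) then expR (- lam * z.1) * a z.2 else 0.
have mF : measurable_fun setT F.
  apply: measurable_fun_ifT => //.
    by apply: measurable_and; apply: measurable_fun_ler.
  apply: measurable_funM.
    exact: (measurable_comp_fst R (measurable_expNM lam (D := setT))).
  exact: (measurable_comp_snd R ma).
have F0 z : (0 <= (F z)%:E)%E.
  by rewrite /F lee_fin; case: ifP => // _; rewrite mulr_ge0 ?expR_ge0.
have mEF : measurable_fun setT (EFin \o F) by apply/measurable_EFinP.
have := @fubini_tonelli _ _ _ _ R mu mu (EFin \o F) mEF F0.
have left t : (\int[mu]_r (F (t, r))%:E =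
    if (s <= t)%R then (expR (- lam * t) * \int[mu]_(r in `[s, t]) a r)%:E else 0)%E.
  rewrite (_ : (fun r => _) = ((fun r => (expR (- lam * t) * a r)%:E) \_ `[s, t])); last first.
    apply/funext => r; rewrite /F/= patchE; case: ifPn => [h|h].
      by rewrite ifT// inE/= in_itv.
    by rewrite ifF//; apply/negbTE; rewrite notin_setE/= in_itv/=; exact/negP.
  rewrite -integral_mkcond; case: ifPn => [st|].
    rewrite EFinM /Rintegral fineK; last first.
      by apply: integrable_fin_num => //; exact: integrable_itv_bounded aM.
    under eq_integral do rewrite EFinM.
    rewrite ge0_integralZl_EFin ?expR_ge0//.
      by move=> r _; rewrite lee_fin.
    by apply/measurable_EFinP; exact: measurable_funTS.
  rewrite -ltNge => ts; rewrite set_itv_ge ?integral_set0//.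
  by rewrite bnd_simp -ltNge.
have right r : (\int[mu]_t (F (t, r))%:E =
    if (s <= r)%R then (a r * (expR (- lam * r) / lam))%:E else 0)%E.
  case: ifPn => sr; last first.
    by rewrite integral0_eq// => t _; rewrite /F/= (negbTE sr).
  rewrite (_ : (fun t => _) = ((fun t => (a r * expR (- lam * t))%:E) \_ `[r, +oo[)); last first.
    apply/funext => t; rewrite /F/= sr/= patchE; case: ifPn => [h|h].
      by rewrite ifT ?inE/= ?in_itv/= ?h// mulrC.
    by rewrite ifF//; apply/negbTE; rewrite notin_setE/= in_itv/= andbT; exact/negP.
  rewrite -integral_mkcond; under eq_integral do rewrite EFinM.
  rewrite ge0_integralZl_EFin// ?integral_expNM//.
  by apply/measurable_EFinP; exact: measurable_expNM.
have mG : measurable_fun `[s, +oo[ (EFin \o (fun t => expR (- lam * t) * \int[mu]_(r in `[s, t]) a r)).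
  have := @measurable_fun_fubini_tonelli_F _ _ _ _ R mu (EFin \o F) mEF F0.
  move=> /(measurable_funS (E := setT) (D := `[s, +oo[%classic) measurableT (@subsetT _ _)).
  apply: eq_measurable_fun => t; rewrite inE/= in_itv/= andbT => st.
  by rewrite /fubini_F/= left st.
under eq_integral do rewrite left.
under [RHS]eq_integral do rewrite right.
rewrite (_ : (fun t => _) = ((fun t => (expR (- lam * t) * \int[mu]_(r in `[s, t]) a r)%:E) \_ `[s, +oo[)); last first.
  apply/funext => t; rewrite patchE; congr (if _ then _ else _).
  by rewrite mem_setE in_itv/= andbT.
rewrite -integral_mkcond.
rewrite (_ : (fun t => if s <= t then (a t * _)%:E else _) =
    ((fun t => (lam^-1 * (expR (- lam * t) * a t))%:E) \_ `[s, +oo[)); last first.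
  apply/funext => t; rewrite patchE mem_setE in_itv/= andbT; case: ifP => // _.
  by congr (_%:E); rewrite mulrC [RHS]mulrC mulrAC.
rewrite -integral_mkcond => eq.
have ia : mu.-integrable `[s, +oo[ (EFin \o (fun t => lam^-1 * (expR (- lam * t) * a t))).
  rewrite (_ : EFin \o _ = fun t => (lam^-1%:E * (expR (- lam * t) * a t)%:E)%E) //.
  by apply: integrableZl => //; exact: integrable_laplace aM.
split; last by rewrite /laplace -RintegralZl// ?/Rintegral ?eq//; exact: integrable_laplace aM.
apply/integrableP; split => //.
under eq_integral do rewrite /= ger0_norm ?mulr_ge0 ?expR_ge0 ?Rintegral_ge0//.
rewrite eq; have /integrableP[_] := ia; apply: le_lt_trans.
by apply: le_integral => //; [exact: integrable_abse|move=> t _; rewrite lee_fin ler_norm].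
Qed.

Lemma laplace_antiderivative lam s (a B : R -> R) M : 0 < lam ->
  measurable_fun setT a -> measurable_fun setT B ->
  (forall t, `|a t| <= M) -> (forall t, `|B t| <= M) ->
  (forall t, s <= t -> B t = B s + \int[mu]_(r in `[s, t]) a r) ->
  lam * laplace lam s B = expR (- lam * s) * B s + laplace lam s a.
Proof.
move=> lam0 ma mB aM BM BE.
have M0 : 0 <= M by exact: le_trans (aM 0).
(* Adding [M] makes the integrand nonnegative, as Tonelli requires; the constant is subtracted
   afterwards. *)
have mc : measurable_fun setT (fun t => a t + M) by exact: measurable_funD.
have [i1 e1] := @laplace_antiderivative_ge0 lam s (fun t => a t + M) (M + M) lam0 mc
  (fun t => ltac:(have := aM t; rewrite ler_norml => /andP[]; lra))
  (fun t => ltac:(by rewrite (le_trans (ler_normD _ _))// lerD// ger0_norm)).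
have [i2 e2] := @laplace_antiderivative_ge0 lam s (cst M) M lam0 (measurable_cst _)
  (fun _ => M0) (fun _ => ltac:(by rewrite /cst ger0_norm)).
have e3 : laplace lam s (fun t => B t - B s) =
    laplace lam s (fun t => \int[mu]_(r in `[s, t]) (a r + M)) -
    laplace lam s (fun t => \int[mu]_(r in `[s, t]) M).
  rewrite /laplace -RintegralB//; apply: eq_Rintegral => t; rewrite inE/= in_itv/= andbT => st.
  rewrite -mulrBr BE// addrAC subrr add0r RintegralD//.
  - by rewrite addrK.
  - exact: integrable_itv_bounded aM.
  - exact: (@integrable_itv_bounded _ _ (cst M) `|M|).
rewrite e1 e2 in e3.
rewrite (laplaceD (M := M) (N := M) _ lam0 ma (measurable_cst M) aM) in e3; last first.
  by move=> t; rewrite /cst ger0_norm.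
rewrite (laplaceD (M := M) (N := M) _ lam0 mB (measurable_cst (- B s)) BM) in e3; last first.
  by move=> t; rewrite /cst normrN.
rewrite !(laplace_cst s _ lam0) in e3.
have final (l b a' e' b0 : R) : 0 < l -> b + - b0 * (e' / l) = l^-1 * (a' + M * (e' / l)) - l^-1 * (M * (e' / l)) ->
    l * b = e' * b0 + a'.
  move=> l0 h; have -> : b = b0 * (e' / l) + l^-1 * a' by lra.
  by field; rewrite gt_eqF.
exact: final e3.
Qed.

(* The weights (1 - (exp(-t) - c)^2)^m concentrate near a point where a is nonzero. *)
Lemma laplace_injective s (a : R -> R) M : 0 <= s -> (forall t, a r @[r --> t^'+] --> a t) ->
  (forall t, `|a t| <= M) ->
  (forall m : nat, laplace m.+1%:R s a = 0) -> forall t, s <= t -> a t = 0.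
Proof.
move=> s0 ca aM lap0 t st; apply/eqP; apply: contrapT => /negP at0.
have ma := measurable_fun_right_continuous ca.
have M0 : 0 <= M by exact: le_trans (aM 0).
wlog {at0} at0 : a ca aM lap0 ma / 0 < a t.
  move=> H; have [a_gt|] := ltP 0 (a t); first exact: (H a).
  rewrite le_eqVlt (negbTE at0)/= => a_lt; apply: (H (fun r => -1 * a r)).
  - by move=> r; apply: cvgMl_tmp; exact: ca.
  - by move=> r; rewrite mulN1r normrN.
  - by move=> m; rewrite (@laplaceZ _ _ _ _ M)// lap0 mulr0.
  - exact: measurable_funM.
  - by rewrite mulN1r oppr_gt0.
have [r r0 har] : exists2 r : R, 0 < r & forall q, t <= q < t + r -> a t / 2 <= a q.
  have /cvgrPdist_lt/(_ (a t / 2)) := ca t.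
  rewrite divr_gt0// => /(_ isT)[r /= r0 h]; exists r => // q /andP[].
  rewrite le_eqVlt => /orP[/eqP <- _|tq qr]; first by rewrite ler_pdivrMr// ler_peMr ?(ltW at0)// ler1n.
  have := h q _ tq; rewrite /= distrC gtr0_norm ?subr_gt0// ltrBlDl => /(_ qr).
  by rewrite ltr_norml => /andP[_]; lra.
(* The new variable [exp(-q)], frozen for [q < s] so that it stays in []0, 1]] on the whole line. *)
pose y q : R := expR (- Num.max s q).
have yE q : s <= q -> y q = expR (- q) by move=> sq; rewrite /y max_r.
have y01 q : 0 < y q <= 1.
  by rewrite expR_gt0 -[leRHS]expR0 ler_expR oppr_le0 le_max s0.
have my : measurable_fun setT y.
  by apply: measurableT_comp => //; apply: measurableT_comp => //; exact: measurable_maxr.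
(* Bounded weights orthogonal to [a], even after multiplication by powers of [y], hence a class
   stable under polynomials in [y]. The hypothesis at [m + 1] is the case of [y ^+ m]. *)
pose null (g : R -> R) := [/\ measurable_fun setT g, (exists N, forall q, `|g q| <= N) &
  forall j, laplace 1 s (fun q => g q * y q ^+ j * a q) = 0].
have null1 : null (cst 1).
  split; [exact: measurable_cst|by exists 1 => q; rewrite normr1|move=> j].
  rewrite -(lap0 j); apply: eq_Rintegral => q; rewrite inE/= in_itv/= andbT => sq.
  rewrite /cst mul1r mulrA; congr (_ * _); rewrite yE// -expRM_natl -expRD; congr expR.
  by rewrite -[j.+1%:R]natr1 -mulr_natr; ring.
have null_bounded g j : null g -> measurable_fun setT (fun q => g q * y q ^+ j * a q) /\
    exists N, forall q, `|g q * y q ^+ j * a q| <= N.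
  move=> [mg [N gN] _]; split.
    by apply: measurable_funM => //; apply: measurable_funM => //; exact: measurable_funX.
  exists (N * M) => q; have /andP[y0 y1] := y01 q.
  rewrite 2!normrM ler_pM ?mulr_ge0// (le_trans (ler_piMr _ _) (gN q))//.
  by rewrite normrX gtr0_norm// exprn_ile1// ltW.
have null_mul g (b0 b1 b2 : R) : null g -> null (fun q => g q * (b0 + b1 * y q + b2 * y q ^+ 2)).
  move=> ng; have [mg [N gN] g0] := ng; split.
  - apply: measurable_funM => //; apply: measurable_funD; last first.
      by apply: measurable_funM => //; exact: measurable_funX.
    by apply: measurable_funD => //; exact: measurable_funM.
  - exists (N * (`|b0| + `|b1| + `|b2|)) => q; rewrite normrM ler_pM//.
    have /andP[y0 y1] := y01 q.
    rewrite (le_trans (ler_normD _ _))// lerD//.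
      by rewrite (le_trans (ler_normD _ _))// lerD// normrM ler_piMr// gtr0_norm.
    by rewrite normrM ler_piMr// normrX gtr0_norm// expr_le1// ltW.
  - move=> j.
    have [m0 [N0 h0]] := null_bounded _ j ng; have [m1 [N1 h1]] := null_bounded _ j.+1 ng.
    have [m2 [N2 h2]] := null_bounded _ j.+2 ng.
    transitivity (laplace 1 s (fun q => b0 * (g q * y q ^+ j * a q) +
        (b1 * (g q * y q ^+ j.+1 * a q) + b2 * (g q * y q ^+ j.+2 * a q)))).
      by apply: eq_Rintegral => q _; rewrite !exprS; ring.
    have bz (f : R -> R) (b K : R) : (forall q, `|f q| <= K) -> forall q, `|b * f q| <= `|b| * K.
      by move=> fK q; rewrite normrM ler_wpM2l.
    rewrite (@laplaceD _ _ _ _ (`|b0| * N0) (`|b1| * N1 + `|b2| * N2))//; last 4 first.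
    - exact: measurable_funM.
    - by apply: measurable_funD; exact: measurable_funM.
    - exact: (bz _ b0 _ h0).
    - by move=> q; rewrite (le_trans (ler_normD _ _))// lerD//; [exact: (bz _ b1 _ h1 q)|exact: (bz _ b2 _ h2 q)].
    rewrite (@laplaceD _ _ _ _ (`|b1| * N1) (`|b2| * N2))//; last 4 first.
    - exact: measurable_funM.
    - exact: measurable_funM.
    - exact: (bz _ b1 _ h1).
    - exact: (bz _ b2 _ h2).
    by rewrite (@laplaceZ _ _ _ _ N0)// (@laplaceZ _ _ _ _ N1)// (@laplaceZ _ _ _ _ N2)// !g0 !mulr0 !addr0.
(* For times after [s], [y] differs from [c] by at least [kp] off [[t, t + r[], and by at most
   [kp / 2] on [[p, q2]], which lies inside the interval where [a] is bounded below. *)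
pose p := t + r / 2; pose c := expR (- p).
have c0 : 0 < c by exact: expR_gt0.
have tp : t < p by rewrite ltrDl divr_gt0.
have pr : p < t + r by rewrite ltrD2l ltr_pdivrMr// ltr_pMr// ltr1n.
pose kp := Num.min (expR (- t) - c) (c - expR (- (t + r))).
have kp0 : 0 < kp by rewrite lt_min !subr_gt0 !ltr_expR !ltrN2 tp pr.
have kpl : kp <= expR (- t) - c by rewrite ge_min lexx.
have kpr : kp <= c - expR (- (t + r)) by rewrite ge_min lexx orbT.
have etr : 0 < expR (- (t + r)) by exact: expR_gt0.
have et1 : expR (- t) <= 1 by rewrite -[leRHS]expR0 ler_expR oppr_le0 (le_trans s0).
have kc : 0 < c - kp / 2 by lra.
pose q2 := - ln (c - kp / 2).
have eq2 : expR (- q2) = c - kp / 2 by rewrite opprK lnK ?posrE.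
have pq2 : p < q2 by rewrite -ltrN2 -ltr_expR eq2 -/c; lra.
have q2r : q2 <= t + r by rewrite -lerN2 -ler_expR eq2; lra.
pose W m q := (1 - (y q - c) ^+ 2) ^+ m.
have nullW m : null (W m).
  elim: m => [|m ih]; first by rewrite (_ : W 0 = cst 1)//; apply/funext => q; rewrite /W expr0.
  rewrite (_ : W m.+1 = fun q => W m q * ((1 - c ^+ 2) + 2 * c * y q + (- 1) * y q ^+ 2)).
    exact: null_mul.
  by apply/funext => q; rewrite /W exprSr; congr (_ * _); ring.
pose step (u q : R) : R := if u <= q then 1 else 0.
have lap_step u : s <= u -> laplace 1 s (step u) = expR (- u).
  move=> su; rewrite /laplace.
  transitivity (\int[mu]_(q in `[u, +oo[) expR (- 1 * q)); last first.
    by rewrite /Rintegral integral_expNM// mulN1r divr1.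
  rewrite [RHS]Rintegral_mkcond [LHS]Rintegral_mkcond; apply: eq_Rintegral => q _.
  rewrite !patchE !mem_setE !in_itv/= !andbT /step.
  case: (leP u q) => uq; first by rewrite (le_trans su uq) mulr1.
  by rewrite mulr0; case: ifP.
pose A m : R := a t / 2 * (1 - kp ^+ 2 / 4) ^+ m.
pose Bm m : R := M * (1 - kp ^+ 2) ^+ m.
have k1 : kp < 1 by lra.
have k2 : 0 <= 1 - kp ^+ 2 by rewrite subr_ge0 expr_le1// ltW.
have k4 : 0 < 1 - kp ^+ 2 / 4 by move: k2; clear; lra.
(* The product is at least [A m] on [[p, q2[], at least 0 on the rest of [[t, t + r[], and at least
   [- Bm m] elsewhere. *)
have lower m q : s <= q -> A m * (step p q - step q2 q) - Bm m <= W m q * a q.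
  move=> sq; rewrite /step.
  have /andP[yq0 yq1] := y01 q.
  have cl1 : c < 1 by lra.
  have W0 : 0 <= 1 - (y q - c) ^+ 2 by move: c0 cl1 yq0 yq1; clear; nra.
  have Wm0 : 0 <= W m q by exact: exprn_ge0.
  have B0 : 0 <= Bm m by rewrite mulr_ge0// exprn_ge0.
  have A0 : 0 <= A m by rewrite mulr_ge0 ?divr_ge0 ?exprn_ge0 ?(ltW at0) ?(ltW k4).
  have [inI|out] := boolP (t <= q < t + r).
    have aq := har q inI; have aq0 : 0 <= a q by lra.
    have [pq|qp] := leP p q; last first.
      rewrite ifF; last by apply/negbTE; rewrite -ltNge; lra.
      by rewrite subrr mulr0 sub0r (le_trans _ (mulr_ge0 Wm0 aq0))// oppr_le0.
    have [q2q|qq2] := leP q2 q.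
      by rewrite subrr mulr0 sub0r (le_trans _ (mulr_ge0 Wm0 aq0))// oppr_le0.
    rewrite subr0 mulr1 (@le_trans _ _ (A m))//; first by lra.
    rewrite /A mulrC ler_pM//; [by rewrite exprn_ge0 ?(ltW k4)|exact: divr_ge0 (ltW at0) _|].
    have y1 : y q <= c by rewrite yE// ler_expR lerN2.
    have y2 : c - kp / 2 <= y q by rewrite yE// -eq2 ler_expR lerN2 ltW.
    rewrite /W lerXn2r ?nnegrE ?(ltW k4)//.
    by move: kp0 y1 y2; clear; nra.
  have far : kp <= `|y q - c|.
    move: out; rewrite negb_and -ltNge -leNgt => /orP[qt|tq].
      have : expR (- t) <= y q by rewrite yE// ler_expR lerN2 ltW.
      by move=> h; rewrite (le_trans _ (ler_norm _))//; lra.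
    have : y q <= expR (- (t + r)) by rewrite yE// ler_expR lerN2.
    by move=> h; rewrite distrC (le_trans _ (ler_norm _))//; lra.
  have z0 : step p q - step q2 q = 0.
    rewrite /step; move: out; rewrite negb_and -ltNge -leNgt => /orP[qt|tq].
      by rewrite !ifF ?subrr//; apply/negbTE; rewrite -ltNge; lra.
    by rewrite !ifT ?subrr//; lra.
  rewrite -/(step p q) -/(step q2 q) z0 mulr0 sub0r.
  have : W m q * `|a q| <= Bm m.
    rewrite mulrC /Bm ler_pM// /W lerXn2r ?nnegrE//.
    by rewrite lerD2l lerN2 -[leRHS](real_normK (num_real _)) lerXn2r ?nnegrE// ltW.
  have h1 : 0 <= a q + `|a q| by have := ler_norm (- a q); rewrite normrN; lra.
  move=> h2; have := mulr_ge0 Wm0 h1; rewrite mulrDr; lra.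
have ineq m : a t / 2 * (1 - kp ^+ 2 / 4) ^+ m * (kp / 2) <= M * (1 - kp ^+ 2) ^+ m.
  have mstep u : measurable_fun setT (step u).
    by apply: measurable_fun_ifT => //; exact: measurable_fun_ler.
  have bstep u q : `|step u q| <= 1 by rewrite /step; case: ifP => _; rewrite ?normr1 ?normr0.
  have [mW [N hN]] := null_bounded _ 0%N (nullW m).
  have [_ _ /(_ 0%N)] := nullW m; rewrite (_ : (fun q => _) = fun q => W m q * a q); last first.
    by apply/funext => q; rewrite expr0 mulr1.
  rewrite (_ : (fun q => _) = fun q => W m q * a q) in mW; last first.
    by apply/funext => q; rewrite expr0 mulr1.
  have {}hN q : `|W m q * a q| <= N by have := hN q; rewrite expr0 mulr1.
  have bAs u q : `|A m * step u q| <= `|A m| by rewrite normrM ler_piMr.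
  have mAs u : measurable_fun setT (fun q => A m * step u q) by exact: measurable_funM.
  have mB : measurable_fun setT (fun q : R => -1 * (A m * step q2 q) + - Bm m).
    by apply: measurable_funD => //; exact: measurable_funM.
  have bB q : `|-1 * (A m * step q2 q) + - Bm m| <= `|A m| + `|Bm m|.
    by rewrite (le_trans (ler_normD _ _))// normrN mulN1r normrN lerD.
  have e1 : laplace 1 s (fun q => A m * step p q + (-1 * (A m * step q2 q) + - Bm m)) =
      A m * (kp / 2) - Bm m * expR (- s).
    rewrite (@laplaceD _ _ _ _ `|A m| (`|A m| + `|Bm m|))//.
    rewrite (@laplaceD _ _ _ _ `|A m| `|Bm m|)//; last 3 first.
    - exact: measurable_funM.
    - by move=> q; rewrite mulN1r normrN.
    - by move=> q; rewrite normrN.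
    rewrite (@laplaceZ _ _ (-1) _ `|A m|)//.
    rewrite !(@laplaceZ _ _ (A m) _ 1)// !lap_step//; last 2 first.
    - by lra.
    - by lra.
    by rewrite (laplace_cst _ _ ltr01) eq2 !mulN1r divr1 -/c; field.
  move=> e2.
  have : laplace 1 s (fun q => A m * step p q + (-1 * (A m * step q2 q) + - Bm m)) <=
      laplace 1 s (fun q => W m q * a q).
    apply: le_Rintegral => //.
    - apply: (@integrable_laplace _ _ _ (`|A m| + (`|A m| + `|Bm m|))) => //.
        exact: measurable_funD.
      by move=> q; rewrite (le_trans (ler_normD _ _))// lerD.
    - exact: (@integrable_laplace _ _ _ N).
    - move=> q; rewrite /= in_itv/= andbT => sq; rewrite ler_wpM2l ?expR_ge0//.
      by rewrite (le_trans _ (lower m q sq))// mulrBr mulN1r addrA.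
  rewrite e1 e2 /A /Bm subr_le0 => h; apply: (le_trans h).
  rewrite ler_piMr//; last by rewrite -[leRHS]expR0 ler_expR oppr_le0.
  by rewrite mulr_ge0// exprn_ge0.
(* The ratio of the two geometric rates; it is below 1, so a positive constant would be bounded by a
   null sequence. *)
pose ro : R := (1 - kp ^+ 2) / (1 - kp ^+ 2 / 4).
have ro01 : 0 <= ro < 1.
  rewrite /ro divr_ge0 ?(ltW k4)//= ltr_pdivrMr// mul1r.
  by move: (exprn_gt0 2 kp0); clear; lra.
have ge m : a t / 2 * (kp / 2) <= M * ro ^+ m.
  rewrite /ro expr_div_n [leRHS]mulrA ler_pdivlMr ?exprn_gt0//.
  by apply: le_trans (ineq m); rewrite mulrAC.
have : M * ro ^+ m @[m --> \oo] --> M * 0.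
  by apply: cvgMl_tmp; apply: cvg_expr; rewrite ger0_norm; case/andP: ro01.
rewrite mulr0 => /cvgrPdist_lt/(_ (a t / 2 * (kp / 2))).
rewrite !mulr_gt0 ?divr_gt0// => /(_ isT)[N _ /(_ N (leqnn N))].
rewrite /= sub0r normrN ltNge => /negP; apply.
by rewrite (le_trans (ge N))// ler_norm.
Qed.

End LaplaceTransform.

(** * Uniqueness of evolutions *)

Section Evolution.
Context {R : realType} {n : nat} (Phi Phip : set 'rV[R]_n).
Hypothesis hPhi : root_system Phi.
Hypothesis hPhip : positive_subsystem Phi Phip.
Local Notation V := 'rV[R]_n.
Local Notation E := (regular_set Phi).
Implicit Types (x y : V) (f g u : V -> R) (s t : R).
Variables k l : V -> R.
Hypothesis hk : forall a, Phi a -> 2^-1 <= k a.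
Hypothesis hkW : weyl_invariant Phi k.
Hypothesis hl : forall a, Phi a -> 0 <= l a.
Local Notation L := (dunkl_laplacian Phip k l).
Local Notation cutoff := (cutoff Phi Phip k).

(** The family [E[1_A f(X_t)]] without its process. Conservation of mass, and cutoffs that exhaust
    the mass at the starting time, record that nothing is lost at the walls or at infinity. *)
Record evolution s (a : (V -> R) -> R -> R) : Prop := Evolution {
  evolution_functional : forall t, positive_functional (a^~ t) ;
  evolution_mass : forall t, a (cst 1) t = a (cst 1) s ;
  evolution_right_continuous : forall f, Cb f -> forall t, a f r @[r --> t^'+] --> a f t ;
  evolution_generator : forall u, CK_infty E u -> forall t, s <= t ->
    a u t = a u s + \int[lebesgue_measure]_(r in `[s, t]) a (L u) r ;
  evolution_cutoff : a (cutoff j.+1%:R) s @[j --> \oo] --> flat 0 (2^-1) * a (cst 1) s }.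

Lemma pf_cst (theta : (V -> R) -> R) c : positive_functional theta ->
  theta (cst c) = c * theta (cst 1).
Proof.
move=> ht; rewrite -(pfZ ht)//; last exact: Cb_cst.
by congr (theta _); apply/funext => x; rewrite /cst mulr1.
Qed.

Lemma cutoff_le_flat N x : 0 < N -> cutoff N x <= flat 0 (2^-1).
Proof.
move=> N0; have [Ex|nEx] := pselect (E x); last first.
  by rewrite cutoff_out// flat_ge0.
rewrite cutoff_in//; apply: flat0_le.
rewrite /cutoff_arg lerBlDr lerDl divr_ge0 ?mulr_ge0 ?(ltW N0)//.
exact: le_trans (dot_ge0 x) (lyapunov_ge hPhi hPhip hk x).
Qed.

Section Resolvent.
Variables (s : R) (a : (V -> R) -> R -> R).
Hypothesis ha : evolution s a.

Lemma evolution_measurable f : Cb f -> measurable_fun setT (a f).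
Proof. by move=> Cf; apply: measurable_fun_right_continuous; exact: (evolution_right_continuous ha Cf). Qed.

Lemma evolution_bound f M : Cb f -> (forall x, `|f x| <= M) ->
  forall t, `|a f t| <= M * a (cst 1) s.
Proof.
move=> Cf fM t; have ht := evolution_functional ha t.
rewrite -(evolution_mass ha t) -(pf_cst M ht).
by apply: (pf_norm_le ht) => //; exact: Cb_cst.
Qed.

Variable lam : R.
Hypothesis lam0 : 0 < lam.

Let theta f := laplace lam s (a f).

Lemma resolvent_functional : positive_functional theta.
Proof.
split=> [c f g Cf Cg|f Cf f0]; last first.
  apply: Rintegral_ge0 => t _; rewrite mulr_ge0 ?expR_ge0//.
  exact: (pf_ge0 (evolution_functional ha t)).
have [_ [M fM]] := Cf; have [_ [N gN]] := Cg.
have mf := evolution_measurable Cf; have mg := evolution_measurable Cg.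
have bf := evolution_bound Cf fM; have bg := evolution_bound Cg gN.
rewrite /theta (_ : a _ = fun t => c * a f t + a g t); last first.
  by apply/funext => t; exact: (pf_linear (evolution_functional ha t)).
rewrite (@laplaceD _ _ _ _ _ (`|c| * (M * a (cst 1) s)) (N * a (cst 1) s))//.
- by rewrite (laplaceZ _ _ lam0 mf bf).
- exact: measurable_funM.
- by move=> t; rewrite normrM ler_wpM2l.
Qed.

Lemma resolvent_generator u : CK_infty E u ->
  theta (fun x => lam * u x - L u x) = expR (- lam * s) * a u s.
Proof.
move=> ku; have Cu := Cc_Cb (CK_infty_Cc ku).
have CL := Cc_Cb (dunkl_laplacian_Cc hPhi hPhip k l ku).
have [_ [M fM]] := Cu; have [_ [N gN]] := CL.
have mu := evolution_measurable Cu; have mL := evolution_measurable CL.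
have bu := evolution_bound Cu fM; have bL := evolution_bound CL gN.
rewrite (pfB resolvent_functional)//; last exact: CbZ.
rewrite (pfZ resolvent_functional)//.
rewrite (@laplace_antiderivative _ lam s (a (L u)) (a u)
  (Num.max (N * a (cst 1) s) (M * a (cst 1) s)))//.
- by rewrite addrK.
- by move=> t; rewrite le_max bL.
- by move=> t; rewrite le_max bu orbT.
- exact: evolution_generator.
Qed.

(** By the lower bound [- c / N] on the generator at the cutoff, the absolute value costs at most
    [2 * c / N]. By the resolvent equation the integral without absolute value is [lam * theta psi -
    exp(- lam * s) * a psi s]; as [psi <= flat 0 (2^-1)] and mass is conserved, it is bounded by the
    mass that the cutoff [psi] misses at time [s]. *)
Lemma resolvent_cutoff (eta : R) : 0 < eta -> exists N0 : nat, forall N : nat, (N0 <= N)%N ->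
  theta (fun x => `|L (cutoff N.+1%:R) x|) <= eta.
Proof.
move=> eta0; have ht := resolvent_functional.
have theta1 : theta (cst 1) = a (cst 1) s * (expR (- lam * s) / lam).
  rewrite /theta (_ : a (cst 1) = cst (a (cst 1) s)); first by rewrite laplace_cst.
  by apply/funext => t; rewrite (evolution_mass ha).
set q := \sum_(b <- posroots Phip) k b.
pose c : R := (q + 1) * (n%:R + 2 * q).
have q0 : 0 <= q.
  rewrite /q big_seq; apply: sumr_ge0 => b /(posroots_sub hPhi hPhip)/hk h; lra.
have c0 : 0 <= c by rewrite mulr_ge0// addr_ge0// mulr_ge0.
have bound N : theta (fun x => `|L (cutoff N.+1%:R) x|) <=
    expR (- lam * s) * (flat 0 (2^-1) * a (cst 1) s - a (cutoff N.+1%:R) s) +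
    2 * c * theta (cst 1) * harmonic N.
  have N0 : 0 < N.+1%:R :> R by [].
  have CK := cutoff_CK_infty hPhi hPhip hk N0.
  have CL := Cc_Cb (dunkl_laplacian_Cc hPhi hPhip k l CK).
  have Cps := Cc_Cb (CK_infty_Cc CK).
  have e1 := resolvent_generator CK.
  rewrite (pfB ht)//= in e1; last exact: CbZ.
  rewrite (pfZ ht)// in e1.
  have e2 : theta (cutoff N.+1%:R) <= flat 0 (2^-1) * theta (cst 1).
    rewrite -(pf_cst _ ht); apply: (pf_le ht) => //; first exact: Cb_cst.
    by move=> x; exact: cutoff_le_flat.
  have e3 : theta (fun x => `|L (cutoff N.+1%:R) x|) <=
      theta (L (cutoff N.+1%:R)) + 2 * (c / N.+1%:R) * theta (cst 1).
    rewrite -(pf_cst _ ht) -(pfD ht)//; last exact: Cb_cst.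
    apply: (pf_le ht); [exact: Cb_norm|by apply: CbD => //; exact: Cb_cst|move=> x].
    have := dunkl_laplacian_cutoff_ge hPhi hPhip l hk hkW x N0.
    rewrite -/q -/c /cst; have : 0 <= c / N.+1%:R by rewrite divr_ge0.
    move: (L _ x) (c / N.+1%:R) => r y y0 h.
    by rewrite ler_norml; apply/andP; split; lra.
  apply: (le_trans e3); have -> : 2 * (c / N.+1%:R) * theta (cst 1) = 2 * c * theta (cst 1) * harmonic N.
    by rewrite /=; move: (theta _) (N.+1%:R^-1) => y z; ring.
  rewrite lerD2r.
  have -> : theta (L (cutoff N.+1%:R)) = lam * theta (cutoff N.+1%:R) - expR (- lam * s) * a (cutoff N.+1%:R) s by lra.
  rewrite mulrBr lerD2r (le_trans (ler_wpM2l (ltW lam0) e2))// theta1 le_eqVlt; apply/orP; left; apply/eqP.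
  by field; rewrite gt_eqF.
have lim : expR (- lam * s) * (flat 0 (2^-1) * a (cst 1) s - a (cutoff N.+1%:R) s) +
    2 * c * theta (cst 1) * harmonic N @[N --> \oo] -->
    expR (- lam * s) * (flat 0 (2^-1) * a (cst 1) s - flat 0 (2^-1) * a (cst 1) s) +
    2 * c * theta (cst 1) * 0.
  apply: cvgD; apply: cvgMl_tmp; last exact: cvg_harmonic.
  by apply: cvgB; [exact: cvg_cst|exact: evolution_cutoff].
rewrite subrr !mulr0 addr0 in lim.
have /cvgrPdist_le/(_ eta eta0)[N0 _ hN0] := lim.
exists N0 => N NN; apply: (le_trans (bound N)).
by have := hN0 N NN; rewrite sub0r normrN; apply: le_trans; exact: ler_norm.
Qed.

End Resolvent.

(** The Laplace transforms are compared at [lam = m + 1], the values from which [laplace_injective]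
    recovers the function. *)
Theorem evolution_uniqueness s (a1 a2 : (V -> R) -> R -> R) : 0 <= s ->
  evolution s a1 -> evolution s a2 -> (forall u, CK_infty E u -> a1 u s = a2 u s) ->
  forall u, Cc E u -> forall t, s <= t -> a1 u t = a2 u t.
Proof.
move=> s0 h1 h2 a12 u Cu t st; have Cbu := Cc_Cb Cu; have [_ [M uM]] := Cbu.
apply/eqP; rewrite -subr_eq0; apply/eqP.
have m1 := evolution_measurable h1 Cbu; have m2 := evolution_measurable h2 Cbu.
have b1 := evolution_bound h1 Cbu uM; have b2 := evolution_bound h2 Cbu uM.
have b2' r : `|-1 * a2 u r| <= M * a2 (cst 1) s by rewrite mulN1r normrN.
have m2' : measurable_fun setT (fun r => -1 * a2 u r) by exact: measurable_funM.
apply: (@laplace_injective _ s (fun r => a1 u r - a2 u r) (M * a1 (cst 1) s + M * a2 (cst 1) s)) => //.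
- move=> r; apply: cvgB; first exact: (evolution_right_continuous h1).
  exact: (evolution_right_continuous h2).
- by move=> r; rewrite (le_trans (ler_normB _ _))// lerD.
move=> m; have lam0 : 0 < m.+1%:R :> R by [].
rewrite (_ : (fun r => _) = fun r => a1 u r + (-1 * a2 u r)); last first.
  by apply/funext => r; rewrite mulN1r.
rewrite (laplaceD _ lam0 m1 m2' b1 b2') (laplaceZ _ _ lam0 m2 b2) mulN1r.
apply/eqP; rewrite subr_eq0; apply/eqP.
apply: (@kato_uniqueness R n Phi Phip hPhi hPhip k l hk hkW hl
  (fun f => laplace m.+1%:R s (a1 f)) (fun f => laplace m.+1%:R s (a2 f)) m.+1%:R
  (resolvent_functional h1 lam0) (resolvent_functional h2 lam0) lam0 _ _ u Cu).
- by move=> v kv; rewrite (resolvent_generator h1 lam0 kv) (resolvent_generator h2 lam0 kv) a12.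
- move=> eta eta0; have eta2 : 0 < eta / 2 by rewrite divr_gt0.
  have [N1 hN1] := resolvent_cutoff h1 lam0 eta2.
  have [N2 hN2] := resolvent_cutoff h2 lam0 eta2.
  exists (maxn N1 N2) => N; rewrite geq_max => /andP[NN1 NN2].
  by rewrite [leRHS]splitr lerD// ?hN1// hN2.
Qed.

End Evolution.

(** * Limits and Fubini for integrals over the probability space *)

Section Convergence.
Context d (T : measurableType d) (R : realType) (mu : {finite_measure set T -> \bar R}).
Implicit Types (D : set T) (f : T -> R).

Lemma bounded_integrable D f (M : R) : measurable D -> measurable_fun setT f ->
  (forall x, `|f x| <= M) -> mu.-integrable D (EFin \o f).
Proof.
move=> mD mf fM; apply: measurable_bounded_integrable => //.
- by rewrite -ge0_fin_numE ?fin_num_measure.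
- exact: measurable_funTS.
- exists M; split; first exact: num_real.
  by move=> N MN x _; rewrite /= (le_trans (fM x))// ltW.
Qed.

Lemma Rintegral_cvg D (f_ : nat -> T -> R) f (M : R) : measurable D ->
  (forall j, measurable_fun setT (f_ j)) -> (forall j x, `|f_ j x| <= M) ->
  (forall x, f_ j x @[j --> \oo] --> f x) ->
  \int[mu]_(x in D) f_ j x @[j --> \oo] --> \int[mu]_(x in D) f x.
Proof.
move=> mD mf_ fM cf.
have mf : measurable_fun setT f by apply: (measurable_fun_cvg mf_) => x _; exact: cf.
have fb x : `|f x| <= M.
  by apply: (ler_cvg_to (cvg_norm (cf x)) (@cvg_cst _ M _ _ _)); apply: nearW => j; exact: fM.
have iM : mu.-integrable D (EFin \o cst M).
  by apply: (@bounded_integrable _ _ `|M|).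
have [_ _] : [/\ mu.-integrable D (EFin \o f),
    (\int[mu]_(x in D) `|(EFin \o f_ j) x - (EFin \o f) x| @[j --> \oo] --> 0)%E &
    (\int[mu]_(x in D) (EFin \o f_ j) x @[j --> \oo] --> \int[mu]_(x in D) (EFin \o f) x)%E].
  apply: (dominated_convergence mD) iM _ => //.
  - by move=> j; apply/measurable_EFinP; exact: measurable_funTS.
  - by apply/measurable_EFinP; exact: measurable_funTS.
  - by apply: aeW => x _; apply: cvg_EFin; [exact: nearW|exact: cf].
  - by apply: aeW => x j _; rewrite lee_fin.
move=> h; apply: fine_cvg; rewrite fineK//.
by apply: integrable_fin_num => //; exact: bounded_integrable fb.
Qed.

End Convergence.

Section FubiniTime.
Context d (T : measurableType d) (R : realType) (P : probability T R).
Local Notation mu := (@lebesgue_measure R).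

Lemma Rintegral_time_fubini (t : R) (A : set T) (h : R -> T -> R) (M : R) : measurable A ->
  measurable_fun setT (fun z : R * T => h z.1 z.2) -> (forall r w, `|h r w| <= M) ->
  \int[P]_(w in A) (\int[mu]_(r in `[0, t]) h r w) =
  \int[mu]_(r in `[0, t]) (\int[P]_(w in A) h r w).
Proof.
move=> mA mh hM; pose I : set R := `[0, t]%classic.
have mI : measurable I by exact: measurable_itv.
have muI : (mu I < +oo)%E.
  by rewrite /= lebesgue_measure_itv; case: ifP => _; rewrite ?ltry.
have mIA : measurable (I `*` A) by exact: measurableX.
pose g := EFin \o (fun z : R * T => h z.1 z.2).
have ig : (mu \x P)%E.-integrable (I `*` A) g.
  apply: measurable_bounded_integrable => //.
  - rewrite /= product_measure1E// lte_mul_pinfty//.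
      by rewrite ge0_fin_numE.
    by rewrite (le_lt_trans (probability_le1 P mA))// ltry.
  - exact: measurable_funTS.
  - exists M; split; first exact: num_real.
    by move=> N MN x _; rewrite /= (le_trans (hM _ _))// ltW.
rewrite integrable_mkcond// in ig.
have mh1 w : measurable_fun setT (h^~ w) by exact: (measurable_fun_pair1 w mh).
have mh2 r : measurable_fun setT (h r) by exact: (measurable_fun_pair2 r mh).
have i2 r : P.-integrable A (EFin \o h r) by exact: (bounded_integrable _ mA (mh2 r) (hM r)).
have i1 w : mu.-integrable I (EFin \o h^~ w).
  by apply: integrable_itv_bounded => // r; exact: hM.
have := integral12_prod_meas1 ig; rewrite -(integral21_prod_meas1 ig) => eq.
rewrite /Rintegral.
have f1 (w : T) : ((fine (\int[mu]_(r in I) (h r w)%:E)%E)%:E = \int[mu]_(r in I) (h r w)%:E)%E.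
  by apply: fineK; apply: integrable_fin_num => //; exact: i1.
have f2 (r : R) : ((fine (\int[P]_(w in A) (h r w)%:E)%E)%:E = \int[P]_(w in A) (h r w)%:E)%E.
  by apply: fineK; apply: integrable_fin_num => //; exact: i2.
transitivity (fine (\int[P]_(w in A) \int[mu]_(r in I) (h r w)%:E)%E).
  by congr fine; apply: eq_integral => w _; exact: f1.
transitivity (fine (\int[mu]_(r in I) \int[P]_(w in A) (h r w)%:E)%E); last first.
  by congr fine; apply: eq_integral => r _; rewrite f2.
congr fine; move: eq.
move=> eq; apply/esym; rewrite integral_mkcond [RHS]integral_mkcond.
apply: etrans; last apply: etrans; [|exact: eq|].
  apply: eq_integral => r _; rewrite /fubini_F patchE; case: ifPn => rI.
    rewrite [LHS]integral_mkcond; apply: eq_integral => w _.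
    by rewrite !patchE in_setX rI.
  by rewrite integral0_eq// => w _; rewrite patchE in_setX (negbTE rI).
apply: eq_integral => w _; rewrite /fubini_G patchE; case: ifPn => wA.
  rewrite [RHS]integral_mkcond; apply: eq_integral => r _.
  by rewrite !patchE in_setX wA andbT.
by rewrite integral0_eq// => r _; rewrite patchE in_setX (negbTE wA) andbF.
Qed.

End FubiniTime.

Section ContinuousMeasurable.
Context {R : realType} {n : nat}.

Lemma continuous_borel_measurable (f : 'rV[R]_n -> R) : continuous f ->
  measurable_fun setT (f : borel_rV R n -> R).
Proof.
move=> cf; apply: (measurability _ (RGenOInfty.measurableE R)) => //= _ [_ [a ->] <-].
rewrite setTI; apply: sub_sigma_algebra.
by apply: open_comp => // x _; exact: cf.
Qed.

End ContinuousMeasurable.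

(** * Solutions of the martingale problem *)

Section ProcessEvolution.
Context {R : realType} {n : nat} (Phi Phip : set 'rV[R]_n).
Hypothesis hPhi : root_system Phi.
Hypothesis hPhip : positive_subsystem Phi Phip.
Local Notation V := 'rV[R]_n.
Local Notation E := (regular_set Phi).
Implicit Types (x y : V) (f g u : V -> R) (s t r : R).
Variables k l : V -> R.
Hypothesis hk : forall a, Phi a -> 2^-1 <= k a.
Local Notation L := (dunkl_laplacian Phip k l).
Local Notation cutoff := (cutoff Phi Phip k).
Local Notation mu := (@lebesgue_measure R).

Context d (T : measurableType d) (P : probability T R) (C : set V) (X : R -> T -> V).
Variable nu : probability (borel_rV R n) R.
Hypothesis hX : martingale_problem_solution P (Dpi_paths Phi C) (CK_infty E) L nu X.

(** Constant for negative times: the path conditions concern [t >= 0], whereas right continuity is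
    wanted on the whole line. *)
Let Xp t : T -> V := X (Num.max t 0).

Let XpE t : 0 <= t -> Xp t = X t.
Proof. by move=> t0; rewrite /Xp max_l. Qed.

Let measurable_Xp t : measurable_fun setT (Xp t : T -> borel_rV R n).
Proof. by apply: (solution_measurable hX); rewrite le_max lexx orbT. Qed.

Let measurable_fXp f t : continuous f -> measurable_fun setT (fun w => f (Xp t w)).
Proof.
move=> cf; exact: (measurableT_comp (continuous_borel_measurable cf) (measurable_Xp t)).
Qed.

Let Xp_right_continuous f t w : continuous f -> f (Xp r w) @[r --> t^'+] --> f (Xp t w).
Proof.
move=> cf; apply: (@cvg_comp _ _ _ (fun r => Xp r w) f); last exact: cf.
have [_ rc _ _ _] := solution_paths hX w.
have [t0|t0] := leP 0 t.
  rewrite XpE//; apply: cvg_trans (rc t t0); apply: near_eq_cvg.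
  near=> r; rewrite XpE// (le_trans t0)// ltW//; near: r; exact: nbhs_right_gt.
apply: cvg_trans (@cvg_cst _ (Xp t w) _ (t^'+) _); apply: near_eq_cvg.
near=> r; rewrite /Xp !max_r ?(ltW t0)// ltW//; near: r; exact: nbhs_right_lt.
Unshelve. all: by end_near. Qed.

Lemma natural_filtration_measurable s A : natural_filtration X s A -> measurable A.
Proof.
apply: smallest_sub; first exact: sigma_algebra_measurable.
move=> _ [t [B [t0 _ mB ->]]]; rewrite -[_ @^-1` _]setTI.
exact: (solution_measurable hX t0).
Qed.

Variables (s : R) (A : set T).
Hypothesis s0 : 0 <= s.
Hypothesis sA : natural_filtration X s A.

Let mA : measurable A := natural_filtration_measurable sA.

Definition process_evolution f t : R := \int[P]_(w in A) f (Xp t w).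

Let a := process_evolution.

Let integrable_Xp f t : Cb f -> P.-integrable A (EFin \o (fun w => f (Xp t w))).
Proof.
by move=> [cf [M fM]]; apply: (bounded_integrable P mA (measurable_fXp t cf) (fun w => fM _)).
Qed.

Lemma process_evolution_functional t : positive_functional (a^~ t).
Proof.
split=> [c f g Cf Cg|f Cf f0]; last exact: Rintegral_ge0.
rewrite /a /process_evolution RintegralD//; last 2 first.
- exact: (integrable_Xp t (CbZ c Cf)).
- exact: integrable_Xp.
by rewrite RintegralZl//; exact: integrable_Xp.
Qed.

Lemma process_evolution_right_continuous f : Cb f ->
  forall t, a f r @[r --> t^'+] --> a f t.
Proof.
move=> [cf [M fM]] t; apply/cvg_at_rightP => q [qt cq].
apply: (@Rintegral_cvg _ _ _ P A (fun j w => f (Xp (q j) w)) (fun w => f (Xp t w)) M) => //.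
- by move=> j; exact: measurable_fXp.
- move=> w; have := @Xp_right_continuous f t w cf.
  by move=> /cvg_at_rightP; apply; split.
Qed.

(** Dominated convergence: the cutoffs converge at every point of [E], where the path space keeps
    the process. *)
Lemma process_evolution_cutoff : a (cutoff j.+1%:R) s @[j --> \oo] -->
  flat 0 (2^-1) * a (cst 1) s.
Proof.
rewrite -[X in _ --> X](pf_cst _ (process_evolution_functional s)).
have CK j : CK_infty E (cutoff j.+1%:R) by exact: cutoff_CK_infty.
apply: (@Rintegral_cvg _ _ _ P A (fun j w => cutoff j.+1%:R (Xp s w)) (fun w => flat 0 (2^-1)) 1) => //.
- by move=> j; apply: measurable_fXp; exact: (Cc_continuous (CK_infty_Cc (CK j))).
- by move=> j w; rewrite ger0_norm ?cutoff_ge0 ?cutoff_le1.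
- move=> w; apply: cvg_cutoff; rewrite XpE//.
  by have [+ _ _ _ _] := solution_paths hX w; apply.
Qed.

Let integral_generator u t : CK_infty E u -> 0 <= t -> natural_filtration X t A ->
  \int[P]_(w in A) (u (X t w) - u (X 0 w) - \int[mu]_(r in `[0, t]) L u (X r w)) =
  a u t - a u 0 - \int[mu]_(r in `[0, t]) a (L u) r.
Proof.
move=> ku t0 tA; have Cu := Cc_Cb (CK_infty_Cc ku).
have CL := Cc_Cb (dunkl_laplacian_Cc hPhi hPhip k l ku).
have [cL [M LM]] := CL; have [cu _] := Cu.
have mL : measurable_fun setT (fun z : R * T => L u (Xp z.1 z.2)).
  apply: (@measurable_right_continuous _ _ _ (fun r w => L u (Xp r w))).
    by move=> r; exact: measurable_fXp.
  by move=> r w; exact: Xp_right_continuous.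
have IE w : \int[mu]_(r in `[0, t]) L u (X r w) = \int[mu]_(r in `[0, t]) L u (Xp r w).
  by apply: eq_Rintegral => r; rewrite inE/= in_itv/= => /andP[r0 _]; rewrite XpE.
have [_ iM _] := solution_martingale hX ku.
have {}iM := integrableS measurableT mA (@subsetT _ _) (iM t t0).
have i1 := integrable_Xp t Cu; have i0 := integrable_Xp 0 Cu.
have id : P.-integrable A (EFin \o (fun w => u (Xp t w) - u (Xp 0 w))).
  by have := integrableB mA i1 i0.
(* Integrability of the time integral is read off from that of the martingale, by subtraction. *)
have ii : P.-integrable A (EFin \o (fun w => \int[mu]_(r in `[0, t]) L u (X r w))).
  have := integrableB mA id iM; apply: eq_integrable => // w _ /=.
  by rewrite -EFinB; congr EFin; rewrite !XpE//; ring.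
rewrite RintegralB//; last first.
  by apply: eq_integrable id => // w _ /=; rewrite !XpE.
rewrite RintegralB//; last 2 first.
- by apply: eq_integrable i1 => // w _ /=; rewrite !XpE.
- by apply: eq_integrable i0 => // w _ /=; rewrite !XpE.
congr (_ - _ - _).
- by apply: eq_Rintegral => w _; rewrite XpE.
- by apply: eq_Rintegral => w _; rewrite XpE.
under eq_Rintegral do rewrite IE.
exact: (@Rintegral_time_fubini _ _ _ P t A (fun r w => L u (Xp r w)) M).
Qed.

Let natural_filtrationS t : s <= t -> natural_filtration X t A.
Proof.
move=> st; apply: sub_smallest2r sA => //.
move=> _ [r [B [r0 rs mB ->]]]; exists r, B; split=> //.
exact: le_trans rs st.
Qed.

(** The martingale property is integrated over [A], an event of the sigma-algebra at time [s];
    Fubini then exchanges time and expectation. *)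
Lemma process_evolution_generator u : CK_infty E u -> forall t, s <= t ->
  a u t = a u s + \int[mu]_(r in `[s, t]) a (L u) r.
Proof.
move=> ku t st; have t0 := le_trans s0 st.
have gs := integral_generator ku s0 sA.
have gt := integral_generator ku t0 (natural_filtrationS st).
have [_ _ mart] := solution_martingale hX ku.
have [_ _ /(_ A sA) eq] := mart s t s0 st.
have {}eq : a u t - a u 0 - \int[mu]_(r in `[0, t]) a (L u) r =
    a u s - a u 0 - \int[mu]_(r in `[0, s]) a (L u) r.
  by rewrite -gs -gt /Rintegral -eq.
have CL := Cc_Cb (dunkl_laplacian_Cc hPhi hPhip k l ku).
have [_ [N gN]] := CL.
have mL : measurable_fun setT (a (L u)).
  by apply: measurable_fun_right_continuous; exact: process_evolution_right_continuous.
have bL r : `|a (L u) r| <= N * a (cst 1) s.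
  have h := process_evolution_functional r; rewrite -[a (cst 1) s]/(a (cst 1) r) -(pf_cst N h).
  by apply: (pf_norm_le h) => //; exact: Cb_cst.
have iL q : mu.-integrable `[0, q] (EFin \o a (L u)) by exact: integrable_itv_bounded bL.
have iLs : mu.-integrable `]s, t] (EFin \o a (L u)).
  by apply: integrableS (iL t) => //; apply: subset_itvr; rewrite bnd_simp.
have := @Rintegral_itvB R (a (L u)) (BLeft 0) (BRight t) s (iL t).
rewrite !bnd_simp => /(_ s0 st); rewrite Rintegral_itv_obnd_cbnd//.
move: eq; move: (\int[mu]_(r in `[0, t]) _) (\int[mu]_(r in `[0, s]) _) (\int[mu]_(r in `[s, t]) _) => q1 q2 q3.
by move: (a u t) (a u s) (a u 0) => r1 r2 r3 h1 h2; lra.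
Qed.

Lemma process_evolutionP : evolution Phi Phip k l s a.
Proof.
split.
- exact: process_evolution_functional.
- by [].
- exact: process_evolution_right_continuous.
- exact: process_evolution_generator.
- exact: process_evolution_cutoff.
Qed.

End ProcessEvolution.

(** * Uniqueness in law *)

Section LawUniqueness.
Context {R : realType} d1 d2 d (T1 : measurableType d1) (T2 : measurableType d2)
  (Y : measurableType d).
Variables (P1 : probability T1 R) (P2 : probability T2 R).

(** Uniqueness of measures on a pi-system, applied to the images of the probabilities restricted to
    [A1] and [A2]. *)
Lemma restricted_law_unique (A1 : set T1) (A2 : set T2) (f1 : T1 -> Y) (f2 : T2 -> Y)
    (G : set (set Y)) :
  measurable A1 -> measurable A2 -> measurable_fun setT f1 -> measurable_fun setT f2 ->
  G `<=` measurable -> setI_closed G -> G setT ->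
  (forall B, G B -> P1 (A1 `&` f1 @^-1` B) = P2 (A2 `&` f2 @^-1` B)) ->
  forall B, <<s G >> B -> P1 (A1 `&` f1 @^-1` B) = P2 (A2 `&` f2 @^-1` B).
Proof.
move=> mA1 mA2 mf1 mf2 Gm GI GT eqG B GB.
pose m1 := mrestr P1 mA1; pose m2 := mrestr P2 mA2.
have mE1 B' : m1 (f1 @^-1` B') = P1 (A1 `&` f1 @^-1` B') by rewrite /m1 /mrestr setIC.
have mE2 B' : m2 (f2 @^-1` B') = P2 (A2 `&` f2 @^-1` B') by rewrite /m2 /mrestr setIC.
rewrite -mE1 -mE2.
have cov : \bigcup_(j : nat) [set: Y] = setT by rewrite bigcup_const//; exists 0%N.
have H := @g_sigma_algebra_measure_unique _ R Y G Gm (fun _ => setT) (fun _ => GT) cov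
  (measure_function_pushforward__canonical__measure_function_Measure m1 mf1)
  (measure_function_pushforward__canonical__measure_function_Measure m2 mf2) GI.
apply: (H _ _ B GB).
- by move=> B' GB'; rewrite /= /pushforward; have := eqG _ GB'; rewrite -mE1 -mE2.
- move=> _; have : (m1 (f1 @^-1` setT) < +oo)%E by rewrite mE1 preimage_setT setIT (le_lt_trans (probability_le1 P1 mA1))// ltry.
  by [].
Qed.

End LawUniqueness.

Section LayerCake.
Context {R : realType} d (T : measurableType d) (P : probability T R).
Local Notation mu := (@lebesgue_measure R).

Lemma Rintegral_indic (A B : set T) : measurable A -> measurable B ->
  \int[P]_(w in A) \1_B w = fine (P (A `&` B)).
Proof. by move=> mA mB; rewrite /Rintegral integral_indic// setIC. Qed.

Let layer (N v : R) : 0 <= v <= N ->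
  \int[mu]_(r in `[0, N]) (if r < v then 1 else 0) = v.
Proof.
move=> /andP[v0 vN]; rewrite Rintegral_mkcond.
transitivity (\int[mu]_(r in `[(0:R), v[) (1 : R)).
  rewrite [RHS]Rintegral_mkcond; apply: eq_Rintegral => r _.
  rewrite !patchE !mem_setE !in_itv/=; case: (ltP r v) => rv; rewrite ?andbT ?andbF ?if_same//.
  by rewrite (le_trans (ltW rv) vN) andbT.
rewrite Rintegral_cst//= lebesgue_measure_itv/= lte_fin mul1r.
by case: ltP => [_|v0']; [rewrite /= oppr0 addr0|apply/esym/le_anti; rewrite v0 v0'].
Qed.

(** The layer cake formula for [f + M], with values in [[0, 2 * M]]. Integrals over two probability
    spaces become comparable through probabilities of events. *)
Lemma Rintegral_layer (A : set T) (f : T -> R) (M : R) : measurable A ->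
  measurable_fun setT f -> (forall w, `|f w| <= M) ->
  \int[P]_(w in A) f w = \int[mu]_(r in `[0, 2 * M])
    (fine (P (A `&` [set w | r < f w + M]))) - M * fine (P A).
Proof.
move=> mA mf fM; have M0 : 0 <= M by rewrite (le_trans _ (fM point)).
have if_ : P.-integrable A (EFin \o f) by exact: (bounded_integrable P mA mf fM).
have ic : P.-integrable A (EFin \o cst M).
  by apply: (@bounded_integrable _ _ _ P A (cst M) M mA) => // w; rewrite ger0_norm.
pose h (r : R) w : R := if r < f w + M then 1 else 0.
have mfM : measurable_fun setT (fun w => f w + M) by exact: measurable_funD.
have mh : measurable_fun setT (fun z : R * T => h z.1 z.2).
  apply: measurable_fun_ifT => //.
  by apply: measurable_fun_ltr; [exact: measurable_fst|exact: (measurable_comp_snd R mfM)].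
have hM r w : `|h r w| <= 1 by rewrite /h; case: ifP; rewrite ?normr1 ?normr0.
have := Rintegral_time_fubini P (2 * M) mA mh hM.
under eq_Rintegral => w _.
  rewrite layer; last by have := fM w; rewrite ler_norml => /andP[? ?]; apply/andP; split; lra.
  over.
under [RHS]eq_Rintegral => r _.
  rewrite (_ : \int[P]_(w in A) h r w = fine (P (A `&` [set w | r < f w + M]))); last first.
    rewrite -Rintegral_indic//; last first.
      rewrite -[X in measurable X]setTI; apply: (measurable_fun_ltr (measurable_cst r) mfM).
        exact: measurableT.
      by [].
    apply: eq_Rintegral => w _; rewrite /h indicE; case: ifPn => rw; first by rewrite mem_set.
    by rewrite memNset//=; exact/negP.
  over.
move=> <-; rewrite RintegralD// Rintegral_cst//.
by rewrite addrK.
Qed.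

End LayerCake.

Section OpenApproximation.
Context {R : realType} {n : nat}.
Local Notation V := 'rV[R]_n.
Implicit Types (O : set V) (x y : V).

Let inner_radii O x : set R := [set r | 0 <= r <= 1 /\ forall y, `|x - y| < r -> O y].

(** The distance to the complement of [O], truncated at 1 so that it is finite also when [O] is the
    whole space. *)
Let radius O x : R := sup (inner_radii O x).

Let inner_radii0 O x : inner_radii O x 0.
Proof. by split=> [|y]; rewrite ?lexx ?ler01// ltNge normr_ge0. Qed.

Let has_sup_radii O x : has_sup (inner_radii O x).
Proof. by split; [exists 0; exact: inner_radii0|exists 1 => r [/andP[]]]. Qed.

Let radius_ge0 O x : 0 <= radius O x.
Proof. by apply: sup_upper_bound => //; exact: inner_radii0. Qed.

Let radius_gt0 O x : 0 < radius O x -> O x.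
Proof.
move=> /(sup_adherent)/(_ (has_sup_radii O x))[r [_ h]]; rewrite subrr => r0.
by apply: h; rewrite subrr normr0.
Qed.

Let open_radius O x : open O -> O x -> 0 < radius O x.
Proof.
rewrite openE => oO /oO/nbhs_ballP[r /= r0 rO].
have r1 : 0 < Num.min r 1 by rewrite lt_min r0 ltr01.
apply: (lt_le_trans r1); apply: sup_upper_bound => //; split.
  by rewrite (ltW r1)/= ge_min lexx orbT.
by move=> y; rewrite lt_min => /andP[xy _]; apply: rO; rewrite -ball_normE.
Qed.

Let radius_lipschitz O x y : radius O x <= radius O y + `|x - y|.
Proof.
apply: sup_le_ub; first by case: (has_sup_radii O x).
move=> r [/andP[r0 r1] h]; rewrite -lerBlDr.
have [xr|/ltW xr] := leP r `|x - y|.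
  by rewrite (le_trans _ (radius_ge0 O y))// subr_le0.
apply: sup_upper_bound => //; split.
  by rewrite subr_ge0 xr/= (le_trans _ r1)// gerBl.
move=> z yz; apply: h; rewrite -(subrKA y) (le_lt_trans (ler_normD _ _))//.
by rewrite -ltrBrDl.
Qed.

Let radius_continuous O : continuous (radius O).
Proof.
move=> x; apply/(@cvgrPdist_le _ _ V (nbhs x) (nbhs_filter x)) => t t0.
apply: filterS (nbhsx_ballx x t t0) => y; rewrite -ball_normE/= => /ltW xy.
have h1 := radius_lipschitz O x y; have h2 := radius_lipschitz O y x.
rewrite distrC in h2; rewrite ler_norml; apply/andP; split; lra.
Qed.

Lemma open_approximation O : open O -> exists u : nat -> V -> R,
  [/\ forall j, Cc O (u j), forall j x, `|u j x| <= 1 &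
      forall x, u j x @[j --> \oo] --> (\1_O x : R)].
Proof.
move=> oO.
(* The truncation of [r] to [[0, 1]]. *)
pose pos (r : R) : R := 2^-1 * (1 + `|r| - `|1 - r|).
have pos0 r : r <= 0 -> pos r = 0.
  by move=> r0; rewrite /pos ler0_norm// ger0_norm; [field|lra].
have pos1 r : 1 <= r -> pos r = 1.
  by move=> r1; rewrite /pos ger0_norm ?ler0_norm; [field|lra..].
have pos01 r : 0 <= pos r <= 1.
  have [/pos0 ->|r0] := leP r 0; first by rewrite lexx ler01.
  have [/pos1 ->|r1] := leP 1 r; first by rewrite lexx ler01.
  by rewrite /pos !gtr0_norm; [apply/andP; split; lra|lra..].
have pos_cont (f : R -> R) : continuous f -> continuous (fun r => pos (f r)).
  move=> cf r; apply: cvgMl_tmp; apply: cvgB.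
    by apply: cvgD; [exact: cvg_cst|apply: cvg_norm; exact: cf].
  by apply: cvg_norm; apply: cvgB; [exact: cvg_cst|exact: cf].
(* Vanishes unless [radius O x > 1/j] and [|x| < j], which confines the support to a compact subset
   of [O]. *)
pose u (j : nat) x := pos (j%:R * radius O x - 1) * pos (j%:R - `|x|).
have mul_cont j : continuous (fun r : R => j%:R * r).
  by move=> r; apply: cvgMl_tmp => ?.
have r_cont j : continuous (fun x : V => j%:R * radius O x).
  move=> x; apply: (@continuous_comp _ _ _ (radius O) (fun r => j%:R * r)); last exact: mul_cont.
  exact: radius_continuous.
have n_cont : continuous (fun x : V => `|x|) by move=> x; exact: norm_continuous.
have c1 j : continuous (fun x => pos (j%:R * radius O x - 1)).
  move=> x; apply: (@continuous_comp _ _ _ (radius O) (fun r => pos (j%:R * r - 1))).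
    exact: radius_continuous.
  apply: (pos_cont (fun r => j%:R * r - 1)) => r.
  by apply: cvgB; [exact: mul_cont|exact: cvg_cst].
have c2 j : continuous (fun x : V => pos (j%:R - `|x|)).
  move=> x; apply: (@continuous_comp _ _ _ (fun x : V => `|x|) (fun r => pos (j%:R - r))).
    exact: n_cont.
  apply: (pos_cont (fun r => j%:R - r)) => r.
  by apply: cvgB; [exact: cvg_cst|move=> ?].
have u_cont j : continuous (u j) by move=> x; exact: (continuousM (c1 j x) (c2 j x)).
exists u; split=> [j|j x|x].
- split; first exact: u_cont.
  pose K : set V := [set x | 1 <= j%:R * radius O x] `&` [set x | `|x| <= j%:R].
  exists K; split.
  + apply: bounded_closed_compact.
      exists j%:R; split; first exact: num_real.
      by move=> N jN x [_ /= xj]; exact: le_trans xj (ltW jN).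
    apply: closedI.
      apply: (@closed_comp _ _ (fun x => j%:R * radius O x) [set t | 1 <= t]) => [x _|]; last exact: closed_ge.
      exact: r_cont.
    apply: (@closed_comp _ _ (fun x : V => `|x|) [set t | t <= j%:R]) => [x _|]; last exact: closed_le.
    exact: n_cont.
  + move=> x [/= h _]; apply: radius_gt0; rewrite lt_neqAle radius_ge0 andbT.
    by apply/eqP => r0; move: h; rewrite -r0 mulr0 leNgt ltr01.
  + move=> x nK; rewrite /u; have [h|h] := leP 1 (j%:R * radius O x).
      have [h2|h2] := leP `|x| j%:R; first by exfalso; apply: nK.
      by rewrite (pos0 (j%:R - _)) ?mulr0// subr_le0 ltW.
    by rewrite pos0 ?mul0r// subr_le0 ltW.
- have /andP[a0 a1] := pos01 (j%:R * radius O x - 1); have /andP[b0 b1] := pos01 (j%:R - `|x|).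
  by rewrite /u ger0_norm; [exact: mulr_ile1|exact: mulr_ge0].
- have [Ox|nOx] := pselect (O x); last first.
    rewrite indicE memNset// (_ : (fun j => u j x) = cst 0); first exact: cvg_cst.
    have r0 : radius O x = 0.
      apply/eqP; rewrite eq_le radius_ge0 andbT leNgt; apply/negP => /radius_gt0.
      exact: nOx.
    by apply/funext => j; rewrite /u r0 mulr0 sub0r pos0 ?mul0r// oppr_le0.
  rewrite indicE mem_set//; have r0 := open_radius oO Ox.
  apply: cvg_near_cst; near=> j.
  have h1 : `|x| + 1 <= j%:R by near: j; exact: nbhs_infty_ger.
  have h2 : 2 / radius O x <= j%:R by near: j; exact: nbhs_infty_ger.
  rewrite ler_pdivrMr// in h2.
  by rewrite /u (pos1 (j%:R - _)) ?(pos1 (_ - 1)) ?mulr1//; lra.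
Unshelve. all: by end_near. Qed.

End OpenApproximation.

Section LawAtTime.
Context {R : realType} {n : nat} d1 d2 (T1 : measurableType d1) (T2 : measurableType d2).
Variables (P1 : probability T1 R) (P2 : probability T2 R).
Local Notation V := 'rV[R]_n.
Variables (A1 : set T1) (A2 : set T2) (Y1 : T1 -> V) (Y2 : T2 -> V).
Hypothesis mA1 : measurable A1.
Hypothesis mA2 : measurable A2.
Hypothesis mY1 : measurable_fun setT (Y1 : T1 -> borel_rV R n).
Hypothesis mY2 : measurable_fun setT (Y2 : T2 -> borel_rV R n).

Let fin_restr d (T : measurableType d) (P : probability T R) (A B : set T) : measurable A ->
  measurable B -> P (A `&` B) \is a fin_num.
Proof. by move=> mA mB; rewrite fin_num_measure//; exact: measurableI. Qed.

Let measurable_preimage d (T : measurableType d) (Y : T -> V) (B : set (borel_rV R n)) :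
  measurable_fun setT (Y : T -> borel_rV R n) -> measurable B -> measurable (Y @^-1` B).
Proof. by move=> mY mB; rewrite -[X in measurable X]setTI; exact: mY. Qed.

(** Open sets form a pi-system, and the indicator of an open subset of [E] is a limit of functions
    in [Cc E]. As [Y1] and [Y2] take values in [E], an open set and its trace on [E] have the same
    preimage. *)
Lemma borel_law_of_Cc (E : set V) : open E -> (forall w, E (Y1 w)) -> (forall w, E (Y2 w)) ->
  (forall u, Cc E u -> \int[P1]_(w in A1) u (Y1 w) = \int[P2]_(w in A2) u (Y2 w)) ->
  forall B : set (borel_rV R n), measurable B ->
  P1 (A1 `&` Y1 @^-1` B) = P2 (A2 `&` Y2 @^-1` B).
Proof.
move=> oE E1 E2 eqCc B mB.
apply: (restricted_law_unique mA1 mA2 mY1 mY2 _ _ _ _ mB).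
- by move=> O oO; exact: sub_sigma_algebra.
- exact: openI.
- exact: openT.
move=> O oO; have mO : measurable (O : set (borel_rV R n)) by exact: sub_sigma_algebra.
have [u [uC u1 uO]] := open_approximation (openI oO oE).
have ucont j : continuous (u j) := Cc_continuous (uC j).
have uE j : Cc E (u j).
  by have [uc [K [cK KE K0]]] := uC j; split=> //; exists K; split=> // x /KE[].
have lim d (T : measurableType d) (P : probability T R) (A : set T) (Y : T -> V) :
    measurable A -> measurable_fun setT (Y : T -> borel_rV R n) -> (forall w, E (Y w)) ->
    \int[P]_(w in A) u j (Y w) @[j --> \oo] --> fine (P (A `&` Y @^-1` O)).
  move=> mA mY EY; rewrite -Rintegral_indic//; last exact: measurable_preimage.
  apply: (@Rintegral_cvg _ _ _ P A (fun j w => u j (Y w)) (fun w => \1_(Y @^-1` O) w) 1) => //.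
  - by move=> j; exact: (measurableT_comp (continuous_borel_measurable (ucont j)) mY).
  - move=> w; rewrite (_ : \1_(Y @^-1` O) w = \1_(O `&` E) (Y w))//.
    rewrite !indicE; congr (_%:R); congr nat_of_bool; apply/idP/idP => /set_mem h; apply/mem_set => //.
    by case: h.
have l1 := lim _ _ P1 A1 Y1 mA1 mY1 E1; have l2 := lim _ _ P2 A2 Y2 mA2 mY2 E2.
have {}l2 : \int[P1]_(w in A1) u j (Y1 w) @[j --> \oo] --> fine (P2 (A2 `&` Y2 @^-1` O)).
  by rewrite (_ : (fun j => _) = fun j => \int[P2]_(w in A2) u j (Y2 w))//; apply/funext => j; exact: eqCc (uE j).
have : fine (P1 (A1 `&` Y1 @^-1` O)) = fine (P2 (A2 `&` Y2 @^-1` O)).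
  exact: cvg_unique l1 l2.
move=> h; rewrite -[LHS]fineK; last by apply: fin_restr => //; exact: measurable_preimage.
by rewrite h fineK//; apply: fin_restr => //; exact: measurable_preimage.
Qed.

Lemma Rintegral_of_borel_law (f : V -> R) : Cb f ->
  (forall B : set (borel_rV R n), measurable B -> P1 (A1 `&` Y1 @^-1` B) = P2 (A2 `&` Y2 @^-1` B)) ->
  \int[P1]_(w in A1) f (Y1 w) = \int[P2]_(w in A2) f (Y2 w).
Proof.
move=> [cf [M fM]] eqB.
have mf1 := measurableT_comp (continuous_borel_measurable cf) mY1.
have mf2 := measurableT_comp (continuous_borel_measurable cf) mY2.
rewrite (Rintegral_layer P1 mA1 mf1 (fun w => fM (Y1 w))).
rewrite (Rintegral_layer P2 mA2 mf2 (fun w => fM (Y2 w))).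
have eqT : P1 A1 = P2 A2.
  by have := eqB setT (@measurableT _ _); rewrite !preimage_setT !setIT.
rewrite eqT; congr (_ - _); apply: eq_Rintegral => r _; congr fine.
apply: (eqB [set x | r < f x + M]).
rewrite -[X in measurable X]setTI; apply: (measurable_fun_ltr (measurable_cst r) _) => //.
by apply: measurable_funD => //; exact: continuous_borel_measurable.
Qed.

End LawAtTime.

Section Cylinders.
Context {R : realType} {n : nat} d (T : measurableType d).
Local Notation V := 'rV[R]_n.
Variable X : R -> T -> V.
Implicit Types (s : seq R) (t : R) (B : R -> set (borel_rV R n)).

(** Conditions are indexed by the time itself, not by its position in the list, so the event ignores
    order and repetitions and the list may be sorted. *)
Definition cylinder (s : seq R) (B : R -> set (borel_rV R n)) :
  set T := [set w | forall t, t \in s -> B t (X t w)].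

Lemma cylinder_rcons s t B :
  cylinder (rcons s t) B = cylinder s B `&` X t @^-1` B t.
Proof.
apply/seteqP; split=> w.
  move=> h; split=> [r rs|]; apply: h; rewrite mem_rcons inE ?rs ?orbT ?eqxx//.
by move=> [h1 h2] r; rewrite mem_rcons inE => /orP[/eqP ->//|]; exact: h1.
Qed.

Lemma cylinder_rconsI s t B (A : set (borel_rV R n)) :
  cylinder (rcons s t) B `&` X t @^-1` A = cylinder s B `&` X t @^-1` (B t `&` A).
Proof. by apply: etrans (esym (setIA _ _ _)); congr (_ `&` _); exact: cylinder_rcons. Qed.

Lemma natural_filtrationI t (A B : set T) :
  natural_filtration X t A -> natural_filtration X t B -> natural_filtration X t (A `&` B).
Proof. by move=> hA hB; exact: (@measurableI _ (g_sigma_algebraType _) A B hA hB). Qed.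

Lemma cylinder_adapted s B t :
  (forall r, measurable (B r)) -> (forall r, r \in s -> 0 <= r <= t) ->
  natural_filtration X t (cylinder s B).
Proof.
move=> mB; elim/last_ind: s => [|s r ih] sr.
  rewrite (_ : cylinder [::] B = setT); last by apply/seteqP; split.
  exact: (@measurableT _ (g_sigma_algebraType _)).
rewrite cylinder_rcons; apply: natural_filtrationI.
  by apply: ih => q qs; apply: sr; rewrite mem_rcons inE qs orbT.
have /andP[r0 rt] := sr r (ltac:(by rewrite mem_rcons inE eqxx)).
by apply: sub_sigma_algebra; exists r, (B r); split.
Qed.

End Cylinders.

Section FiniteDimensionalLaws.
Context {R : realType} {n : nat} (Phi Phip C : set 'rV[R]_n) (k l : 'rV[R]_n -> R).
Hypothesis hPhi : root_system Phi.
Hypothesis hPhip : positive_subsystem Phi Phip.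
Hypothesis hk : forall a, Phi a -> 2^-1 <= k a.
Hypothesis hkW : weyl_invariant Phi k.
Hypothesis hl : forall a, Phi a -> 0 <= l a.
Variable nu : probability (borel_rV R n) R.
Context d1 d2 (T1 : measurableType d1) (T2 : measurableType d2).
Variables (P1 : probability T1 R) (P2 : probability T2 R)
  (X1 : R -> T1 -> 'rV[R]_n) (X2 : R -> T2 -> 'rV[R]_n).
Hypothesis hX1 : martingale_problem_solution P1 (Dpi_paths Phi C)
  (CK_infty (regular_set Phi)) (dunkl_laplacian Phip k l) nu X1.
Hypothesis hX2 : martingale_problem_solution P2 (Dpi_paths Phi C)
  (CK_infty (regular_set Phi)) (dunkl_laplacian Phip k l) nu X2.
Local Notation V := 'rV[R]_n.
Local Notation E := (regular_set Phi).

Let same_law_at (s : R) (A1 : set T1) (A2 : set T2) :=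
  forall B : set (borel_rV R n), measurable B ->
    P1 (A1 `&` X1 s @^-1` B) = P2 (A2 `&` X2 s @^-1` B).

(** A Markov-type step. [A1] and [A2] live on different spaces and are linked only through the laws
    at time [s] restricted to them, which start two evolutions with the same initial value. *)
Lemma same_law_at_later s t A1 A2 : 0 <= s -> s <= t ->
  natural_filtration X1 s A1 -> natural_filtration X2 s A2 ->
  same_law_at s A1 A2 -> same_law_at t A1 A2.
Proof.
move=> s0 st sA1 sA2 eqs; have t0 := le_trans s0 st.
have mA1 := natural_filtration_measurable hX1 sA1.
have mA2 := natural_filtration_measurable hX2 sA2.
have ev1 := process_evolutionP hPhi hPhip hk hX1 s0 sA1.
have ev2 := process_evolutionP hPhi hPhip hk hX2 s0 sA2.
apply: (borel_law_of_Cc mA1 mA2 (solution_measurable hX1 t0) (solution_measurable hX2 t0)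
  (open_regular_set hPhi)).
- by move=> w; have [+ _ _ _ _] := solution_paths hX1 w; apply.
- by move=> w; have [+ _ _ _ _] := solution_paths hX2 w; apply.
have pe d (T : measurableType d) (P : probability T R) (X : R -> T -> V) (A : set T) (f : V -> R) r :
    0 <= r -> process_evolution P X A f r = \int[P]_(w in A) f (X r w).
  by move=> r0; rewrite /process_evolution max_l.
move=> u Cu; rewrite -(pe _ _ P1 X1 A1 u t t0) -(pe _ _ P2 X2 A2 u t t0).
apply: (evolution_uniqueness hPhi hPhip hk hkW hl s0 ev1 ev2 _ Cu st) => v kv.
rewrite (pe _ _ P1 X1 A1 v s s0) (pe _ _ P2 X2 A2 v s s0).
exact: (Rintegral_of_borel_law mA1 mA2 (solution_measurable hX1 s0) (solution_measurable hX2 s0)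
  (Cc_Cb (CK_infty_Cc kv))).
Qed.

(** Induction along increasing times, starting at time 0 with the initial law. [last 0 s] is the
    time reached; the condition at a new time is absorbed into the test set. *)
Let cylinder_law_at (B : R -> set (borel_rV R n)) s : (forall r, measurable (B r)) ->
  path <=%R 0 s -> [/\ 0 <= last 0 s, forall r, r \in s -> 0 <= r <= last 0 s &
  same_law_at (last 0 s) (cylinder X1 s B) (cylinder X2 s B)].
Proof.
move=> mB; elim/last_ind: s => [|s t ih].
  move=> _; split=> // A mA.
  have c0 d (T : measurableType d) (X : R -> T -> V) : cylinder X [::] B = setT.
    by apply/seteqP; split.
  by rewrite !c0 !setTI (solution_initial hX1)// (solution_initial hX2).
rewrite rcons_path last_rcons => /andP[ps st]; have [l0 sl eqs] := ih ps.
have t0 := le_trans l0 st; split=> // [r|A mA].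
  rewrite mem_rcons inE => /orP[/eqP ->|/sl /andP[r0 rl]]; first by rewrite t0 lexx.
  by rewrite r0 (le_trans rl).
rewrite [X in P1 X](cylinder_rconsI X1 s t B A) [X in P2 X](cylinder_rconsI X2 s t B A).
apply: (same_law_at_later l0 st _ _ eqs); last exact: measurableI.
- exact: cylinder_adapted.
- exact: cylinder_adapted.
Qed.

Let cylinder_law (B : R -> set (borel_rV R n)) s : (forall r, measurable (B r)) ->
  (forall r, r \in s -> 0 <= r) -> P1 (cylinder X1 s B) = P2 (cylinder X2 s B).
Proof.
move=> mB s0; have csort d (T : measurableType d) (X : R -> T -> V) :
    cylinder X (sort <=%R s) B = cylinder X s B.
  by apply/seteqP; split=> w h r rs; apply: h; rewrite ?mem_sort// -(mem_sort <=%R).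
have : path <=%R 0 (sort <=%R s).
  rewrite (path_sortedE le_trans) sort_sorted ?andbT; last exact: le_total.
  by apply/allP => r; rewrite mem_sort; exact: s0.
move=> /(cylinder_law_at mB)[_ _ /(_ setT measurableT)].
by rewrite !preimage_setT !setIT !csort.
Qed.

(** Finite-dimensional cylinders form a pi-system containing the generators of the path
    sigma-algebra. Paths are arbitrary functions here, so the map to path space is measurable as
    soon as each coordinate at [t >= 0] is. *)
Lemma same_path_law : same_law P1 X1 P2 X2.
Proof.
move=> A pA; rewrite -[X in P1 X]setTI -[X in P2 X]setTI.
pose gen := [set A : set (R -> V) | exists (t : R) (B : set (borel_rV R n)),
  [/\ 0 <= t, measurable B & A = [set p | B (p t)]]].
pose Y := g_sigma_algebraType gen.
pose G := [set A : set Y | exists (s : seq R) (B : R -> set (borel_rV R n)),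
  [/\ forall r, r \in s -> 0 <= r, forall r, measurable (B r) &
      A = [set p : R -> V | forall t, t \in s -> B t (p t)]]].
have genG : gen `<=` G.
  move=> _ [t [B [t0 mB ->]]]; exists [:: t], (fun=> B); split=> //.
    by move=> r; rewrite inE => /eqP ->.
  by apply/seteqP; split=> p /= h; [move=> r; rewrite inE => /eqP ->|apply: h; exact: mem_head].
have mpath d (T : measurableType d) (P : probability T R) (X : R -> T -> V) :
    (forall t, 0 <= t -> measurable_fun setT (X t : T -> borel_rV R n)) ->
    measurable_fun setT ((fun w t => X t w) : T -> Y).
  move=> mX; apply: (@measurability _ _ T Y setT _ gen) => //.
  move=> _ [_ [t [B [t0 mB ->]]] <-]; exact: mX.
have mG : G `<=` (measurable : set (set Y)).
  move=> _ [s [B [s0 mB ->]]]; elim: s s0 => [|t s ih] s0.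
    by rewrite (_ : [set p | _] = setT)//; apply/seteqP; split.
  rewrite (_ : [set p | _] = [set p | B t (p t)] `&` [set p | forall r, r \in s -> B r (p r)]).
    apply: measurableI; last by apply: ih => r rs; apply: s0; rewrite inE rs orbT.
    by apply: sub_sigma_algebra; exists t, (B t); split=> //; apply: s0; exact: mem_head.
  apply/seteqP; split=> p /=.
    by move=> h; split=> [|r rs]; apply: h; rewrite inE ?eqxx ?rs ?orbT.
  by move=> [h1 h2] r; rewrite inE => /orP[/eqP ->//|]; exact: h2.
apply: (restricted_law_unique measurableT measurableT (mpath _ _ P1 X1 (solution_measurable hX1))
  (mpath _ _ P2 X2 (solution_measurable hX2)) mG).
- move=> _ _ [s [B [s0 mB ->]]] [s' [B' [s'0 mB' ->]]].
  (* At a time absent from one of the lists the condition is the whole space, so that concatenation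
     yields the intersection. *)
  exists (s ++ s'), (fun t => (if t \in s then B t else setT) `&` (if t \in s' then B' t else setT)).
  split.
  + by move=> r; rewrite mem_cat => /orP[/s0|/s'0].
  + by move=> r; apply: measurableI; case: ifP.
  + apply/seteqP; split=> p /=.
      by move=> [h h'] t _; split; case: ifP => // ?; [exact: h|exact: h'].
    move=> h; split=> t ts.
      by have [] := h t (ltac:(by rewrite mem_cat ts)); rewrite ts.
    by have [] := h t (ltac:(by rewrite mem_cat ts orbT)); rewrite ts.
- by exists [::], (fun=> setT); split=> //; apply/seteqP; split.
- move=> _ [s [B [s0 mB ->]]]; rewrite !setTI; exact: cylinder_law.
- exact: (sub_sigma_algebra2 genG pA).
Qed.

End FiniteDimensionalLaws.

Theorem lemma18 (R : realType) (n : nat) (Phi Phip C : set 'rV[R]_n)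
    (k l : 'rV[R]_n -> R)
    (hPhi : root_system Phi)
    (hPhip : positive_subsystem Phi Phip)
    (hC : weyl_chamber Phi C)
    (hk : forall a, Phi a -> 2^-1 <= k a)
    (hkW : weyl_invariant Phi k)
    (hl : forall a, Phi a -> 0 <= l a)
    (nu : probability (borel_rV R n) R)
    (hnu : nu (regular_set Phi) = 1%E)
    (d1 d2 : measure_display) (T1 : measurableType d1) (T2 : measurableType d2)
    (P1 : probability T1 R) (P2 : probability T2 R)
    (X1 : R -> T1 -> 'rV[R]_n) (X2 : R -> T2 -> 'rV[R]_n)
    (hX1 : martingale_problem_solution P1 (Dpi_paths Phi C)
       (CK_infty (regular_set Phi)) (dunkl_laplacian Phip k l) nu X1)
    (hX2 : martingale_problem_solution P2 (Dpi_paths Phi C)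
       (CK_infty (regular_set Phi)) (dunkl_laplacian Phip k l) nu X2) :
  same_law P1 X1 P2 X2.
Proof. exact: (same_path_law hPhi hPhip hk hkW hl hX1 hX2). Qed.
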